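(* Let $\lambda>0$, let $\xi\in D(S_0)$ be an eigenvector of $\Delta_0^{1/2}$ corresponding to the eigenvalue $\lambda^2$, and fix a densely defined, closed operator $(X,D(X))$ affiliated to $M$ such that $$\xi_0\in D(X)\cap D(X^* ),\qquad \xi=X\xi_0,\qquad S_0(X\xi_0)=X^*\xi_0.$$ Then, setting $d_X^{\lambda}:=i(\lambda X-\lambda^{-1}j(X^* ))$ and $d_{X^*}^{\lambda^{-1}}:=i(\lambda^{-1}X^*-\lambda j(X))$, for all $y\in M_0$ we have $$d_X^\lambda i_0(y)=i_0(i[X,y]),\qquad d_{X^*}^{\lambda^{-1}}i_0(y)=i_0(i[X^*,y]).$$ In other words, setting $\delta_X(y):=i[X,y]$ and $\delta_{X^*}(y):=i[X^*,y]$ for $y\in M_0$, on the $^*$-algebra $M_0$ one has $d_X^\lambda\circ i_0=i_0\circ\delta_X$ and $d_{X^*}^{\lambda^{-1}}\circ i_0=i_0\circ\delta_{X^*}$.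
   Context: $(M,L^2(M),L^2_+(M),J)$ is a standard form of a $\sigma$-finite von Neumann algebra with commutant $M'$; $\omega_0$ is a faithful normal state represented by the cyclic vector $\xi_0\in L^2_+(M)$. $S_0=J\Delta_0^{1/2}$ is the polar decomposition of the closure $S_0$ of $x\xi_0\mapsto x^*\xi_0$, $x\in M$; $\sigma^{\omega_0}_t(x)=\Delta_0^{it}x\Delta_0^{-it}$ is the modular group, and $M_0\subseteq M$ is the weak$^*$-dense $^*$-subalgebra of analytic elements for it (those $x$ for which $t\mapsto\sigma^{\omega_0}_t(x)$ extends to an entire function). $i_0(x):=\Delta_0^{1/4}x\xi_0$ is the symmetric embedding $M\to L^2(M)$. A densely defined closed operator $(X,D(X))$ is affiliated to $M$ if $z'D(X)\subseteq D(X)$ and $Xz'\eta=z'X\eta$ for $z'\in M'$, $\eta\in D(X)$. $j(X):=JXJ$ with domain $JD(X)$; the domains of $d_X^\lambda$ and $d_{X^*}^{\lambda^{-1}}$ are $D(X)\cap JD(X^* )$ and $D(X^* )\cap JD(X)$. Under the stated hypotheses, for $y\in M_0$ the vector $\xi_0$ lies in the domain of the commutators $[X,y]=Xy-yX$ and $[X^*,y]$, and $[X,y]\xi_0,[X^*,y]\xi_0\in D(\Delta_0^{1/4})$; the notation $i_0([X,y])$ stands for $\Delta_0^{1/4}(Xy-yX)\xi_0$, similarly $i_0([X^*,y]):=\Delta_0^{1/4}(X^*y-yX^* )\xi_0$, and $i_0(i[X,y]):=i\,i_0([X,y])$. *)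

(* Defs.v *)
From HB Require Import structures.
From mathcomp Require Import all_boot all_order all_algebra.
From mathcomp Require Import all_classical all_reals all_analysis.
From mathcomp Require Import complex.

Set Implicit Arguments.
Unset Strict Implicit.
Unset Printing Implicit Defensive.
Import Order.TTheory GRing.Theory Num.Theory.
Import numFieldNormedType.Exports.

Local Open Scope classical_set_scope.
Local Open Scope ring_scope.
Local Open Scope complex_scope.

(* A Hilbert space is a complete normed space [H] over [R[i]] together with a
   positive definite Hermitian form [ip] inducing its norm ([hilbert] below);
   the library's forms are linear in the first argument. *)

(* An unbounded operator is represented by its graph, a [set (H * H)]. *)

Section HilbertSpace.
Context {R : realType} {H : completeNormedModType R[i]}.
Variable ip : {dot H for (@Num.conj R[i])}.
Implicit Types (a b : H -> H) (M : set (H -> H)) (T X : set (H * H)).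

Definition hilbert := forall u : H, `|u| ^+ 2 = ip u u.

Definition bounded_op a := linear a /\ continuous a.

Definition adjoint_of a b := forall u v, ip (a u) v = ip u (b v).

Definition projection a := [/\ bounded_op a, a \o a = a & adjoint_of a a].

Definition op_le a b := forall u, ip (a u) u <= ip (b u) u.

Definition positive_op a := forall u, 0 <= ip (a u) u.

Definition commutant M : set (H -> H) :=
  [set b | bounded_op b /\ forall a, M a -> a \o b = b \o a].

Definition von_neumann_algebra M :=
  (forall a, M a -> exists2 b, M b & adjoint_of a b) /\
  commutant (commutant M) = M.

Definition sigma_finite_algebra M :=
  forall Q : set (H -> H),
    (forall p, Q p -> [/\ M p, projection p & p <> \0]) ->
    (forall p q, Q p -> Q q -> p <> q -> p \o q = \0) ->
    countable Q.

Definition state M (w : (H -> H) -> R[i]) :=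
  [/\ forall c a b, M a -> M b ->
        w (fun u => c *: a u + b u) = c * w a + w b,
      forall a, M a -> positive_op a -> 0 <= w a
    & w id = 1].

Definition faithful M (w : (H -> H) -> R[i]) :=
  forall a, M a -> positive_op a -> w a = 0 -> a = \0.

(* [w] preserves suprema of increasing nets of positive elements; that [w x]
   is an upper bound already follows from the positivity of [w]. *)
Definition normal M (w : (H -> H) -> R[i]) :=
  forall (D : set (H -> H)) x, D !=set0 ->
    (forall a, D a -> M a /\ positive_op a) ->
    (forall a b, D a -> D b -> exists2 c, D c & op_le a c /\ op_le b c) ->
    M x -> (forall a, D a -> op_le a x) ->
    (forall z, M z -> (forall a, D a -> op_le a z) -> op_le x z) ->
    forall c : R[i], (forall a, D a -> w a <= c) -> w x <= c.

(* Haagerup's axioms, with [P] the self-dual positive cone *)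
Definition standard_form M (P : set H) (J : H -> H) :=
  [/\ von_neumann_algebra M,
      P = [set u | forall v, P v -> 0 <= ip u v],
      [/\ forall (c : R[i]) u v, J (c *: u + v) = Num.conj c *: J u + J v,
          forall u, J (J u) = u
        & forall u v, ip (J u) (J v) = ip v u],
      [set J \o a \o J | a in M] = commutant M
    & [/\ forall z, M z -> commutant M z -> adjoint_of z (J \o z \o J),
          forall u, P u -> J u = u
        & forall x u, M x -> P u -> P (x (J (x (J u))))]].

Definition cyclic M (xi0 : H) := dense [set x xi0 | x in M].

Definition dom T : set H := [set u | exists v, T (u, v)].

(* The value [T u] when [u] is in [dom T], and [0] otherwise *)
Definition app T (u : H) : H := xget 0 [set v | T (u, v)].

Definition graph (f : H -> H) : set (H * H) := [set p : H * H | p.2 = f p.1].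

Definition comp_op T X : set (H * H) :=
  [set p : H * H | exists v, X (p.1, v) /\ T (v, p.2)].

Definition linear_op T :=
  [/\ T (0, 0),
      forall (c : R[i]) p q, T p -> T q -> T (c *: p + q)
    & forall u v v', T (u, v) -> T (u, v') -> v = v'].

Definition densely_defined T := linear_op T /\ dense (dom T).

Definition adj T : set (H * H) :=
  [set p : H * H | forall q, T q -> ip q.2 p.1 = ip q.1 p.2].

Definition positive_selfadjoint T :=
  [/\ densely_defined T, adj T = T & forall p, T p -> 0 <= ip p.2 p.1].

Definition eigenvector T (c : R[i]) (u : H) := u <> 0 /\ T (u, c *: u).

Definition affiliated M X :=
  forall z p, commutant M z -> X p -> X (z p.1, z p.2).

(* j(X) = J X J, with domain J D(X), for an involution [J] *)
Definition jop (J : H -> H) X : set (H * H) := [set p : H * H | X (J p.1, J p.2)].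

(* i (c X - c^-1 j(Y)), with domain D(X) `&` J D(Y) *)
Definition dop (J : H -> H) (c : R) X Y : set (H * H) :=
  [set p : H * H | exists v w, [/\ X (p.1, v), jop J Y (p.1, w) &
    p.2 = 'i *: (c%:C *: v - (c^-1)%:C *: w)]].

(* [X, y] = X y - y X on its natural domain *)
Definition commutator X (y : H -> H) : set (H * H) :=
  [set p : H * H | exists v w, [/\ X (y p.1, v), X (p.1, w) & p.2 = v - y w]].

Definition projection_valued_measure (E : set R -> H -> H) :=
  [/\ forall A, measurable A -> projection (E A),
      E setT = id,
      forall A B, measurable A -> measurable B -> E (A `&` B) = E A \o E B
    & forall A : nat -> set R, (forall n, measurable (A n)) ->
        trivIset setT A -> forall u,
        (\sum_(0 <= k < n) E (A k) u) @[n --> \oo] --> E (\bigcup_n A n) u].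

Definition sqmod (z : R[i]) : R := complex.Re z ^+ 2 + complex.Im z ^+ 2.

(* The spectral integral of a Borel function [f]: the value at [u] is the image
   of [f] under the isometric extension to L^2(mu), mu A = <E A u, u>, of the
   map sending the simple function \sum_k c_k 1_(A_k) to \sum_k c_k E(A_k) u;
   the domain consists of the [u] for which [f] belongs to L^2(mu). *)
Definition spectral_integral (E : set R -> H -> H) (f : R -> R[i]) :
    set (H * H) :=
  [set p : H * H | exists mu : {measure set (measurableTypeR R) -> \bar R},
    (forall A : set R, measurable A ->
       mu A = (complex.Re (ip (E A p.1) p.1))%:E) /\
    exists s : nat -> seq (R[i] * set R),
    [/\ forall n, {in s n, forall c, measurable c.2},
        (\int[mu]_x (sqmod (f x -
            \sum_(c <- s n) c.1 * (\1_(c.2) x)%:C)%R)%:E)%E @[n --> \oo]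
          --> (0 : \bar R)
      & (\sum_(c <- s n) c.1 *: E c.2 p.1) @[n --> \oo] --> p.2]].

Definition spectral_measure (E : set R -> H -> H) T :=
  projection_valued_measure E /\ spectral_integral E (fun s => s%:C) = T.

(* s ^ z = exp (z ln s) for s > 0 *)
Definition cpow (z : R[i]) (s : R) : R[i] :=
  (s `^ complex.Re z)%:C *
  (cos (complex.Im z * ln s) +i* sin (complex.Im z * ln s)).

(* The power T^z of the positive operator T with spectral measure [E] *)
Definition op_power (E : set R -> H -> H) (z : R[i]) : set (H * H) :=
  spectral_integral E (cpow z).

(* The closure of x xi0 |-> x^* xi0 *)
Definition modular_S M (xi0 : H) : set (H * H) :=
  closure [set p : H * H | exists x y,
    [/\ M x, adjoint_of x y, p.1 = x xi0 & p.2 = y xi0]].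

(* Delta^(it) x Delta^(-it), with [E] the spectral measure of Delta *)
Definition modular_group (E : set R -> H -> H) (t : R) (x : H -> H) :
    set (H * H) :=
  comp_op (op_power E ('i * t%:C))
    (comp_op (graph x) (op_power E (- ('i * t%:C)))).

(* Complex differentiability in operator norm *)
Definition entire (F : R[i] -> H -> H) :=
  forall z : R[i], exists2 D, bounded_op D &
    forall e : R[i], 0 < e -> exists2 d : R[i], 0 < d &
      forall h u, h != 0 -> `|h| < d ->
        `|h^-1 *: (F (z + h) u - F z u) - D u| <= e * `|u|.

Definition analytic_elements M (E : set R -> H -> H) : set (H -> H) :=
  [set x | M x /\ exists F : R[i] -> H -> H,
    [/\ forall z, M (F z), entire F
      & forall t : R, graph (F t%:C) = modular_group E t x]].

(* The value at xi0 of an operator [T] is in the domain of Delta^(1/4) *)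
Definition embeddable (E : set R -> H -> H) (xi0 : H) T :=
  dom T xi0 /\ dom (op_power E (4^-1)%:C) (app T xi0).

(* Delta^(1/4) T xi0, the symmetric embedding extended to unbounded [T] *)
Definition symmetric_embedding (E : set R -> H -> H) (xi0 : H) T : H :=
  app (op_power E (4^-1)%:C) (app T xi0).

End HilbertSpace.

(* Main.v *)
Require Import Defs.
From HB Require Import structures.
From mathcomp Require Import all_boot all_order all_algebra.
From mathcomp Require Import all_classical all_reals all_analysis.
From mathcomp Require Import measurable_realfun.
From mathcomp Require Import complex.
From mathcomp Require Import ring lra zify.
Import Order.TTheory GRing.Theory Num.Theory.
Import numFieldNormedType.Exports.
Local Open Scope classical_set_scope.
Local Open Scope ring_scope.
Local Open Scope complex_scope.
Set Implicit Arguments.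
Unset Strict Implicit.
Unset Printing Implicit Defensive.

(* The integral of a Borel function f against the spectral measure Q of log Delta
   maps u to v exactly when |Q(B)(v - c u)| <= e |Q(B) u| for every Borel set B
   on which f is within e of c; the calculus of the unbounded powers Delta^z then
   reduces to estimates on small sets.

   From S0 = J Delta^(1/2) = S0^-1 one gets J Delta^(1/2) J = Delta^(-1/2), and a
   growth argument then shows that J reflects Q, whence J Delta^(1/4) =
   Delta^(-1/4) J. For y in M_0 with entire orbit F, and v with log Delta v =
   theta v, the identity theorem (Goursat on rectangles and a Landau kernel)
   identifies Delta^a (y v) with e^(a theta) F(-i a) v.

   Since y xi0 = J F(i/2)^* xi0 and i0(y) = F(-i/4) xi0 = J F(i/4)^* xi0, where
   J F(z)^* J lies in M', affiliation gives X y xi0 = J F(i/2)^* J xi and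
   X i0(y) = J F(i/4)^* J xi; similarly X^* J i0(y) = J F(-i/4) J X^* xi0.
   Applying Delta^(1/4) to (X y - y X) xi0 and using that xi and J xi are
   eigenvectors of log Delta gives d_X i0(y), up to the factor i. *)

(** * Entire functions *)

(** Three unbounded objects meet: the powers of Delta, defined through L^2 limits of simple
    functions; an affiliated [X], accessible only through M'; and the orbit F, tied to Delta on the
    real line alone. The estimate on Borel sets keeps domains harmless: lying in the domain of a
    quotient or of a limit becomes a conclusion instead of a side condition. Passing to log Delta
    turns products of powers into sums of exponents and inversion into a reflection of the line; it
    is possible because S0 is injective. The operator Delta^a y Delta^(-a) is never formed. It is
    only evaluated at eigenvectors of log Delta, where Delta^(-a) is a number; xi0, xi and J xi are
    such vectors, with eigenvalues 0, 4 ln lambda and -4 ln lambda. The relation Delta^(1/4) xi =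
    lambda xi is the origin of the weights in the derivations. The second identity is the first one
    for X^* and 1/lambda, because X^* xi0 = lambda^2 J xi is an eigenvector of Delta^(1/2) for
    lambda^(-2). *)

Section ComplexModulus.
Context {R : realType}.
Local Notation C := R[i].
Implicit Types (z w h : C) (r : R).

(** The norm of [R[i]] is itself complex-valued; a real-valued modulus keeps the estimates in a
    totally ordered field. *)
Definition cmod z : R := Normc.normc z.

Lemma cmodE z : `|z| = (cmod z)%:C.
Proof. by []. Qed.

Lemma cmod_ge0 z : 0 <= cmod z.
Proof. by case: z => a b; apply: sqrtr_ge0. Qed.

Lemma cmod0 : cmod 0 = 0.
Proof. exact: Normc.normc0. Qed.

Lemma cmodM z w : cmod (z * w) = cmod z * cmod w.
Proof. exact: Normc.normcM. Qed.

Lemma cmodX z n : cmod (z ^+ n) = cmod z ^+ n.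
Proof.
elim: n => [|n IHn]; first by rewrite !expr0 /cmod Normc.normc1.
by rewrite !exprS cmodM IHn.
Qed.

Lemma cmodD z w : cmod (z + w) <= cmod z + cmod w.
Proof. exact: le_normcD. Qed.

Lemma cmodN z : cmod (- z) = cmod z.
Proof. exact: normcN. Qed.

Lemma cmodB z w : cmod (z - w) <= cmod z + cmod w.
Proof. by rewrite -(cmodN w) cmodD. Qed.

Lemma cmodC z w : cmod (z - w) = cmod (w - z).
Proof. by rewrite -cmodN opprB. Qed.

Lemma cmod_eq0 z : cmod z = 0 -> z = 0.
Proof. exact: Normc.eq0_normc. Qed.

Lemma cmod_real r : cmod r%:C = `|r|.
Proof. by rewrite /cmod /= expr0n addr0 sqrtr_sqr. Qed.

Lemma cmod_sqr z : cmod z ^+ 2 = complex.Re z ^+ 2 + complex.Im z ^+ 2.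
Proof. by case: z => a b; rewrite /cmod /= sqr_sqrtr// addr_ge0 ?sqr_ge0. Qed.

Lemma ler_Re_cmod z : `|complex.Re z| <= cmod z.
Proof.
rewrite -(ler_pXn2r (_ : 0 < 2)%N) ?nnegrE ?cmod_ge0//.
by rewrite cmod_sqr real_normK ?num_real// lerDl sqr_ge0.
Qed.

Lemma ler_Im_cmod z : `|complex.Im z| <= cmod z.
Proof.
rewrite -(ler_pXn2r (_ : 0 < 2)%N) ?nnegrE ?cmod_ge0//.
by rewrite cmod_sqr real_normK ?num_real// lerDr sqr_ge0.
Qed.

Lemma cmod_ler_ReIm z : cmod z <= `|complex.Re z| + `|complex.Im z|.
Proof.
rewrite [z in cmod z]complexE (le_trans (cmodD _ _))// cmodM !cmod_real.
by rewrite {1}/cmod /= expr0n/= expr1n add0r sqrtr1 mul1r.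
Qed.

Lemma cmod_conjc z : cmod (conjc z) = cmod z.
Proof. by case: z => a b; rewrite /cmod /= sqrrN. Qed.

Lemma cmod_ler_sum (I : Type) (s : seq I) (F : I -> C) :
  cmod (\sum_(i <- s) F i) <= \sum_(i <- s) cmod (F i).
Proof.
elim: s => [|i s IHs]; first by rewrite !big_nil cmod0.
by rewrite !big_cons (le_trans (cmodD _ _))// lerD2l.
Qed.

End ComplexModulus.
Arguments cmod {R} z : simpl never.

Section ComplexDifferentiable.
Context {R : realType}.
Local Notation C := R[i].

(** Division-free, so that [h = 0] is no exception. Continuity of the derivative is not part of it,
    whence Goursat's subdivision argument below. *)
Definition cderivable (f : C -> C) := forall z, exists d, forall e : R, 0 < e ->
  exists2 r : R, 0 < r & forall h, cmod h < r ->
    cmod (f (z + h) - f z - d * h) <= e * cmod h.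

Lemma cderivable_cst c : cderivable (fun=> c).
Proof.
move=> z; exists 0 => e e0; exists 1 => // h _.
by rewrite /= subrr mul0r subr0 cmod0 mulr_ge0 ?cmod_ge0// ltW.
Qed.

Lemma cderivable_id : cderivable id.
Proof.
move=> z; exists 1 => e e0; exists 1 => // h _.
have -> : id (z + h) - id z - 1 * h = 0 by rewrite /=; ring.
by rewrite cmod0 mulr_ge0 ?cmod_ge0// ltW.
Qed.

Lemma cderivableD f g : cderivable f -> cderivable g ->
  cderivable (fun z => f z + g z).
Proof.
move=> fd gd z; have [a fa] := fd z; have [b gb] := gd z.
exists (a + b) => e e0; have e20 : 0 < e / 2 by rewrite divr_gt0.
have [r r0 rf] := fa _ e20; have [s s0 sg] := gb _ e20.
exists (Num.min r s) => [|h]; first by rewrite lt_min r0.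
rewrite lt_min => /andP[/rf rh /sg sh].
have -> : f (z + h) + g (z + h) - (f z + g z) - (a + b) * h =
  (f (z + h) - f z - a * h) + (g (z + h) - g z - b * h) by ring.
by rewrite (le_trans (cmodD _ _))// (le_trans (lerD rh sh))//; lra.
Qed.

Lemma cderivable_continuous f : cderivable f -> forall z (e : R), 0 < e ->
  exists2 r : R, 0 < r & forall h, cmod h < r -> cmod (f (z + h) - f z) < e.
Proof.
move=> fd z e e0; have [a fa] := fd z; have [r r0 rf] := fa 1 ltr01.
have a0 := cmod_ge0 a; have a2 : 0 < cmod a + 2 by lra.
exists (Num.min r (e / (cmod a + 2))) => [|h].
  by rewrite lt_min r0 divr_gt0.
rewrite lt_min ltr_pdivlMr// => /andP[/rf rh he].
have -> : f (z + h) - f z = (f (z + h) - f z - a * h) + a * h by ring.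
have h0 := cmod_ge0 h.
rewrite (le_lt_trans (cmodD _ _))// cmodM (le_lt_trans (lerD rh (lexx _)))//.
have [->|hn0] := eqVneq (cmod h) 0; first by rewrite !mulr0 addr0.
by have : 0 < cmod h by [rewrite lt_neqAle eq_sym hn0]; nra.
Qed.

Lemma cderivableM f g : cderivable f -> cderivable g ->
  cderivable (fun z => f z * g z).
Proof.
move=> fd gd z; have [a fa] := fd z; have [b gb] := gd z.
exists (a * g z + f z * b) => e e0.
(* The product has three error terms; [e3] solves [e3 * (K + e) = e], hence is at most 1 and leaves
   room for all of them. *)
have [e3 [e30 e31 e3E]] : exists e3, [/\ 0 < e3, e3 <= 1 &
    e3 * ((cmod (f z) + cmod (g z) + cmod a + 1) * 3 + e) = e].
  set K := (_ + 1) * 3; have K0 : 0 < K.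
    by rewrite mulr_gt0// ltr_wpDl// !addr_ge0// cmod_ge0.
  exists (e / (K + e)); split; first by rewrite divr_gt0// addr_gt0.
    by rewrite ler_pdivrMr ?addr_gt0// mul1r lerDr ltW.
  by rewrite divfK// gt_eqF// addr_gt0.
have [r r0 rf] := fa _ e30; have [s s0 sg] := gb _ e30.
have [t t0 tg] := cderivable_continuous gd z e30.
exists (Num.min r (Num.min s t)) => [|h]; first by rewrite !lt_min r0 s0.
rewrite !lt_min => /and3P[/rf rh /sg sh /tg th].
have -> : f (z + h) * g (z + h) - f z * g z - (a * g z + f z * b) * h =
  (f (z + h) - f z - a * h) * (g z + (g (z + h) - g z)) +
  ((a * h) * (g (z + h) - g z) + f z * (g (z + h) - g z - b * h)) by ring.
rewrite (le_trans (cmodD _ _))// (le_trans (lerD (lexx _) (cmodD _ _)))// !cmodM.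
have := cmodD (g z) (g (z + h) - g z).
move: (cmod_ge0 (g z + (g (z + h) - g z))) rh sh th.
move: (cmod_ge0 (f (z + h) - f z - a * h)) (cmod_ge0 (g (z + h) - g z - b * h)).
move: (cmod_ge0 (g (z + h) - g z)).
move: (cmod (g z + _)) (cmod (f (z + h) - _ - _)) (cmod (g (z + h) - g z - _)).
move: (cmod (g (z + h) - g z)) => p q u v.
move: (cmod_ge0 h) (cmod_ge0 a) (cmod_ge0 (f z)) (cmod_ge0 (g z)).
move: (cmod h) (cmod a) (cmod (f z)) (cmod (g z)) e3E => H A F G e3E.
move=> H0 A0 F0 G0 p0 u0 v0 q0 uH vH pe qG.
have q1 : q <= G + 1 by lra.
have h1 : u * q <= e3 * H * (G + 1) by apply: ler_pM.
have h2 : A * H * p <= A * H * e3 by rewrite ler_wpM2l ?mulr_ge0// ltW.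
have h3 : F * v <= F * (e3 * H) by rewrite ler_wpM2l.
have -> : e * H = e3 * ((F + G + A + 1) * 3 + e) * H by rewrite e3E.
have m0 : 0 <= e3 * H by rewrite mulr_ge0// ltW.
have := mulr_ge0 m0 A0; have := mulr_ge0 m0 F0; have := mulr_ge0 m0 G0.
have := mulr_ge0 m0 (ltW e0); nra.
Qed.

Lemma cderivableX f n : cderivable f -> cderivable (fun z => f z ^+ n).
Proof.
move=> fd; elim: n => [|n IHn]; first exact: cderivable_cst.
rewrite (_ : (fun z => _) = (fun z => f z * f z ^+ n)); first exact: cderivableM.
by apply/funext => z; rewrite exprS.
Qed.

Lemma cderivable_scale f c : cderivable f -> cderivable (fun z => f (c * z)).
Proof.
move=> fd z; have [a fa] := fd (c * z); exists (a * c) => e e0.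
have c0 := cmod_ge0 c; have c10 : 0 < cmod c + 1 by rewrite ltr_wpDl.
have [r r0 rf] := fa (e / (cmod c + 1)) (divr_gt0 e0 c10).
exists (r / (cmod c + 1)) => [|h]; first by rewrite divr_gt0.
rewrite ltr_pdivlMr// => hr; have h0 := cmod_ge0 h.
have ch : cmod (c * h) < r by rewrite cmodM; nra.
have := rf _ ch; rewrite mulrDr mulrA => /le_trans; apply.
by rewrite cmodM -mulrA ler_pM2l// ler_pdivrMl// ler_wpM2r// lerDl.
Qed.

End ComplexDifferentiable.

(** * Primitives on segments and Goursat's theorem for rectangles *)

Section Goursat.
Context {R : realType}.
Local Notation C := R[i].

(** Componentwise, because the extreme value theorem and the fundamental theorem of calculus are
    applied to real functions. *)
Definition ccontinuous (g : R -> C) :=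
  continuous (fun x => complex.Re (g x)) /\ continuous (fun x => complex.Im (g x)).

Lemma ccontinuousP (g : R -> C) :
  (forall x (e : R), 0 < e -> exists2 r : R, 0 < r & forall h, `|h| < r ->
    cmod (g (x + h) - g x) < e) -> ccontinuous g.
Proof.
move=> gc; split=> x; apply/cvgrPdist_lt => e e0; have [r r0 rg] := gc x e e0.
- near=> t; have /rg : `|t - x| < r.
    by rewrite distrC; near: t; apply: cvgr_dist_lt.
  rewrite subrKC => /(le_lt_trans (ler_Re_cmod _)).
  by rewrite raddfB/= distrC.
- near=> t; have /rg : `|t - x| < r.
    by rewrite distrC; near: t; apply: cvgr_dist_lt.
  rewrite subrKC => /(le_lt_trans (ler_Im_cmod _)).
  by rewrite raddfB/= distrC.
Unshelve. all: by end_near. Qed.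

Lemma cderivable_line (f : C -> C) p q : cderivable f ->
  ccontinuous (fun x : R => f (p + q * x%:C)).
Proof.
move=> fd; apply: ccontinuousP => x e e0.
have [r r0 rf] := cderivable_continuous fd (p + q * x%:C) e0.
have q0 := cmod_ge0 q; have q10 : 0 < cmod q + 1 by rewrite ltr_wpDl.
exists (r / (cmod q + 1)) => [|h]; first by rewrite divr_gt0.
rewrite ltr_pdivlMr// => hr.
rewrite rmorphD/= mulrDr addrA; apply: rf.
rewrite cmodM cmod_real; have := normr_ge0 h; nra.
Qed.

Lemma cbounded (g : R -> C) a b : ccontinuous g ->
  exists2 K : R, 0 <= K & forall x, a <= x <= b -> cmod (g x) <= K.
Proof.
move=> [gr gi]; have [ab|ba] := leP a b; last first.
  exists 0 => // x /andP[ax xb]; have := le_trans ax xb.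
  by rewrite leNgt ba.
have bnd (u : R -> R) : continuous u ->
    exists K, forall x, a <= x <= b -> `|u x| <= K.
  move=> uc; have nuc : continuous (fun x => `|u x|).
    by move=> x; apply: continuous_comp; [exact: uc|exact: norm_continuous].
  have [c _ cP] := EVT_max ab (continuous_subspaceT nuc).
  by exists `|u c| => x xab; apply: cP; rewrite in_itv.
have [K KP] := bnd _ gr; have [L LP] := bnd _ gi.
exists (Num.max 0 (K + L)) => [|x xab]; first by rewrite le_max lexx.
rewrite le_max; apply/orP; right.
by rewrite (le_trans (cmod_ler_ReIm _))// lerD// ?KP ?LP.
Qed.

(** Line integrals enter only as increments of such primitives, so that additivity over adjacent
    segments is a cancellation. The window ]-L, L[ is any one containing the rectangle at hand. *)
Definition primitive_on (L : R) (g G : R -> C) := forall x : R, - L < x < L ->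
  is_derive x 1 (fun t => complex.Re (G t)) (complex.Re (g x)) /\
  is_derive x 1 (fun t => complex.Im (G t)) (complex.Im (g x)).

Lemma real_primitive_on (L : R) (u : R -> R) : continuous u ->
  exists U : R -> R, forall x, - L < x < L -> is_derive x 1 U (u x).
Proof.
move=> uc; exists (fun x => (\int[lebesgue_measure]_(t in `[- L, x]) u t)%R).
move=> x /andP[Lx xL].
have ui : lebesgue_measure.-integrable `[- L, L] (EFin \o u).
  apply: continuous_compact_integrable; first exact: segment_compact.
  exact: continuous_subspaceT.
have [d e] := continuous_FTC1_closed xL ui Lx (uc x).
by rewrite -e derive1E; apply/derivableP.
Qed.

Lemma primitive_on_exists (L : R) (g : R -> C) : ccontinuous g ->
  exists G, primitive_on L g G.
Proof.
move=> [/(real_primitive_on L)[U Ur] /(real_primitive_on L)[V Vi]].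
by exists (fun x => U x +i* V x) => x xL; split; [exact: Ur|exact: Vi].
Qed.

(** Mean value theorem for [U] minus the antiderivative x p + x^2 q / 2 of the affine function. *)
Lemma real_primitive_bound (U u : R -> R) (p q K a b : R) : a <= b ->
  (forall x, a <= x <= b -> is_derive x 1 U (u x)) ->
  (forall x, a <= x <= b -> `|u x - (p + x * q)| <= K) ->
  `|U b - U a - ((b - a) * p + (b ^+ 2 - a ^+ 2) / 2 * q)| <= K * (b - a).
Proof.
move=> ab dU Ku.
pose W x := U x - (x * p + x ^+ 2 / 2 * q).
have dW x : a <= x <= b -> is_derive x 1 W (u x - (p + x * q)).
  move=> xab; have dUx := dU _ xab.
  have dV : is_derive x 1 (fun y => y * p + y ^+ 2 / 2 * q) (p + x * q).
    by apply: is_derive_eq; rewrite /GRing.scale/=; field.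
  exact: (is_deriveB (f := U)).
have cW : {within `[a, b], continuous W}.
  apply: derivable_within_continuous => x; rewrite in_itv => xab.
  by have [] := dW _ xab.
have [|c] := @MVT_segment _ W (fun x => u x - (p + x * q)) _ _ ab _ cW.
  by move=> x; rewrite in_itv/= => /andP[ax xb]; apply: dW; rewrite !ltW.
rewrite in_itv => cab; rewrite /W => e.
have -> : U b - U a - ((b - a) * p + (b ^+ 2 - a ^+ 2) / 2 * q) =
  U b - (b * p + b ^+ 2 / 2 * q) - (U a - (a * p + a ^+ 2 / 2 * q)) by field.
by rewrite e normrM (ger0_norm (x := b - a)) ?subr_ge0// ler_wpM2r ?subr_ge0 ?Ku.
Qed.

(** The factor 2 is the price of applying the mean value theorem to the real and to the imaginary
    part separately. *)
Lemma primitive_bound (L : R) (g G : R -> C) (p q : C) (K a b : R) :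
  - L < a -> a <= b -> b < L -> primitive_on L g G ->
  (forall x : R, a <= x <= b -> cmod (g x - (p + x%:C * q)) <= K) ->
  cmod (G b - G a - ((b - a)%:C * p + ((b ^+ 2 - a ^+ 2) / 2)%:C * q)) <=
    2 * K * (b - a).
Proof.
move=> La ab bL gG gK.
have inL x : a <= x <= b -> - L < x < L.
  by move=> /andP[ax xb]; rewrite (lt_le_trans La)// (le_lt_trans xb).
rewrite (le_trans (cmod_ler_ReIm _))// -mulrA mulr_natl mulr2n.
have mulcE (r : R) z : r%:C * z = (r * complex.Re z) +i* (r * complex.Im z).
  by case: z => c d; apply/eqP; rewrite eq_complex /= !mul0r subr0 addr0 !eqxx.
rewrite !mulcE; apply: lerD.
- have := @real_primitive_bound (fun x => complex.Re (G x))
    (fun x => complex.Re (g x)) (complex.Re p) (complex.Re q) K a b ab.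
  case: (G a) (G b) => [ga ga'] [gb gb'] /=; apply=> x xab.
    by have [] := gG x (inL _ xab).
  rewrite (le_trans _ (gK _ xab))//; apply: le_trans (ler_Re_cmod _).
  by rewrite mulcE; case: (g x) (p) (q) => ? ? [? ?] [? ?].
- have := @real_primitive_bound (fun x => complex.Im (G x))
    (fun x => complex.Im (g x)) (complex.Im p) (complex.Im q) K a b ab.
  case: (G a) (G b) => [ga ga'] [gb gb'] /=; apply=> x xab.
    by have [] := gG x (inL _ xab).
  rewrite (le_trans _ (gK _ xab))//; apply: le_trans (ler_Im_cmod _).
  by rewrite mulcE; case: (g x) (p) (q) => ? ? [? ?] [? ?].
Qed.

End Goursat.

Section GoursatRectangle.
Context {R : realType}.
Local Notation C := R[i].

(** The point is the supremum of the left endpoints of the nested intervals [a n, a n + w 2^-n]. *)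
Lemma nested_point (a : nat -> R) (w : R) : 0 <= w ->
  (forall n, a n <= a n.+1) ->
  (forall n, a n.+1 + w * 2^-1 ^+ n.+1 <= a n + w * 2^-1 ^+ n) ->
  exists x, forall n, a n <= x <= a n + w * 2^-1 ^+ n.
Proof.
move=> w0 aS bS.
have w2 n : 0 <= w * 2^-1 ^+ n by rewrite mulr_ge0// exprn_ge0// invr_ge0.
have aD n m : a n <= a (n + m)%N.
  elim: m => [|m IHm]; first by rewrite addn0.
  by rewrite addnS (le_trans IHm).
have bD n m : a (n + m)%N + w * 2^-1 ^+ (n + m) <= a n + w * 2^-1 ^+ n.
  elim: m => [|m IHm]; first by rewrite addn0.
  by rewrite addnS (le_trans _ IHm).
have ub n : ubound (range a) (a n + w * 2^-1 ^+ n).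
  move=> _ [m _ <-].
  have := aD m n; have := bD n m; rewrite addnC.
  have := w2 (m + n)%N; lra.
have hs : has_sup (range a).
  by split; [exists (a 0%N), 0%N|exists (a 0%N + w * 2^-1 ^+ 0); exact: ub].
exists (sup (range a)) => n; apply/andP; split.
  by apply: sup_upper_bound => //; exists n.
by apply: ge_sup; [exists (a 0%N), 0%N|exact: ub].
Qed.

Variables (f : C -> C) (fd : cderivable f).
Let pt (x y : R) : C := x%:C + 'i * y%:C.
Variables (L : R) (Hp Vp : R -> R -> C).
Hypothesis HpP : forall y, primitive_on L (fun x => f (pt x y)) (Hp y).
Hypothesis VpP : forall x, primitive_on L (fun y => f (pt x y)) (Vp x).

(* The integral of f along the boundary of [a, a + w] x [c, c + h], in terms of
   primitives Hp y, Vp x of f on the lines of ordinate y and abscissa x *)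
Definition boundary_integral (a c w h : R) : C :=
  (Hp c (a + w) - Hp c a) + 'i * (Vp (a + w) (c + h) - Vp (a + w) c) -
  (Hp (c + h) (a + w) - Hp (c + h) a) - 'i * (Vp a (c + h) - Vp a c).
Local Notation I := boundary_integral.

(** Inner edges are run through twice, in opposite directions, so the four quarters add up to the
    whole and one of them carries at least a fourth of its modulus. *)
Lemma boundary_integral_quarter a c w h : exists s t : bool,
  cmod (I a c w h) / 4 <=
  cmod (I (a + s%:R * (w / 2)) (c + t%:R * (h / 2)) (w / 2) (h / 2)).
Proof.
have ew : a + w / 2 + w / 2 = a + w by field.
have eh : c + h / 2 + h / 2 = c + h by field.
have e : I a c w h = I a c (w / 2) (h / 2) + I (a + w / 2) c (w / 2) (h / 2) +
    (I a (c + h / 2) (w / 2) (h / 2) + I (a + w / 2) (c + h / 2) (w / 2) (h / 2)).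
  by rewrite /I !ew !eh; ring.
apply: contrapT => /forallNP nst.
have {}nst (s t : bool) : cmod (I (a + s%:R * (w / 2)) (c + t%:R * (h / 2)) (w / 2) (h / 2))
    < cmod (I a c w h) / 4.
  by rewrite ltNge; apply/negP => H; case: (nst s); exists t.
have := nst true true; have := nst true false.
have := nst false true; have := nst false false.
rewrite !mul1r !mul0r !addr0 => h1 h2 h3 h4.
have := le_trans (cmodD _ _) (lerD (cmodD _ _) (cmodD _ _)).
move=> /(_ _ (I a c (w / 2) (h / 2)) (I (a + w / 2) c (w / 2) (h / 2))
   (I a (c + h / 2) (w / 2) (h / 2)) (I (a + w / 2) (c + h / 2) (w / 2) (h / 2))).
rewrite -e; lra.
Qed.

(** An affine function has boundary integral zero, so only the error counts: the perimeter
    [2 * (w + h)] times [e], doubled by [primitive_bound]. *)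
Lemma boundary_integral_affine a c w h (p d : C) (e : R) :
  - L < a -> a + w < L -> - L < c -> c + h < L -> 0 <= w -> 0 <= h ->
  (forall x y, a <= x <= a + w -> c <= y <= c + h ->
    cmod (f (pt x y) - (p + d * pt x y)) <= e) ->
  cmod (I a c w h) <= 4 * e * (w + h).
Proof.
move=> La aL Lc cL w0 h0 fpd.
have aw : a <= a + w by rewrite lerDl.
have ch : c <= c + h by rewrite lerDl.
have hor y : c <= y <= c + h -> cmod (Hp y (a + w) - Hp y a -
    ((a + w - a)%:C * (p + d * ('i * y%:C)) +
     (((a + w) ^+ 2 - a ^+ 2) / 2)%:C * d)) <= 2 * e * w.
  move=> yc; rewrite (_ : 2 * e * w = 2 * e * (a + w - a)); last by ring.
  apply: (primitive_bound La aw aL (HpP y)) => x xa.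
  rewrite (_ : _ - _ = f (pt x y) - (p + d * pt x y)) ?fpd//.
  by rewrite /pt; ring.
have ver x : a <= x <= a + w -> cmod (Vp x (c + h) - Vp x c -
    ((c + h - c)%:C * (p + d * x%:C) +
     (((c + h) ^+ 2 - c ^+ 2) / 2)%:C * (d * 'i))) <= 2 * e * h.
  move=> xa; rewrite (_ : 2 * e * h = 2 * e * (c + h - c)); last by ring.
  apply: (primitive_bound Lc ch cL (VpP x)) => y yc.
  rewrite (_ : _ - _ = f (pt x y) - (p + d * pt x y)) ?fpd//.
  by rewrite /pt; ring.
have h1 := hor c; rewrite lexx ch in h1; have {}h1 := h1 erefl.
have h2 := hor (c + h); rewrite lexx ch in h2; have {}h2 := h2 erefl.
have v1 := ver a; rewrite lexx aw in v1; have {}v1 := v1 erefl.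
have v2 := ver (a + w); rewrite lexx aw in v2; have {}v2 := v2 erefl.
rewrite /I.
set A := (X in cmod X <= _) in h1; set B := (X in cmod X <= _) in h2.
set A' := (X in cmod X <= _) in v1; set B' := (X in cmod X <= _) in v2.
have -> : Hp c (a + w) - Hp c a + 'i * (Vp (a + w) (c + h) - Vp (a + w) c) -
  (Hp (c + h) (a + w) - Hp (c + h) a) - 'i * (Vp a (c + h) - Vp a c) =
  (A - B) + 'i * (B' - A').
  rewrite /A /B /A' /B' ![_%:C](rmorphD, rmorphN)/=.
  by ring.
have i1 : cmod ('i : C) = 1 by rewrite /cmod /= expr0n/= expr1n add0r sqrtr1.
rewrite (le_trans (cmodD _ _))// cmodM i1 mul1r.
have := cmodB A B; have := cmodB B' A'; lra.
Qed.

(** Repeated quartering keeps a rectangle of sides w 2^-n and h 2^-n whose integral is at least |I|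
    4^-n. Near the common point of these rectangles f is affine up to e (w + h) 2^-n, so the same
    integral is at most 4 e (w + h)^2 4^-n, a contradiction for small e. *)
Lemma goursat a c w h :
  - L < a -> a + w < L -> - L < c -> c + h < L -> 0 <= w -> 0 <= h ->
  I a c w h = 0.
Proof.
move=> La aL Lc cL w0 h0.
apply/cmod_eq0/eqP/negP => /negP I0.
have {}I0 : 0 < cmod (I a c w h) by rewrite lt_neqAle eq_sym I0 cmod_ge0.
pose W n := w * 2^-1 ^+ n; pose T n := h * 2^-1 ^+ n.
have /choice[nx nxP] (p : R * R * nat) : exists q : R * R, exists s t : bool,
    q = (p.1.1 + s%:R * (W p.2 / 2), p.1.2 + t%:R * (T p.2 / 2)) /\
    cmod (I p.1.1 p.1.2 (W p.2) (T p.2)) / 4 <=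
    cmod (I q.1 q.2 (W p.2 / 2) (T p.2 / 2)).
  have [s [t st]] := boundary_integral_quarter p.1.1 p.1.2 (W p.2) (T p.2).
  by exists (p.1.1 + s%:R * (W p.2 / 2), p.1.2 + t%:R * (T p.2 / 2)), s, t.
pose q := fix q n := if n is m.+1 then nx (q m, m) else (a, c).
have W2 n : W n / 2 = W n.+1 by rewrite /W exprSr mulrA.
have T2 n : T n / 2 = T n.+1 by rewrite /T exprSr mulrA.
have W0 n : 0 <= W n by rewrite mulr_ge0// exprn_ge0// invr_ge0.
have T0 n : 0 <= T n by rewrite mulr_ge0// exprn_ge0// invr_ge0.
have In n : cmod (I a c w h) * 4^-1 ^+ n <= cmod (I (q n).1 (q n).2 (W n) (T n)).
  elim: n => [|n IHn]; first by rewrite /W /T !expr0 !mulr1.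
  have [s [t [_ /= st]]] := nxP (q n, n).
  rewrite W2 T2 in st; apply: le_trans st.
  by rewrite exprSr mulrA ler_wpM2r// invr_ge0.
have hW n : W n = W n.+1 + W n.+1 by rewrite -W2; field.
have hT n : T n = T n.+1 + T n.+1 by rewrite -T2; field.
have q1 n : (q n).1 <= (q n.+1).1 /\
    (q n.+1).1 + W n.+1 <= (q n).1 + W n.
  have [s [t [/= -> _]]] := nxP (q n, n); rewrite /= W2.
  by have := hW n; have := W0 n.+1; case: s => /=; lra.
have q2 n : (q n).2 <= (q n.+1).2 /\
    (q n.+1).2 + T n.+1 <= (q n).2 + T n.
  have [s [t [/= -> _]]] := nxP (q n, n); rewrite /= T2.
  by have := hT n; have := T0 n.+1; case: t => /=; lra.
have [x0 x0P] := nested_point (a := fun n => (q n).1) w0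
  (fun n => proj1 (q1 n)) (fun n => proj2 (q1 n)).
have [y0 y0P] := nested_point (a := fun n => (q n).2) h0
  (fun n => proj1 (q2 n)) (fun n => proj2 (q2 n)).
have Lq n : a <= (q n).1 /\ (q n).1 + W n <= a + w.
  elim: n => [|n [IH1 IH2]]; first by rewrite /W expr0 mulr1 !lexx.
  by have [? ?] := q1 n; lra.
have Lq' n : c <= (q n).2 /\ (q n).2 + T n <= c + h.
  elim: n => [|n [IH1 IH2]]; first by rewrite /T expr0 mulr1 !lexx.
  by have [? ?] := q2 n; lra.
have [d dP] := fd (pt x0 y0).
(* The added 1 makes [e * ((w + h) ^+ 2 * 4)] strictly less than the modulus of [I a c w h], also
   when the rectangle is degenerate. *)
have S0 : 0 < (w + h) ^+ 2 * 4 + 1 by rewrite ltr_wpDl// mulr_ge0// sqr_ge0.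
have [r r0 rP] := dP _ (divr_gt0 I0 S0).
set e := cmod _ / _ in rP.
have e0 : 0 < e by rewrite divr_gt0.
have eE : e * ((w + h) ^+ 2 * 4 + 1) = cmod (I a c w h) by rewrite divfK ?gt_eqF.
have [n nr] : exists n, (w + h) * 2^-1 ^+ n < r.
  have : (fun n => (w + h) * 2^-1 ^+ n : R) @ \oo --> 0.
    by apply: cvg_geometric; rewrite ger0_norm ?invr_ge0// invf_lt1// ltr1n.
  move=> /cvgrPdist_lt/(_ _ r0)[n _ /(_ n (leqnn n))] /=.
  rewrite sub0r normrN ger0_norm; first by exists n.
  by rewrite mulr_ge0 ?addr_ge0// exprn_ge0// invr_ge0.
have WT : W n + T n < r by rewrite -mulrDl.
have [a1 a2] := Lq n; have [c1 c2] := Lq' n.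
have /andP[x1 x2] := x0P n; have /andP[y1 y2] := y0P n.
have := @boundary_integral_affine (q n).1 (q n).2 (W n) (T n)
  (f (pt x0 y0) - d * pt x0 y0) d (e * (W n + T n)).
move=> /(_ (lt_le_trans La a1) (le_lt_trans a2 aL) (lt_le_trans Lc c1)
  (le_lt_trans c2 cL) (W0 n) (T0 n)) H.
have {}H : cmod (I (q n).1 (q n).2 (W n) (T n)) <= 4 * (e * (W n + T n)) * (W n + T n).
  apply: H => x y /andP[xa xb] /andP[ya yb].
  have zle : cmod (pt x y - pt x0 y0) <= W n + T n.
    rewrite (le_trans (cmod_ler_ReIm _))//= !(mul0r, mul1r, subr0, addr0, add0r).
    apply: lerD; rewrite ler_norml; rewrite /W /T in xb yb *; lra.
  have := rP _ (le_lt_trans zle WT).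
  rewrite subrKC => H; apply: le_trans (_ : e * cmod (pt x y - pt x0 y0) <= _).
    by apply: le_trans H; rewrite le_eqVlt; apply/orP; left; apply/eqP; congr cmod; ring.
  by rewrite ler_pM2l.
have {}H := le_trans (In n) H.
have : cmod (I a c w h) * 4^-1 ^+ n <= (e * ((w + h) ^+ 2 * 4)) * 4^-1 ^+ n.
  rewrite (le_trans H)// le_eqVlt; apply/orP; left; apply/eqP.
  rewrite /W /T (_ : 4^-1 = 2^-1 ^+ 2) -?exprM ?(mulnC 2) ?exprM; first by ring.
  by field.
rewrite ler_pM2r ?exprn_gt0 ?invr_gt0//; lra.
Qed.

End GoursatRectangle.

(** * Entire functions vanishing on the real line *)

Section EntireZero.
Context {R : realType}.
Local Notation C := R[i].

(** Serves to choose the exponent of the Landau kernel, and later the power of T in the growth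
    argument for J. *)
Lemma geometric_gap (c K r s : R) : 0 < c -> 0 <= s -> s < r ->
  exists n, K * s ^+ n < c * r ^+ n.
Proof.
move=> c0 s0 sr; have r0 : 0 < r by exact: le_lt_trans sr.
have sr0 : 0 <= s / r by rewrite divr_ge0// ltW.
have /cvgrPdist_lt/(_ c c0)[n _ /(_ n (leqnn n))] /= :
    (fun n => `|K| * (s / r) ^+ n : R) @ \oo --> 0.
  by apply: cvg_geometric; rewrite (ger0_norm sr0) ltr_pdivrMr ?mul1r.
rewrite sub0r normrN ger0_norm ?mulr_ge0 ?exprn_ge0// => H.
exists n; have rn : 0 < r ^+ n by rewrite exprn_gt0.
move: H; rewrite expr_div_n mulrA ltr_pdivrMr//; apply: le_lt_trans.
by rewrite ler_wpM2r ?exprn_ge0// ler_norm.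
Qed.

Lemma derive_ge_growth (U u : R -> R) (m a b : R) : a <= b ->
  (forall x, a <= x <= b -> is_derive x 1 U (u x)) ->
  (forall x, a <= x <= b -> m <= u x) -> m * (b - a) <= U b - U a.
Proof.
move=> ab dU mu.
have cU : {within `[a, b], continuous U}.
  by apply: derivable_within_continuous => x; rewrite in_itv => /dU[].
have [|c] := @MVT_segment _ U u _ _ ab _ cU.
  by move=> x; rewrite in_itv/= => /andP[ax xb]; apply: dU; rewrite !ltW.
rewrite in_itv/= => cab ->.
by rewrite ler_wpM2r ?subr_ge0// mu.
Qed.

Lemma sqr_ler_norm (e x : R) : 0 <= e -> (x <= - e) || (e <= x) -> e ^+ 2 <= x ^+ 2.
Proof. by move=> e0 /orP[|] xe; nra. Qed.

Lemma sqr_le_itv (e x : R) : - e <= x <= e -> x ^+ 2 <= e ^+ 2.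
Proof. by move=> /andP[]; nra. Qed.

Lemma subr_sqr_ge0 (x : R) : -1 <= x <= 1 -> 0 <= 1 - x ^+ 2.
Proof. by move=> /andP[]; nra. Qed.

(** The central part [-e/2, e/2], of length e, contributes at least
    [d * e * (1 - (e / 2) ^+ 2) ^+ n]; the rest of [-e, e] contributes a nonnegative amount; each of
    the two outer intervals, of length at most 1, costs at most [K * (1 - e ^+ 2) ^+ n]. *)
Lemma landau_kernel_ge (U u : R -> R) (K d e : R) (n : nat) :
  0 < e -> e <= 2^-1 -> 0 <= K -> 0 < d ->
  (forall x : R, -1 <= x <= 1 -> is_derive x 1 U (u x * (1 - x ^+ 2) ^+ n)) ->
  (forall x : R, -1 <= x <= 1 -> `|u x| <= K) ->
  (forall x : R, - e <= x <= e -> d <= u x) ->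
  d * e * (1 - (e / 2) ^+ 2) ^+ n - 2 * K * (1 - e ^+ 2) ^+ n <= U 1 - U (-1).
Proof.
move=> e0 e2 K0 d0 dU uK ud.
set A := (1 - e ^+ 2) ^+ n; set B := (1 - (e / 2) ^+ 2) ^+ n.
have k0 (x : R) : -1 <= x <= 1 -> 0 <= 1 - x ^+ 2.
  exact: subr_sqr_ge0.
have KA0 : 0 <= K * A by rewrite mulr_ge0// exprn_ge0// k0//; lra.
have far (a b : R) : -1 <= a -> a <= b -> b <= 1 -> b - a <= 1 ->
    (forall x : R, a <= x <= b -> e ^+ 2 <= x ^+ 2) -> - (K * A) <= U b - U a.
  move=> a1 ab b1 ba1 abe.
  have H : - (K * A) * (b - a) <= U b - U a.
    apply: derive_ge_growth ab _ _ => [x xab|x xab].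
      by apply: dU; lra.
    have x1 : -1 <= x <= 1 by lra.
    have : `|u x * (1 - x ^+ 2) ^+ n| <= K * A.
      rewrite normrM ler_pM// ?uK// ger0_norm ?exprn_ge0 ?k0//.
      by rewrite lerXn2r ?nnegrE ?k0 ?lerB ?abe//; lra.
    by rewrite ler_norml => /andP[].
  by apply: le_trans H; move: KA0 ba1; clear; nra.
have mid (a b m : R) : - e <= a -> a <= b -> b <= e -> 0 <= m ->
    (forall x : R, a <= x <= b -> m <= (1 - x ^+ 2) ^+ n) ->
    d * m * (b - a) <= U b - U a.
  move=> a1 ab b1 m0 abe; apply: derive_ge_growth ab _ _ => [x xab|x xab].
    by apply: dU; lra.
  by rewrite ler_pM ?(ltW d0) ?abe// ud//; lra.
have f1 : - (K * A) <= U (- e) - U (-1).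
  by apply: far; try lra; move=> x /andP[_ xe]; rewrite sqr_ler_norm ?(ltW e0)// xe.
have f2 : - (K * A) <= U 1 - U e.
  by apply: far; try lra; move=> x /andP[xe _]; rewrite sqr_ler_norm ?(ltW e0)// xe orbT.
have m1 : 0 <= U (- (e / 2)) - U (- e).
  have := mid (- e) (- (e / 2)) 0; rewrite mulr0 mul0r; apply; try lra.
  by move=> x xe; rewrite exprn_ge0// k0//; lra.
have m3 : 0 <= U e - U (e / 2).
  have := mid (e / 2) e 0; rewrite mulr0 mul0r; apply; try lra.
  by move=> x xe; rewrite exprn_ge0// k0//; lra.
have m2 : d * e * B <= U (e / 2) - U (- (e / 2)).
  rewrite (_ : d * e * B = d * B * (e / 2 - - (e / 2))); last by field.
  apply: mid; try lra; first by rewrite exprn_ge0// k0//; lra.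
  move=> x xe; have x1 : -1 <= x <= 1 by lra.
  have e1 : -1 <= e / 2 <= 1 by lra.
  by rewrite lerXn2r ?nnegrE ?k0 ?lerB ?sqr_le_itv.
by rewrite -[2 * K * A]mulrA; move: (K * A) (d * e * B) f1 f2 m1 m2 m3; clear => *; lra.
Qed.

(* The integral of f(z)(1 - (z - i/4)^2)^n along the boundary of
   [-1, 1] x [0, 1/4] vanishes; the bottom side does not contribute, the
   vertical sides are exponentially small, and on the top side the kernel
   (1 - x^2)^n concentrates at the midpoint i/4. *)
Lemma entire_zero_quarter_le0 (f : C -> C) :
  cderivable f -> (forall t : R, f t%:C = 0) ->
  complex.Re (f ('i * (4^-1 : R)%:C)) <= 0.
Proof.
move=> fd f0; set z0 := 'i * _; rewrite leNgt; apply/negP => fz0.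
pose pt (x y : R) : C := x%:C + 'i * y%:C.
pose k z := 1 - (z - z0) ^+ 2 : C.
have kd : cderivable k.
  have e : k = fun z => 1 + (-1) * ((z - z0) ^+ 2).
    by apply/funext => z; rewrite /k mulN1r.
  rewrite e; apply: cderivableD; first exact: cderivable_cst.
  apply: cderivableM; first exact: cderivable_cst.
  apply: cderivableX; apply: cderivableD; first exact: cderivable_id.
  exact: cderivable_cst.
have i1 : cmod ('i : C) = 1 by rewrite /cmod /= expr0n/= expr1n add0r sqrtr1.
have ch g y : cderivable g -> ccontinuous (fun x => g (pt x y)).
  move=> gd; have := cderivable_line ('i * y%:C) 1 gd.
  by congr ccontinuous; apply/funext => x; rewrite /pt mul1r addrC.
have cv g x : cderivable g -> ccontinuous (fun y => g (pt x y)).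
  by move=> gd; apply: cderivable_line.
have [K1 K10 K1P] := cbounded (-1) 1 (ch _ 4^-1 fd).
have [K2 K20 K2P] := cbounded 0 1 (cv _ 1 fd).
have [K3 K30 K3P] := cbounded 0 1 (cv _ (-1) fd).
pose d0 := complex.Re (f z0) / 2.
have d00 : 0 < d0 by rewrite divr_gt0.
have [r r0 rP] := cderivable_continuous fd z0 d00.
pose eta := Num.min (r / 2) (2^-1).
have eta0 : 0 < eta by rewrite lt_min divr_gt0//= invr_gt0.
have eta2 : eta <= 2^-1 by rewrite ge_min lexx orbT.
have etar : eta < r.
  by rewrite (@le_lt_trans _ _ (r / 2))// ?ge_min ?lexx//; lra.
have ptop x : pt x 4^-1 = z0 + x%:C by rewrite /pt addrC.
have near0 x : - eta <= x <= eta -> d0 <= complex.Re (f (pt x 4^-1)).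
  move=> xe; have /rP : cmod x%:C < r.
    by rewrite cmod_real (le_lt_trans _ etar)// ler_norml.
  move/(le_lt_trans (ler_Re_cmod _)); rewrite raddfB/= -ptop ltr_norml /d0.
  by case: (f z0) (f _) => [? ?] [? ?] /=; lra.
have ktop x : k (pt x 4^-1) = (1 - x ^+ 2)%:C.
  by rewrite /k ptop rmorphB rmorphXn/= rmorph1; congr (1 - _ ^+ 2); rewrite addrAC subrr add0r.
(* With v = y - 1/4 the kernel on the vertical sides is v^2 - 2iv or v^2 + 2iv, of squared modulus
   v^4 + 4 v^2. The small height 1/4 of the rectangle is what keeps this below 1. *)
have kside (s : bool) y : 0 <= y <= 4^-1 -> cmod (k (pt ((-1) ^+ s) y)) <= 3 / 4.
  have k34 : 0 <= 3 / 4 :> R by lra.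
  move=> y01; rewrite -(ler_pXn2r (_ : 0 < 2)%N) ?nnegrE ?cmod_ge0//.
  have -> : k (pt ((-1) ^+ s) y) = ((y - 4^-1) ^+ 2) +i* (- 2 * (-1) ^+ s * (y - 4^-1)).
    rewrite /k /pt /z0; apply/eqP; rewrite eq_complex/=.
    by case: s => /=; apply/andP; split; apply/eqP; rewrite ?expr1 ?expr0; field.
  rewrite cmod_sqr/= !exprMn sqrr_sign.
  have : 0 <= (y - 4^-1) ^+ 2 <= 4^-1 ^+ 2.
    by rewrite sqr_ge0 /=; apply: sqr_le_itv; lra.
  by clear; set u := (y - _) ^+ 2; nra.
(* [s0] dominates the kernel on the vertical sides and on the outer parts of the top side, and stays
   below its minimum [1 - (eta / 2) ^+ 2] on the central part. *)
pose s0 : R := Num.max (1 - eta ^+ 2) (3 / 4).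
have s00 : 0 <= s0 by rewrite le_max; apply/orP; right; lra.
have s0r : s0 < 1 - (eta / 2) ^+ 2.
  by rewrite gt_max; apply/andP; split; move: eta0 eta2; clear; nra.
have [n] := geometric_gap (2 * K1 + 2 * K2 + 2 * K3) (mulr_gt0 d00 eta0) s00 s0r.
set A := s0 ^+ n; set B := (1 - _) ^+ n => AB.
have A0 : 0 <= A by rewrite exprn_ge0.
pose g z := f z * k z ^+ n.
have gd : cderivable g by apply: cderivableM => //; apply: cderivableX.
have /choice[Hp HpP] y := primitive_on_exists 2 (ch _ y gd).
have /choice[Vp VpP] x := primitive_on_exists 2 (cv _ x gd).
have := goursat gd HpP VpP (a := -1) (c := 0) (w := 2) (h := 4^-1).
have N21 : - 2 < -1 :> R by lra. have E21 : -1 + 2 < 2 :> R by lra.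
have N20 : - 2 < 0 :> R by lra. have E42 : 0 + 4^-1 < 2 :> R by lra.
move=> /(_ N21 E21 N20 E42 (ler0n _ 2)); rewrite invr_ge0 ler0n => /(_ erefl).
rewrite /boundary_integral (_ : -1 + 2 = 1); last by ring.
rewrite add0r => I0.
have bot : Hp 0 1 - Hp 0 (-1) = 0.
  apply: cmod_eq0; apply: le_anti; rewrite cmod_ge0 andbT.
  have := primitive_bound (p := 0) (q := 0) (K := 0) N21 _ _ (HpP 0).
  move=> /(_ 1); rewrite !mulr0 !addr0 subr0 !mul0r; apply; try lra.
  by move=> x _; rewrite mulr0 addr0 subr0 /g /pt mulr0 addr0 f0 mul0r cmod0.
have side (s : bool) K : 0 <= K ->
    (forall y, 0 <= y <= 1 -> cmod (f (pt ((-1) ^+ s) y)) <= K) ->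
    cmod (Vp ((-1) ^+ s) 4^-1 - Vp ((-1) ^+ s) 0) <= K * A.
  move=> K0 fK.
  have := primitive_bound (p := 0) (q := 0) (K := K * A) N20 _ _ (VpP ((-1) ^+ s)).
  move=> /(_ 4^-1); rewrite !mulr0 !addr0 !subr0 => H.
  have {}H : cmod (Vp ((-1) ^+ s) 4^-1 - Vp ((-1) ^+ s) 0) <= 2 * (K * A) * 4^-1.
    apply: H; try lra.
    move=> y /andP[y0 y4]; rewrite mulr0 addr0 subr0 /g cmodM cmodX ler_pM ?exprn_ge0 ?cmod_ge0//.
    - by apply: fK; rewrite y0 (le_trans y4)//; lra.
    - by rewrite lerXn2r ?nnegrE ?cmod_ge0// (le_trans (kside _ _ _)) ?y0// le_max lexx orbT.
  by rewrite (le_trans H)//; have := mulr_ge0 K0 A0; lra.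
have s1 := side false _ K20 K2P; have s2 := side true _ K30 K3P.
rewrite /= expr0 expr1 in s1 s2.
have top : `|complex.Re (Hp 4^-1 1) - complex.Re (Hp 4^-1 (-1))| <= (K2 + K3) * A.
  rewrite -raddfB (le_trans (ler_Re_cmod _))//.
  have -> : Hp 4^-1 1 - Hp 4^-1 (-1) =
     'i * (Vp 1 4^-1 - Vp 1 0) - 'i * (Vp (-1) 4^-1 - Vp (-1) 0).
    apply/eqP; rewrite -subr_eq0 -oppr_eq0 -I0 bot add0r; apply/eqP; ring.
  by rewrite (le_trans (cmodB _ _))// !cmodM i1 !mul1r mulrDl lerD.
have low : d0 * eta * B - 2 * K1 * (1 - eta ^+ 2) ^+ n <=
    complex.Re (Hp 4^-1 1) - complex.Re (Hp 4^-1 (-1)).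
  apply: (@landau_kernel_ge (fun x => complex.Re (Hp 4^-1 x))
    (fun x => complex.Re (f (pt x 4^-1)))) => //.
  - move=> x x1; have [|+ _] := HpP 4^-1 x; first by move: x1; clear; lra.
    by rewrite /g ktop -rmorphXn /=; case: (f _) => u v /=; rewrite mulr0 subr0.
  - by move=> x x1; rewrite (le_trans (ler_Re_cmod _))// K1P.
have kA : (1 - eta ^+ 2) ^+ n <= A.
  have e1 : 0 <= 1 - eta ^+ 2.
    by rewrite subr_sqr_ge0//; move: eta0 eta2; clear; lra.
  have es0 : 1 - eta ^+ 2 <= s0 by rewrite le_max lexx.
  by rewrite lerXn2r ?nnegrE.
have H := ler_wpM2l (mulr_ge0 (ler0n _ 2) K10) kA.
move: top; rewrite ler_norml => /andP[_ top].
have K2A := mulr_ge0 K20 A0; have K3A := mulr_ge0 K30 A0.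
move: AB low top H K2A K3A; clear; rewrite !mulrDl -!mulrA.
move: (complex.Re _) (complex.Re _) => u v.
lra.
Qed.

(** The estimate at i/4 only says that a real part is at most 0. It is applied to w |-> f(4 a w)
    times the conjugate of f(i a), whose value at i/4 is |f(i a)|^2. *)
Lemma entire_eq0 (f : C -> C) : cderivable f -> (forall t : R, f t%:C = 0) ->
  forall a : R, f ('i * a%:C) = 0.
Proof.
move=> fd f0 a; set z := f _; apply: contrapT => /eqP z0.
have cz0 : 0 < complex.Re (z * conjc z).
  have : z * conjc z != 0 by rewrite mulf_neq0// conjc_eq0.
  have := mulcJ_ge0 z; case: (z * _) => u v /=; rewrite lecE/= => /andP[/eqP -> u0].
  by rewrite eq_complex/= eqxx andbT lt_neqAle eq_sym u0 andbT.
pose g w := f ((4 * a)%:C * w) * conjc z.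
have gd : cderivable g.
  by apply: cderivableM; [exact: cderivable_scale|exact: cderivable_cst].
have : complex.Re (g ('i * (4^-1 : R)%:C)) <= 0.
  by apply: entire_zero_quarter_le0 => // t; rewrite /g -rmorphM f0 mul0r.
rewrite /g mulrCA -rmorphM/= (_ : 4 * a / 4 = a); last by field.
by rewrite leNgt cz0.
Qed.

End EntireZero.

(** * Projection-valued measures *)

Section Hilbert.
Context {R : realType} {H : completeNormedModType R[i]}.
Local Notation C := R[i].
Implicit Types (u v w : H) (c : C).

Definition hnorm u : R := complex.Re `|u|.

Lemma hnormE u : `|u| = (hnorm u)%:C.
Proof. by apply/esym/RRe_real/ger0_real. Qed.

Lemma hnorm_ge0 u : 0 <= hnorm u.
Proof. by rewrite -ler0c -hnormE normr_ge0. Qed.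

Lemma hnorm0 : hnorm 0 = 0.
Proof. by rewrite /hnorm normr0. Qed.

Lemma hnormN u : hnorm (- u) = hnorm u.
Proof. by rewrite /hnorm normrN. Qed.

Lemma hnormZ c u : hnorm (c *: u) = cmod c * hnorm u.
Proof. by apply: complexI; rewrite -hnormE normrZ rmorphM /= -hnormE cmodE. Qed.

Lemma ler_hnormD u v : hnorm (u + v) <= hnorm u + hnorm v.
Proof. by rewrite -lecR rmorphD/= -!hnormE ler_normD. Qed.

Lemma ler_hnormB u v : hnorm (u - v) <= hnorm u + hnorm v.
Proof. by rewrite -(hnormN v) ler_hnormD. Qed.

Lemma hnormB u v : hnorm (u - v) = hnorm (v - u).
Proof. by rewrite -hnormN opprB. Qed.

Lemma hnorm_eq0 u : hnorm u = 0 -> u = 0.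
Proof. by move=> u0; apply/eqP; rewrite -normr_eq0 hnormE u0. Qed.

Lemma hnorm_le0 u : hnorm u <= 0 -> u = 0.
Proof. by move=> u0; apply/hnorm_eq0/le_anti; rewrite u0 hnorm_ge0. Qed.

Lemma hnorm_cvgP (s : nat -> H) (l : H) : (s @ \oo --> l) <->
  forall e : R, 0 < e -> exists N : nat, forall n : nat, (N <= n)%N ->
    hnorm (s n - l) < e.
Proof.
split=> [/cvgrPdist_lt sl e e0|sl].
  have /sl[N _ NP] : (0 : C) < e%:C by rewrite ltcR.
  by exists N => n /NP /=; rewrite hnormE ltcR hnormB.
apply/cvgrPdist_lt => e; rewrite ltcE/= => /andP[/eqP ei e0].
have [N NP] := sl _ e0; exists N => // n /NP.
rewrite hnormB => h; rewrite hnormE /=.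
by case: e ei e0 {NP} h => a b /= -> _; rewrite ltcR.
Qed.

Lemma hnorm_cauchy (s : nat -> H) :
  (forall e : R, 0 < e -> exists N : nat, forall n m : nat,
    (N <= n)%N -> (N <= m)%N -> hnorm (s n - s m) < e) ->
  exists l : H, s @ \oo --> l.
Proof.
move=> sc; suff /cvg_ex : [cvg (s @ \oo) in H] by [].
apply: cauchy_cvg; apply: cauchy_exP => e.
rewrite ltcE/= => /andP[/eqP ei e0].
have [N NP] := sc _ e0; exists (s N); exists N => // n /= Nn.
rewrite -ball_normE /ball_/= hnormE.
have := NP N n (leqnn _) Nn; case: e ei e0 {NP} => a b /= -> _.
by rewrite ltcR.
Qed.

Lemma cvgnP (s : nat -> R) (l : R) : (s @ \oo --> l) <->
  forall e : R, 0 < e -> exists N : nat, forall n : nat, (N <= n)%N ->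
    `|s n - l| < e.
Proof.
split=> [/cvgrPdist_lt sl e /sl[N _ NP]|sl].
  by exists N => n /NP /=; rewrite distrC.
by apply/cvgrPdist_lt => e /sl[N NP]; exists N => // n /NP /=; rewrite distrC.
Qed.

Lemma hcvg_unique (s : nat -> H) (l l' : H) :
  s @ \oo --> l -> s @ \oo --> l' -> l = l'.
Proof.
move=> /hnorm_cvgP sl /hnorm_cvgP sl'.
apply/eqP; rewrite -subr_eq0; apply/eqP/hnorm_le0/ler_addgt0Pl => /= e e0.
have [N NP] := sl _ (divr_gt0 e0 (ltr0n _ 2)).
have [M MP] := sl' _ (divr_gt0 e0 (ltr0n _ 2)).
have := NP _ (leq_maxl N M); have := MP _ (leq_maxr N M).
set a := s _ => h1 h2; have -> : l - l' = (l - a) + (a - l').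
  by rewrite addrA subrK.
by rewrite addr0 (le_trans (ler_hnormD _ _))// (hnormB l); move: h1 h2; lra.
Qed.

Lemma ler_dist_hnorm u v : `|hnorm u - hnorm v| <= hnorm (u - v).
Proof.
rewrite ler_norml lerNl opprB !lerBlDr; apply/andP; split.
  by rewrite hnormB -[X in hnorm X <= _](subrK u) ler_hnormD.
by rewrite -[X in hnorm X <= _](subrK v) ler_hnormD.
Qed.

Lemma hnorm_cvg (s : nat -> H) (l : H) :
  s @ \oo --> l -> (fun n => hnorm (s n)) @ \oo --> hnorm l.
Proof.
move=> /hnorm_cvgP sl; apply/cvgnP => e /sl[N NP]; exists N => n /NP.
apply: le_lt_trans; exact: ler_dist_hnorm.
Qed.

Lemma hcvg_squeeze (s : nat -> H) (l : H) (b : nat -> R) :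
  (forall n, hnorm (s n - l) <= b n) -> b @ \oo --> 0 -> s @ \oo --> l.
Proof.
move=> sb /cvgnP b0; apply/hnorm_cvgP => e /b0[N NP]; exists N => n /NP.
rewrite subr0; apply: le_lt_trans.
by rewrite (le_trans (sb n))// ler_norm.
Qed.

Variable ip : {dot H for (@Num.conj R[i])}.

Lemma ipDl u v w : ip (u + v) w = ip u w + ip v w.
Proof. exact: linearDl. Qed.

Lemma ipDr u v w : ip w (u + v) = ip w u + ip w v.
Proof. exact: linearDr. Qed.

Lemma ipNl u w : ip (- u) w = - ip u w.
Proof. exact: linearNl. Qed.

Lemma ipNr u w : ip w (- u) = - ip w u.
Proof. exact: linearNr. Qed.

Lemma ipBl u v w : ip (u - v) w = ip u w - ip v w.
Proof. exact: linearBl. Qed.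

Lemma ipBr u v w : ip w (u - v) = ip w u - ip w v.
Proof. exact: linearBr. Qed.

Lemma ipZl c u w : ip (c *: u) w = c * ip u w.
Proof. exact: linearZl_LR. Qed.

Lemma ipZr c u w : ip w (c *: u) = conjc c * ip w u.
Proof. exact: linearZr_LR. Qed.

Lemma ip0r w : ip w 0 = 0.
Proof. exact: linear0r. Qed.

Lemma ipC u v : ip u v = conjc (ip v u).
Proof. by rewrite hermC expr0 mul1r. Qed.

Lemma ip_suml (I : Type) (r : seq I) (F : I -> H) w :
  ip (\sum_(i <- r) F i) w = \sum_(i <- r) ip (F i) w.
Proof. exact: linear_sumlz. Qed.

Lemma ip_sumr (I : Type) (r : seq I) (F : I -> H) w :
  ip w (\sum_(i <- r) F i) = \sum_(i <- r) ip w (F i).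
Proof. exact: linear_sumr. Qed.

Hypothesis Hip : hilbert ip.

Lemma ip_hnorm u : ip u u = (hnorm u ^+ 2)%:C.
Proof. by rewrite -Hip hnormE rmorphXn. Qed.

Lemma hnorm_sqr u : hnorm u ^+ 2 = complex.Re (ip u u).
Proof. by rewrite ip_hnorm. Qed.

Lemma hnorm_sqrD u v :
  hnorm (u + v) ^+ 2 = hnorm u ^+ 2 + hnorm v ^+ 2 + 2 * complex.Re (ip u v).
Proof.
rewrite !hnorm_sqr !(ipDl, ipDr) (ipC v u).
by case: (ip u u) (ip v v) (ip u v) => [? ?] [? ?] [? ?] /=; ring.
Qed.

Lemma pythagoras u v : ip u v = 0 ->
  hnorm (u + v) ^+ 2 = hnorm u ^+ 2 + hnorm v ^+ 2.
Proof. by move=> uv; rewrite hnorm_sqrD uv mulr0 addr0. Qed.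

Lemma pythagoras_sum (s : nat -> H) n :
  (forall i j, i <> j -> ip (s i) (s j) = 0) ->
  hnorm (\sum_(0 <= i < n) s i) ^+ 2 = \sum_(0 <= i < n) hnorm (s i) ^+ 2.
Proof.
move=> so; elim: n => [|n IHn]; first by rewrite !big_nil hnorm0 expr0n.
rewrite !big_nat_recr//= pythagoras ?IHn// ip_suml big_seq big1// => i.
rewrite mem_index_iota => /andP[_ ilt]; apply: so => e.
by rewrite e ltnn in ilt.
Qed.

Lemma cauchy_schwarz u v : cmod (ip u v) <= hnorm u * hnorm v.
Proof.
have [v0|v0] := eqVneq (hnorm v) 0.
  by rewrite (hnorm_eq0 v0) ip0r cmod0 hnorm0 mulr0.
have {}v0 : 0 < hnorm v by rewrite lt_neqAle eq_sym v0 hnorm_ge0.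
rewrite -(ler_pXn2r (_ : 0 < 2)%N) ?nnegrE ?mulr_ge0 ?cmod_ge0 ?hnorm_ge0//.
pose a := hnorm v ^+ 2; pose b := ip u v.
have a0 : 0 < a by rewrite exprn_gt0.
have := sqr_ge0 (hnorm (a%:C *: u - b *: v)).
rewrite hnorm_sqr !(ipBl, ipBr, ipZl, ipZr) (ipC v u) !ip_hnorm -/a -/b.
rewrite cmod_sqr exprMn -/a conjc_real.
case: b => p q /=; rewrite !(mul0r, mulr0, subr0, addr0, add0r, sub0r).
set x := hnorm u ^+ 2 => h.
have {h} : 0 <= a * (x * a - (p ^+ 2 + q ^+ 2)) by lra.
by rewrite pmulr_rge0// subr_ge0.
Qed.

Lemma ip_ext u v : (forall w, ip u w = ip v w) -> u = v.
Proof.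
move=> uv; apply/eqP; rewrite -subr_eq0; apply/eqP/hnorm_eq0/eqP.
by rewrite -sqrf_eq0 hnorm_sqr ipBl uv subrr.
Qed.

Lemma ip_cvg (s : nat -> H) (l w : H) : s @ \oo --> l ->
  forall e : R, 0 < e -> exists N : nat, forall n : nat, (N <= n)%N ->
    cmod (ip (s n) w - ip l w) < e.
Proof.
move=> /hnorm_cvgP sl e e0; have w0 := hnorm_ge0 w.
have w1 : 0 < hnorm w + 1 by rewrite ltr_wpDl.
have [N NP] := sl _ (divr_gt0 e0 w1); exists N => n /NP.
rewrite ltr_pdivlMr// -ipBl => h.
by rewrite (le_lt_trans (cauchy_schwarz _ _))//; have := hnorm_ge0 (s n - l); nra.
Qed.

End Hilbert.

Section ProjectionValuedMeasure.
Context {R : realType} {H : completeNormedModType R[i]}.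
Local Notation C := R[i].
Variable ip : {dot H for (@Num.conj R[i])}.
Hypothesis Hip : hilbert ip.
Variable E : set R -> H -> H.
Hypothesis HE : projection_valued_measure ip E.
Implicit Types (A B : set R) (u v w a : H) (c : C).

Lemma pvm_projection A : measurable A -> projection ip (E A).
Proof. by case: HE => + _ _ _; apply. Qed.

Lemma pvm_lin A c u v : measurable A -> E A (c *: u + v) = c *: E A u + E A v.
Proof. by move=> /pvm_projection[[Elin _] _ _]; exact: Elin. Qed.

Lemma pvm0 A : measurable A -> E A 0 = 0.
Proof.
move=> mA; have := pvm_lin (-1) 0 0 mA.
by rewrite scaler0 addr0 scaleN1r addNr.
Qed.

Lemma pvmZ A c u : measurable A -> E A (c *: u) = c *: E A u.
Proof. by move=> mA; have := pvm_lin c u 0 mA; rewrite !addr0 pvm0// addr0. Qed.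

Lemma pvmD A u v : measurable A -> E A (u + v) = E A u + E A v.
Proof. by move=> mA; have := pvm_lin 1 u v mA; rewrite !scale1r. Qed.

Lemma pvmB A u v : measurable A -> E A (u - v) = E A u - E A v.
Proof. by move=> mA; rewrite -scaleN1r pvmD// pvmZ// scaleN1r. Qed.

Lemma pvm_sum A (I : Type) (r : seq I) (F : I -> H) : measurable A ->
  E A (\sum_(i <- r) F i) = \sum_(i <- r) E A (F i).
Proof.
move=> mA; elim: r => [|i r IHr]; first by rewrite !big_nil pvm0.
by rewrite !big_cons pvmD// IHr.
Qed.

Lemma pvmT u : E setT u = u.
Proof. by case: HE => _ -> _ _. Qed.

Lemma pvmI A B u : measurable A -> measurable B -> E (A `&` B) u = E A (E B u).
Proof. by case: HE => _ _ + _ mA mB; move=> ->. Qed.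

Lemma pvm_adj A u v : measurable A -> ip (E A u) v = ip u (E A v).
Proof. by move=> /pvm_projection[_ _]; exact. Qed.

Lemma pvm_sigma (A : nat -> set R) u : (forall n, measurable (A n)) ->
  trivIset setT A ->
  (fun n => \sum_(0 <= k < n) E (A k) u) @ \oo --> E (\bigcup_n A n) u.
Proof. by case: HE => _ _ _ + mA tA; apply. Qed.

Arguments pvm_sigma {A} u _ _.

(** Countable additivity on the constant sequence of empty sets: the increments of a convergent
    series tend to zero, and here each of them is [E set0 u]. *)
Lemma pvm_set0 u : E set0 u = 0.
Proof.
have tI : trivIset setT (fun _ : nat => set0 : set R).
  by apply/trivIsetP => i j _ _ _; rewrite set0I.
have := pvm_sigma u (fun _ => measurable0) tI.
rewrite bigcup0// => /hnorm_cvgP h.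
apply/hnorm_le0/ler_addgt0Pl => /= e e0; rewrite addr0.
have [N NP] := h _ (divr_gt0 e0 (ltr0n _ 2)).
have := NP N (leqnn _); have := NP N.+1 (leqnSn _).
rewrite big_nat_recr//=; set s := \sum_(_ <= _ < _) _; set z := E set0 u.
move=> h1 h2; have -> : z = (s + z - z) - (s - z).
  by rewrite addrK opprB addrC subrK.
by rewrite (le_trans (ler_hnormB _ _))//; move: h1 h2; lra.
Qed.

Lemma pvmU A B u : measurable A -> measurable B -> A `&` B = set0 ->
  E (A `|` B) u = E A u + E B u.
Proof.
move=> mA mB AB0.
have := pvm_sigma (A := bigcup2 A B) u.
have m2 n : measurable (bigcup2 A B n).
  by case: n => [|[|n]]//; exact: measurable0.
have t2 : trivIset setT (bigcup2 A B) by rewrite -trivIset_bigcup2.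
move=> /(_ m2 t2); rewrite bigcup2E => h.
apply: hcvg_unique h _; apply/hnorm_cvgP => e e0; exists 2%N => n n2.
rewrite -(subnKC n2) /index_iota subn0 iotaD big_cat/= !big_cons big_nil.
rewrite big1_seq => [|i]; first by rewrite !addr0 subrr hnorm0.
by rewrite mem_iota => /andP[_ /andP[+ _]]; case: i => [|[|i]]// _; rewrite pvm_set0.
Qed.

Lemma pvmC A u : measurable A -> E (~` A) u = u - E A u.
Proof.
move=> mA; rewrite -[X in _ = X - _](pvmT u) -(setvU A) pvmU ?setICl ?addrK//.
exact: measurableC.
Qed.

Lemma pvm_orth A B u v : measurable A -> measurable B -> A `&` B = set0 ->
  ip (E A u) (E B v) = 0.
Proof.
by move=> mA mB AB0; rewrite pvm_adj// -pvmI// AB0 pvm_set0 ip0r.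
Qed.

Lemma pvm_id A u : measurable A -> E A (E A u) = E A u.
Proof. by move=> mA; rewrite -pvmI// setIid. Qed.

Lemma pvm_subl A B u : measurable A -> measurable B -> A `<=` B ->
  E A (E B u) = E A u.
Proof. by move=> mA mB AB; rewrite -pvmI// setIidl. Qed.

Lemma pvm_disj A B u : measurable A -> measurable B -> A `&` B = set0 ->
  E A (E B u) = 0.
Proof. by move=> mA mB AB; rewrite -pvmI// AB pvm_set0. Qed.

Lemma pvm_comm A B u : measurable A -> measurable B ->
  E A (E B u) = E B (E A u).
Proof. by move=> mA mB; rewrite -!pvmI// setIC. Qed.

Lemma pvm_sqr A u : measurable A -> hnorm (E A u) ^+ 2 = complex.Re (ip (E A u) u).
Proof. by move=> mA; rewrite (hnorm_sqr Hip) -[in RHS](pvm_id u mA) (pvm_adj (E A u) u). Qed.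

Lemma pvm_contract A u : measurable A -> hnorm (E A u) <= hnorm u.
Proof.
move=> mA; rewrite -(ler_pXn2r (_ : 0 < 2)%N) ?nnegrE ?hnorm_ge0//.
have -> : hnorm u ^+ 2 = hnorm (E A u + E (~` A) u) ^+ 2 by rewrite pvmC// subrKC.
have mC : measurable (~` A) by exact: measurableC.
by rewrite (pythagoras Hip) ?lerDl ?sqr_ge0// pvm_orth// setICr.
Qed.

Lemma pvm_le A B u : measurable A -> measurable B -> A `<=` B ->
  hnorm (E A u) <= hnorm (E B u).
Proof. by move=> mA mB AB; rewrite -(pvm_subl u mA mB AB) pvm_contract. Qed.

Lemma pvm_bigcup_norm (D : nat -> set R) u : (forall n, measurable (D n)) ->
  trivIset setT D ->
  (fun n => \sum_(0 <= k < n) hnorm (E (D k) u) ^+ 2) @ \oo -->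
    hnorm (E (\bigcup_n D n) u) ^+ 2.
Proof.
move=> mD tD; have /hnorm_cvg := pvm_sigma u mD tD.
move=> h; have -> : (fun n => \sum_(0 <= k < n) hnorm (E (D k) u) ^+ 2) =
    (fun n => hnorm (\sum_(0 <= k < n) E (D k) u) ^+ 2).
  apply/funext => n; rewrite (pythagoras_sum Hip)// => i j ij.
  by apply: pvm_orth => //; move/trivIsetP : tD => /(_ i j I I); apply; apply/eqP.
exact: (cvgM h h).
Qed.

Arguments pvm_bigcup_norm {D} u _ _.

Lemma pvm_bessel (D : nat -> set R) u n : (forall n, measurable (D n)) ->
  trivIset setT D ->
  \sum_(0 <= k < n) hnorm (E (D k) u) ^+ 2 <= hnorm (E (\bigcup_n D n) u) ^+ 2.
Proof.
move=> mD tD; have h := pvm_bigcup_norm u mD tD.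
rewrite -(cvg_lim (@Rhausdorff R) h).
apply: (@nondecreasing_cvgn_le _ (fun n => \sum_(0 <= k < n) hnorm (E (D k) u) ^+ 2)).
  apply/nondecreasing_seqP => k; rewrite big_nat_recr//= lerDl sqr_ge0//.
by apply/cvg_ex; eexists; exact: h.
Qed.

Lemma pvm_nondecreasing_cvg (D : nat -> set R) u : (forall n, measurable (D n)) ->
  {homo D : n m / (n <= m)%N >-> n `<=` m} ->
  (fun n => E (D n) u) @ \oo --> E (\bigcup_n D n) u.
Proof.
move=> mD hD.
have mS n : measurable (seqD D n) by case: n => [|n] //=; exact: measurableD.
have hD' : nondecreasing_seq D by move=> n m nm; apply/subsetPset; exact: hD.
have := pvm_sigma u mS (trivIset_seqD hD'); rewrite eq_bigcup_seqD.
move=> /hnorm_cvgP h; apply/hnorm_cvgP => e /h[N NP]; exists N => n Nn.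
have -> : E (D n) u = \sum_(0 <= k < n.+1) E (seqD D k) u.
  elim: n {Nn} => [|n IHn]; first by rewrite big_nat1.
  rewrite big_nat_recr//= -IHn -pvmU//; last 2 first.
    by exact: measurableD.
    by rewrite setDIK.
  congr E; rewrite setDUK//; exact: hD.
by apply: NP; rewrite (leq_trans Nn).
Qed.

Arguments pvm_nondecreasing_cvg {D} u _ _.

(* An estimate holds on B if it holds, up to square summable errors of
   arbitrarily small size, on the pieces of countable partitions. *)
Lemma local_principle w a (eps : R) B : measurable B -> 0 <= eps ->
  (exists K : R, forall d : R, 0 < d -> d <= 1 ->
    exists (D : nat -> set R) (t : nat -> R),
    [/\ forall k, measurable (D k), trivIset setT D, \bigcup_k D k = setT,
      forall k, hnorm (E (B `&` D k) w) <= eps * hnorm (E (B `&` D k) a) + d * t k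
    & forall N, \sum_(0 <= k < N) t k ^+ 2 <= K]) ->
  hnorm (E B w) <= eps * hnorm (E B a).
Proof.
move=> mB eps0 [K KP].
pose A2 := hnorm (E B a) ^+ 2.
have A20 : 0 <= A2 by exact: sqr_ge0.
have K0 : 0 <= K.
  have [D [t [_ _ _ _ /(_ 0%N)]]] := KP 1 ltr01 (lexx _).
  by rewrite big_geq.
pose M := eps * (A2 + K) + K.
have M0 : 0 <= M by rewrite addr_ge0// mulr_ge0// addr_ge0.
have main d : 0 < d -> d <= 1 -> hnorm (E B w) ^+ 2 <= eps ^+ 2 * A2 + d * M.
  move=> d0 d1; have [D [t [mD tD DT Dw tK]]] := KP d d0 d1.
  have mBD k : measurable (B `&` D k) by exact: measurableI.
  have tBD : trivIset setT (fun k => B `&` D k).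
    by apply: trivIset_setIl.
  have BU : \bigcup_k (B `&` D k) = B by rewrite -setI_bigcupr DT setIT.
  have hw := pvm_bigcup_norm w mBD tBD; rewrite BU in hw.
  rewrite -(cvg_lim (@Rhausdorff R) hw); apply: limr_le.
    by apply/cvg_ex; eexists; exact: hw.
  near=> n.
  have ha := pvm_bessel a n mBD tBD; rewrite BU -/A2 in ha.
  (* The cross term is absorbed by 2yz <= y^2 + z^2, so that after summation the error is [d] times
     a constant [M] independent of the partition. *)
  have step k : hnorm (E (B `&` D k) w) ^+ 2 <=
      eps ^+ 2 * hnorm (E (B `&` D k) a) ^+ 2 +
      d * (eps * (hnorm (E (B `&` D k) a) ^+ 2 + t k ^+ 2) + t k ^+ 2).
    have := Dw k; have := hnorm_ge0 (E (B `&` D k) w).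
    move: (hnorm (E _ w)) (hnorm (E _ a)) (t k) => x y z x0 xyz.
    have : x ^+ 2 <= (eps * y + d * z) ^+ 2.
      by rewrite lerXn2r ?nnegrE// (le_trans x0).
    move=> /le_trans; apply.
    have d0' := ltW d0.
    have h1 : 0 <= eps * d * (y - z) ^+ 2 by apply: mulr_ge0; [apply: mulr_ge0|apply: sqr_ge0].
    have h2 : 0 <= d * (1 - d) * z ^+ 2
      by apply: mulr_ge0; [apply: mulr_ge0; rewrite ?subr_ge0|apply: sqr_ge0].
    by move: h1 h2; rewrite !expr2; clear; lra.
  apply: (le_trans (ler_sum _ (fun k _ => step k))).
  rewrite big_split/= -!mulr_sumr big_split/= -!mulr_sumr big_split/=.
  have := tK n; move: ha; set sa := \sum_(_ <= _ < _) _; set st := \sum_(_ <= _ < _) _.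
  move=> ha ht; rewrite /M lerD ?ler_wpM2l ?sqr_ge0 ?(ltW d0)//.
  by rewrite lerD// ler_wpM2l// lerD.
rewrite -(ler_pXn2r (_ : 0 < 2)%N) ?nnegrE ?mulr_ge0 ?hnorm_ge0// exprMn -/A2.
apply/ler_addgt0Pr => /= e e0.
pose d := Num.min 1 (e / (M + 1)).
have d0 : 0 < d by rewrite lt_min ltr01 divr_gt0// ltr_wpDl.
have d1 : d <= 1 by rewrite ge_min lexx.
apply: (le_trans (main d d0 d1)); rewrite lerD2l.
have : d * (M + 1) <= e by rewrite -ler_pdivlMr ?ltr_wpDl// ge_min lexx orbT.
by move: d0; clear; lra.
Unshelve. all: by end_near. Qed.

End ProjectionValuedMeasure.

(** * Spectral integrals *)

Section Cells.
Context {R : realType}.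
Local Notation C := R[i].

Definition cmeasurable (f : R -> C) :=
  measurable_fun setT (fun x => complex.Re (f x)) /\
  measurable_fun setT (fun x => complex.Im (f x)).

Lemma measurable_cell (u : R -> R) (d : R) (p : int) : measurable_fun setT u ->
  0 < d -> measurable [set x | Num.floor (u x / d) = p].
Proof.
move=> mu d0; have -> : [set x | Num.floor (u x / d) = p] =
    setT `&` u @^-1` `[p%:~R * d, (p + 1)%:~R * d[%classic.
  rewrite setTI; apply/seteqP; split=> x /=; rewrite in_itv/=.
    by move=> <-; rewrite -ler_pdivlMr// -ltr_pdivrMr// floor_itv.
  by rewrite -ler_pdivlMr// -ltr_pdivrMr// => /floor_def.
by apply: mu => //; exact: measurable_itv.
Qed.

(** Preimages of the squares of a grid of side [d / 2], enumerated by the codes of their integer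
    indices; [c k] is a corner of the square, or 0 when [k] codes nothing and the cell is empty. The
    last clause makes sums over cells finite wherever [f] is bounded. *)
Lemma cmeasurable_cells (f : R -> C) (d : R) : cmeasurable f -> 0 < d ->
  exists (D : nat -> set R) (c : nat -> C),
  [/\ forall k, measurable (D k), trivIset setT D, \bigcup_k D k = setT,
      forall k x, D k x -> cmod (f x - c k) <= d
    & forall K : R, exists N : nat, forall x, cmod (f x) <= K ->
        exists2 k, (k < N)%N & D k x].
Proof.
move=> [mfr mfi] d0; pose r := d / 2.
have r0 : 0 < r by rewrite divr_gt0.
pose idx x : int * int :=
  (Num.floor (complex.Re (f x) / r), Num.floor (complex.Im (f x) / r)).
pose D k := [set x | pickle (idx x) = k].
pose c k : C := if pickle_inv k is Some p
  then (p.1%:~R * r) +i* (p.2%:~R * r) else 0.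
exists D, c; split.
- move=> k; have [[[p1 p2] pk]|np] := pselect (exists p : int * int, pickle p = k).
    have -> : D k = [set x | Num.floor (complex.Re (f x) / r) = p1] `&`
        [set x | Num.floor (complex.Im (f x) / r) = p2].
      apply/seteqP; split=> x; rewrite /D /=.
        by rewrite -pk => /(pcan_inj pickleK)[-> ->].
      by rewrite -pk => -[<- <-].
    by apply: measurableI; exact: measurable_cell.
  suff -> : D k = set0 by exact: measurable0.
  by apply/seteqP; split=> x //= Dx; apply: np; exists (idx x).
- apply/trivIsetP => i j _ _ /eqP ij; apply/seteqP; split=> x //= -[xi xj].
  by case: ij; rewrite -xi -xj.
- by apply/seteqP; split=> x // _; exists (pickle (idx x)).
- move=> k x <-; rewrite /c pickleK_inv /idx /=.
  have near1 (a : R) : `|a - (Num.floor (a / r))%:~R * r| <= r.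
    have := floor_itv (a / r); rewrite ler_pdivlMr// ltr_pdivrMr// => /andP[h1 h2].
    by rewrite ger0_norm ?subr_ge0// lerBlDl ltW// (lt_le_trans h2)// intrD mulrDl mul1r.
  rewrite (le_trans (cmod_ler_ReIm _))// !raddfB/=.
  by rewrite (le_trans (lerD (near1 _) (near1 _)))// /r -splitr.
- move=> K; pose M := (absz (Num.floor (`|K| / r))).+1.
  have bnd (a : R) : `|a| <= K ->
      exists2 i : 'I_(2 * M).+1, true & Num.floor (a / r) = (i : nat)%:Z - M%:Z.
    move=> aK; set z := Num.floor (a / r).
    have h1 : a / r <= `|K| / r.
      by rewrite ler_pM2r ?invr_gt0// (le_trans (ler_norm _))// (le_trans aK)// ler_norm.
    have h2 : - (`|K| / r) <= a / r.
      rewrite -mulNr ler_pM2r ?invr_gt0// lerNl -normrN.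
      by rewrite (le_trans (ler_norm _))// normrN (le_trans _ (ler_norm _))//; rewrite normrN.
    have z1 : z <= M%:Z.
      have : (z <= Num.floor (`|K| / r))%R by exact: le_floor.
      move=> zl; apply: le_trans zl _; rewrite /M; move: (Num.floor _) => t; lia.
    have z2 : - M%:Z <= z.
      rewrite real_floor_ge_int ?num_real// rmorphN/= (le_trans _ h2)// lerN2.
      have /andP[_ /ltW/le_trans] := floor_itv (`|K| / r); apply.
      by rewrite ler_int /M; move: (Num.floor _) => t; lia.
    have zM : (`|(z + M%:Z)%R|%N < (2 * M).+1)%N by lia.
    exists (Ordinal zM) => //=; lia.
  pose N := (\max_(i < (2 * M).+1) \max_(j < (2 * M).+1)
     pickle ((i : nat)%:Z - M%:Z, (j : nat)%:Z - M%:Z)%R).+1.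
  exists N => x fx; exists (pickle (idx x)) => //.
  have [i _ ei] := bnd _ (le_trans (ler_Re_cmod _) fx).
  have [j _ ej] := bnd _ (le_trans (ler_Im_cmod _) fx).
  rewrite ltnS /idx ei ej; apply: leq_trans (leq_bigmax i).
  exact: (leq_bigmax (F := fun j : 'I__ =>
    pickle ((i : nat)%:Z - M%:Z, (j : nat)%:Z - M%:Z)%R) j).
Qed.

End Cells.

Section ComplexMeasurable.
Context {R : realType}.
Local Notation C := R[i].
Implicit Types f g : R -> C.

Lemma cmeasurable_cst (c : C) : cmeasurable (fun=> c : C).
Proof. by split; exact: measurable_cst. Qed.

Lemma cmeasurable_real (u : R -> R) : measurable_fun setT u ->
  cmeasurable (fun x => (u x)%:C).
Proof. by move=> mu; split => //; exact: measurable_cst. Qed.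

Lemma cmeasurableD f g : cmeasurable f -> cmeasurable g ->
  cmeasurable (fun x => f x + g x).
Proof.
move=> [fr fi] [gr gi]; split.
- under eq_fun do rewrite raddfD/=; exact: measurable_funD.
- under eq_fun do rewrite raddfD/=; exact: measurable_funD.
Qed.

Lemma cmeasurableM f g : cmeasurable f -> cmeasurable g ->
  cmeasurable (fun x => f x * g x).
Proof.
move=> [fr fi] [gr gi]; split.
- have -> : (fun x => complex.Re (f x * g x)) = (fun x => complex.Re (f x) *
      complex.Re (g x) - complex.Im (f x) * complex.Im (g x)).
    by apply/funext => x; case: (f x) (g x) => [? ?] [? ?].
  by apply: measurable_funB; exact: measurable_funM.
- have -> : (fun x => complex.Im (f x * g x)) = (fun x => complex.Re (f x) *
      complex.Im (g x) + complex.Im (f x) * complex.Re (g x)).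
    by apply/funext => x; case: (f x) (g x) => [? ?] [? ?].
  by apply: measurable_funD; exact: measurable_funM.
Qed.

Lemma cmeasurableN f : cmeasurable f -> cmeasurable (fun x => - f x).
Proof.
move=> mf; rewrite (_ : (fun x => _) = (fun x => -1 * f x)).
  by apply: cmeasurableM => //; exact: cmeasurable_cst.
by apply/funext => x; rewrite mulN1r.
Qed.

Lemma measurable_sqmod f : cmeasurable f ->
  measurable_fun setT (fun x : measurableTypeR R => (sqmod (f x))%:E).
Proof.
move=> [fr fi]; apply/measurable_EFinP.
by apply: measurable_funD; exact: measurable_funX.
Qed.

Lemma cmeasurable_simple (s : seq (C * set R)) :
  {in s, forall p, measurable p.2} ->
  cmeasurable (fun x => \sum_(p <- s) p.1 * (\1_(p.2) x)%:C).
Proof.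
elim: s => [|p s IHs] ms.
  by under eq_fun do rewrite big_nil; exact: cmeasurable_cst.
under eq_fun do rewrite big_cons; apply: cmeasurableD.
  apply: cmeasurableM; first exact: cmeasurable_cst.
  by apply: cmeasurable_real; apply: measurable_indic; apply: ms; rewrite mem_head.
by apply: IHs => q qs; apply: ms; rewrite inE qs orbT.
Qed.

End ComplexMeasurable.

(** * The local description of spectral integrals and its calculus *)

Section LocalCalculus.
Context {R : realType} {H : completeNormedModType R[i]}.
Local Notation C := R[i].
Variable ip : {dot H for (@Num.conj R[i])}.
Hypothesis Hip : hilbert ip.
Variable E : set R -> H -> H.
Hypothesis HE : projection_valued_measure ip E.
Implicit Types (A B D : set R) (u v w a : H) (c : C) (f g h : R -> C).

(* For measurable f this is the graph of the spectral integral of f, see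
   spectral_integralE below. *)
Definition loc f u v := forall B c (e : R), measurable B ->
  (forall x, B x -> cmod (f x - c) <= e) ->
  hnorm (E B (v - c *: u)) <= e * hnorm (E B u).

Lemma loc_on f u v D c (e : R) : loc f u v -> measurable D ->
  (forall x, D x -> cmod (f x - c) <= e) ->
  hnorm (E D v - c *: E D u) <= e * hnorm (E D u).
Proof. by move=> fuv mD fD; have := fuv D c e mD fD; rewrite (pvmB HE)// (pvmZ HE). Qed.

Lemma locP f u v : (forall B c (e : R), measurable B -> 0 <= e ->
    (forall x, B x -> cmod (f x - c) <= e) ->
    hnorm (E B (v - c *: u)) <= e * hnorm (E B u)) -> loc f u v.
Proof.
move=> fuv B c e mB fB; have [->|/set0P[x Bx]] := eqVneq B set0.
  by rewrite !(pvm_set0 HE) hnorm0 mulr0.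
by apply: fuv => //; exact: le_trans (cmod_ge0 _) (fB x Bx).
Qed.

(** Common refinement of the cells of [f] and [g]: an estimate has to be proved only where both
    functions are nearly constant. By Bessel's inequality for [u] and [u'], errors proportional to
    the pieces of these two vectors are square summable, and [M] may be anything independent of
    [d]. *)
Lemma cells_principle f g w a u u' (eps M : R) B :
  cmeasurable f -> cmeasurable g -> measurable B -> 0 <= eps -> 0 <= M ->
  (forall (d : R) D c c', 0 < d -> d <= 1 -> measurable D -> D !=set0 ->
    D `<=` B -> (forall x, D x -> cmod (f x - c) <= d) ->
    (forall x, D x -> cmod (g x - c') <= d) ->
    hnorm (E D w) <= eps * hnorm (E D a) +
      d * (M * (hnorm (E D u) + hnorm (E D u')))) ->
  hnorm (E B w) <= eps * hnorm (E B a).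
Proof.
move=> mf mg mB eps0 M0 DP; apply: (local_principle Hip HE) => //.
exists (2 * M ^+ 2 * (hnorm u ^+ 2 + hnorm u' ^+ 2)) => d d0 d1.
have [F [c [mF tF FT Fc _]]] := cmeasurable_cells mf d0.
have [G [c' [mG tG GT Gc _]]] := cmeasurable_cells mg d0.
pose D k := if pickle_inv k is Some p then F p.1 `&` G p.2 else set0.
have mD k : measurable (D k).
  by rewrite /D; case: pickle_inv => [[i j]|]; [exact: measurableI|exact: measurable0].
have tD : trivIset setT D.
  apply/trivIsetP => k l _ _ /eqP kl; apply/seteqP; split=> x //= -[]; rewrite /D.
  have := @pickle_invK (nat * nat)%type k; have := @pickle_invK (nat * nat)%type l.
  case: (pickle_inv k) => [[i j]|//] /=; case: (pickle_inv l) => [[i' j']|//] /=.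
  move=> pl pk [Fi Gj] [Fi' Gj']; apply: kl; rewrite -pl -pk.
  have -> : i = i' by apply: tF => //; exists x.
  by have -> : j = j' by apply: tG => //; exists x.
have DT : \bigcup_k D k = setT.
  apply/seteqP; split=> x // _.
  have [i _ Fi] : (\bigcup_k F k) x by rewrite FT.
  have [j _ Gj] : (\bigcup_k G k) x by rewrite GT.
  by exists (pickle (i, j)) => //; rewrite /D pickleK_inv.
have mBD k : measurable (B `&` D k) by exact: measurableI.
exists D, (fun k => M * (hnorm (E (B `&` D k) u) + hnorm (E (B `&` D k) u'))).
split=> // [k|N].
  have [->|/set0P BD0] := eqVneq (B `&` D k) set0.
    by rewrite !(pvm_set0 HE) !hnorm0 addr0 !mulr0 addr0.
  move: BD0 (mBD k); rewrite /D; case: (pickle_inv k) => [[i j]|] /=; last first.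
    by rewrite setI0 => -[].
  move=> BD0 mBk; apply: (DP d _ (c i) (c' j)) => //.
  - by move=> x [_ [Fx _]]; exact: Fc.
  - by move=> x [_ [_ Gx]]; exact: Gc.
pose S v := \sum_(0 <= k < N) hnorm (E (B `&` D k) v) ^+ 2.
have SP v : S v <= hnorm v ^+ 2.
  have tBD : trivIset setT (fun k => B `&` D k) by apply: trivIset_setIl.
  apply: le_trans (pvm_bessel Hip HE v N mBD tBD) _.
  by rewrite lerXn2r ?nnegrE ?hnorm_ge0// (pvm_contract Hip HE)//; exact: bigcup_measurable.
have : \sum_(0 <= k < N) (M * (hnorm (E (B `&` D k) u) + hnorm (E (B `&` D k) u'))) ^+ 2
    <= 2 * M ^+ 2 * (S u + S u').
  rewrite /S -big_split/= mulr_sumr; apply: ler_sum => k _.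
  have := sqr_ge0 (M * (hnorm (E (B `&` D k) u) - hnorm (E (B `&` D k) u'))).
  by move: (hnorm _) (hnorm _) => x y; rewrite !expr2; lra.
move=> /le_trans; apply; rewrite ler_wpM2l ?lerD//.
by rewrite mulr_ge0// sqr_ge0.
Qed.

(** On a cell [D] where f is within d of c, both values are within d |E(D) u| of the same vector c
    E(D) u. *)
Lemma loc_unique f u v v' : cmeasurable f -> loc f u v -> loc f u v' -> v = v'.
Proof.
move=> mf fv fv'; apply/eqP; rewrite -subr_eq0; apply/eqP/hnorm_le0.
suff : hnorm (E setT (v - v')) <= 0 * hnorm (E setT 0) by rewrite mul0r (pvmT HE).
apply: (cells_principle (u := u) (u' := 0) (M := 2) mf mf) => // d D c _ d0 _ mD _ _ fD _.
rewrite mul0r add0r (pvm0 HE)// hnorm0 addr0.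
have := loc_on fv mD fD; have := loc_on fv' mD fD; rewrite (pvmB HE)//.
have -> : E D v - E D v' = (E D v - c *: E D u) - (E D v' - c *: E D u).
  by rewrite opprB addrA subrK.
by move=> h1 h2; rewrite (le_trans (ler_hnormB _ _))//; move: h1 h2; lra.
Qed.

Lemma loc_lin f c u v u' v' : cmeasurable f -> loc f u v -> loc f u' v' ->
  loc f (c *: u + u') (c *: v + v').
Proof.
move=> mf fv fv'; apply: locP => B p e mB e0 fB.
have c0 := cmod_ge0 c.
apply: (cells_principle (u := u) (u' := u') (M := 2 * (cmod c + 1)) mf mf) => //.
  by rewrite mulr_ge0// addr_ge0.
move=> d D q _ d0 _ mD [x Dx] DB fD _.
have h1 := loc_on fv mD fD; have h2 := loc_on fv' mD fD.
have qp : cmod (q - p) <= d + e.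
  rewrite -(subrKA (f x)) (le_trans (cmodD _ _))// cmodC lerD ?fD//.
  by apply: fB; exact: DB.
rewrite (pvmB HE)// (pvmZ HE)// !(pvm_lin HE)//.
move: (E D u) (E D v) (E D u') (E D v') h1 h2 => x1 y1 x2 y2 h1 h2.
have -> : c *: y1 + y2 - p *: (c *: x1 + x2) =
    (c *: (y1 - q *: x1) + (y2 - q *: x2)) + (q - p) *: (c *: x1 + x2).
  by apply: (ip_ext Hip) => z; rewrite !(ipDl, ipNl, ipZl); ring.
have h3 : hnorm (c *: (y1 - q *: x1)) <= cmod c * (d * hnorm x1).
  by rewrite hnormZ ler_wpM2l.
have h4 : hnorm ((q - p) *: (c *: x1 + x2)) <= (d + e) * hnorm (c *: x1 + x2).
  by rewrite hnormZ ler_wpM2r// hnorm_ge0.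
have h5 := ler_hnormD (c *: x1) x2; rewrite hnormZ in h5.
rewrite (le_trans (ler_hnormD _ _))// (le_trans (lerD (ler_hnormD _ _) (lexx _)))//.
have h6 := ler_wpM2l (ltW d0) h5.
have h7 := mulr_ge0 (ltW d0) (hnorm_ge0 x1).
have h8 := mulr_ge0 (mulr_ge0 (ltW d0) c0) (hnorm_ge0 x2).
have h9 := mulr_ge0 (ltW d0) (hnorm_ge0 x2).
move: h2 h3 h4 h6 h7 h8 h9; nra.
Qed.

End LocalCalculus.

Section LocalCalculusLaws.
Context {R : realType} {H : completeNormedModType R[i]}.
Local Notation C := R[i].
Variable ip : {dot H for (@Num.conj R[i])}.
Hypothesis Hip : hilbert ip.
Variable E : set R -> H -> H.
Hypothesis HE : projection_valued_measure ip E.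
Implicit Types (A B D : set R) (u v w a : H) (c : C) (f g h : R -> C).
Local Notation loc := (loc E).

Lemma loc_scale f c u v : loc f u v -> loc f (c *: u) (c *: v).
Proof.
move=> fuv B p e mB fB.
have -> : c *: v - p *: (c *: u) = c *: (v - p *: u).
  by rewrite scalerBr !scalerA mulrC.
by rewrite !(pvmZ HE)// !hnormZ mulrCA ler_wpM2l ?cmod_ge0// fuv.
Qed.

Lemma loc_id c u : loc (fun=> c) u (c *: u).
Proof.
apply: (locP HE) => B p e mB e0 fB.
have [->|/set0P[x Bx]] := eqVneq B set0.
  by rewrite !(pvm_set0 HE) hnorm0 mulr0.
by rewrite -scalerBl (pvmZ HE)// hnormZ ler_wpM2r ?hnorm_ge0// (fB x).
Qed.

Lemma loc_symlin f g c u v w : cmeasurable f -> cmeasurable g ->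
  loc f u v -> loc g u w -> loc (fun x => c * f x + g x) u (c *: v + w).
Proof.
move=> mf mg fv gw; apply: (locP HE) => B p e mB e0 fgB.
have c0 := cmod_ge0 c.
apply: (cells_principle Hip HE (u := u) (u' := 0) (M := 2 * (cmod c + 1)) mf mg) => //.
  by rewrite mulr_ge0// addr_ge0.
move=> d D q r d0 _ mD [x Dx] DB fD gD.
have h1 := loc_on HE fv mD fD; have h2 := loc_on HE gw mD gD.
have h3 : cmod (c * q + r - p) <= cmod c * d + d + e.
  have -> : c * q + r - p = c * (q - f x) + (r - g x) + (c * f x + g x - p) by ring.
  rewrite (le_trans (cmodD _ _))// lerD//; last by apply: fgB; exact: DB.
  rewrite (le_trans (cmodD _ _))// lerD//; last by rewrite cmodC gD.
  by rewrite cmodM ler_wpM2l// cmodC fD.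
rewrite (pvm0 HE)// hnorm0 addr0 (pvmB HE)// (pvmZ HE)// (pvm_lin HE)//.
move: (E D u) (E D v) (E D w) h1 h2 => x1 y1 y2 h1 h2.
have -> : c *: y1 + y2 - p *: x1 =
    (c *: (y1 - q *: x1) + (y2 - r *: x1)) + (c * q + r - p) *: x1.
  by apply: (ip_ext Hip) => z; rewrite !(ipDl, ipNl, ipZl); ring.
rewrite (le_trans (ler_hnormD _ _))// (le_trans (lerD (ler_hnormD _ _) (lexx _)))//.
rewrite !hnormZ; have h4 := ler_wpM2l c0 h1.
have h5 := ler_wpM2r (hnorm_ge0 x1) h3.
by move: h2 h4 h5; lra.
Qed.

(** The substitute for the product rule of unbounded calculus: from a = f(T) u and b = (h f)(T) u it
    follows that [a] is in the domain of h(T) and b = h(T) a. On a cell with f near p, h f near q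
    and h near c, the number q is near c p. *)
Lemma loc_div f h u a b : cmeasurable f -> cmeasurable (fun x => h x * f x) ->
  loc f u a -> loc (fun x => h x * f x) u b -> loc h a b.
Proof.
move=> mf mhf fa hb; apply: (locP HE) => B c e mB e0 hB.
have c0 := cmod_ge0 c.
apply: (cells_principle Hip HE (u := u) (u' := 0) (M := 2 + 2 * cmod c + 2 * e) mf mhf) => //.
  by lra.
move=> d D p q d0 _ mD [x Dx] DB fD hD.
have h1 := loc_on HE fa mD fD; have h2 := loc_on HE hb mD hD.
have fx : cmod (f x) <= cmod p + d.
  by rewrite -(subrK p (f x)) (le_trans (cmodD _ _))// addrC lerD2l fD.
have h3 : cmod (q - c * p) <= d + e * (cmod p + d) + cmod c * d.
  have -> : q - c * p = (q - h x * f x) + (h x - c) * f x + c * (f x - p) by ring.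
  rewrite (le_trans (cmodD _ _))// lerD//; last by rewrite cmodM ler_wpM2l// fD.
  rewrite (le_trans (cmodD _ _))// lerD//; first by rewrite cmodC hD.
  by rewrite cmodM ler_pM ?cmod_ge0// hB//; exact: DB.
rewrite (pvm0 HE)// hnorm0 addr0 (pvmB HE)// (pvmZ HE)//.
move: (E D u) (E D a) (E D b) h1 h2 => x1 y1 y2 h1 h2.
have -> : y2 - c *: y1 = (y2 - q *: x1) + ((q - c * p) *: x1 - c *: (y1 - p *: x1)).
  by apply: (ip_ext Hip) => z; rewrite !(ipDl, ipNl, ipZl); ring.
rewrite (le_trans (ler_hnormD _ _))// (le_trans (lerD (lexx _) (ler_hnormB _ _)))//.
rewrite !hnormZ; have h4 := ler_wpM2l c0 h1.
have h5 := ler_wpM2r (hnorm_ge0 x1) h3.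
(* The admissible error is [e] times the piece of [a], not of [u]; this converts the product of |p|
   and the piece of [u] into the piece of [a], up to [d]. *)
have h6 : cmod p * hnorm x1 <= hnorm y1 + d * hnorm x1.
  rewrite -hnormZ -{1}(subrK y1 (p *: x1)) addrC.
  by rewrite (le_trans (ler_hnormD _ _))// lerD2l hnormB.
have h7 := ler_wpM2l e0 h6.
by move: h2 h4 h5 h7; lra.
Qed.

Lemma loc_restrict f u v A : measurable A -> loc f u v -> loc f (E A u) (E A v).
Proof.
move=> mA fuv B c e mB fB.
have mAB : measurable (B `&` A) by exact: measurableI.
have := fuv (B `&` A) c e mAB; rewrite (pvmI HE)// (pvmI HE)// (pvmB HE)// (pvmZ HE)//.
by apply => x [Bx _]; exact: fB.
Qed.

Lemma loc_support f u v A : cmeasurable f -> measurable A ->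
  loc f (E A u) v -> E A v = v.
Proof.
move=> mf mA fuv; have mC : measurable (~` A) by exact: measurableC.
suff /eqP : E (~` A) v = 0 by rewrite (pvmC HE)// subr_eq0 => /eqP.
apply: hnorm_le0; suff : hnorm (E (~` A) v) <= 0 * hnorm (E (~` A) 0) by rewrite mul0r.
apply: (cells_principle Hip HE (u := 0) (u' := 0) (M := 0) mf mf) => //.
move=> d D c _ d0 _ mD _ DA fD _; rewrite !mul0r mulr0 addr0.
have := loc_on HE fuv mD fD.
rewrite (pvm_disj HE)// ?scaler0 ?subr0 ?hnorm0 ?mulr0//.
by apply/disjoints_subset.
Qed.

Lemma loc_bound f u v A (K : R) : cmeasurable f -> measurable A ->
  (forall x, A x -> cmod (f x) <= K) ->
  loc f (E A u) v -> hnorm v <= K * hnorm (E A u).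
Proof.
move=> mf mA fK fuv; have := fuv A 0 K mA.
rewrite scale0r subr0 (loc_support mf mA fuv) (pvm_id HE)//.
by apply => x Ax; rewrite subr0 fK.
Qed.

Lemma loc_closed f (us vs : nat -> H) u v : (forall n, loc f (us n) (vs n)) ->
  us @ \oo --> u -> vs @ \oo --> v -> loc f u v.
Proof.
move=> fn uu vv; apply: (locP HE) => B c e mB e0 fB.
apply/ler_addgt0Pl => /= r r0.
have c0 := cmod_ge0 c; have K0 : 0 < 1 + cmod c + e by lra.
have [N NP] := (hnorm_cvgP _ _).1 uu _ (divr_gt0 r0 K0).
have [M MP] := (hnorm_cvgP _ _).1 vv _ (divr_gt0 r0 K0).
set n := maxn N M; have := NP n (leq_maxl _ _); have := MP n (leq_maxr _ _).
set s := r / _ => h1 h2.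
have sE : s * (1 + cmod c + e) = r by rewrite divfK// gt_eqF.
have := fn n B c e mB fB.
have {}h1 : hnorm (E B (vs n) - E B v) <= s.
  by rewrite -(pvmB HE)// (le_trans (pvm_contract Hip HE _ mB))// ltW.
have {}h2 : hnorm (E B (us n) - E B u) <= s.
  by rewrite -(pvmB HE)// (le_trans (pvm_contract Hip HE _ mB))// ltW.
rewrite !(pvmB HE)// !(pvmZ HE)// -sE.
move: (E B (us n)) (E B (vs n)) (E B u) (E B v) h1 h2 => x1 y1 x2 y2 h1 h2 h3.
have -> : y2 - c *: x2 = (y1 - c *: x1) - (y1 - y2) + c *: (x1 - x2).
  by apply: (ip_ext Hip) => z; rewrite !(ipDl, ipNl, ipZl); ring.
rewrite (le_trans (ler_hnormD _ _))// (le_trans (lerD (ler_hnormB _ _) (lexx _)))//.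
rewrite hnormZ; have h4 := ler_wpM2l c0 h2.
have h5 : hnorm x1 <= hnorm x2 + s.
  by rewrite -{1}(subrK x2 x1) addrC (le_trans (ler_hnormD _ _))// lerD2l.
have h6 := ler_wpM2l e0 h5.
by move: h1 h3 h4 h6; lra.
Qed.

(** Approximate values are finite sums of q_k E(D_k) u over cells. Two of them, at scales r and s,
    differ by at most (r + s) |u|, so they form a Cauchy sequence as the scale shrinks. *)
Lemma loc_exists f A w (K : R) : cmeasurable f -> measurable A ->
  (forall x, A x -> cmod (f x) <= K) -> exists v, loc f (E A w) v.
Proof.
move=> mf mA fK; set u := E A w.
have uA : E A u = u by rewrite (pvm_id HE).
(* v approximates the value of the integral of f at u up to r *)
pose apx (r : R) v := forall B c (e : R), measurable B -> 0 <= e ->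
  (forall x, B x -> cmod (f x - c) <= e) ->
  hnorm (E B (v - c *: u)) <= (e + r) * hnorm (E B u).
have apxP (r : R) : 0 < r -> exists v, apx r v.
  move=> r0; have [D [q [mD tD DT Dq DK]]] := cmeasurable_cells mf r0.
  have [N NP] := DK K.
  (* Beyond [N] the cells do not meet [A], since f is bounded by [K] there; the finite sum therefore
     omits nothing. *)
  have outD k : (N <= k)%N -> E (D k) u = 0.
    move=> Nk; rewrite (pvm_disj HE)//; apply/seteqP; split=> x //= -[Dx Ax].
    have [i iN Di] := NP x (fK x Ax).
    have ik : i = k by apply: tD => //; exists x.
    by move: Nk; rewrite -ik leqNgt iN.
  exists (\sum_(0 <= k < N) q k *: E (D k) u) => B c e mB e0 fB.
  have er0 : 0 <= e + r by rewrite addr_ge0// ltW.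
  apply: (local_principle Hip HE) => //; exists 0 => d d0 _.
  exists D, (fun=> 0); split=> // [k|n]; last by rewrite big1// => i _; rewrite expr0n.
  rewrite mulr0 addr0.
  have mBD : measurable (B `&` D k) by exact: measurableI.
  rewrite (pvmB HE)// (pvmZ HE)// (pvm_sum HE)//.
  have [->|/set0P[x [Bx Dx]]] := eqVneq (B `&` D k) set0.
    rewrite !(pvm_set0 HE) scaler0 subr0 hnorm0 mulr0 big1 ?hnorm0// => i _.
    by rewrite (pvm_set0 HE).
  have [kN|Nk] := ltnP k N; last first.
    rewrite (pvmI HE)// outD// (pvm0 HE)// scaler0 subr0 hnorm0 mulr0.
    rewrite big1_seq ?hnorm0// => i; rewrite mem_index_iota => /andP[_ /= iN].
    rewrite (pvmZ HE)// (pvmI HE)// (pvm_disj HE (A := D k)) ?(pvm0 HE) ?scaler0//.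
    apply/seteqP; split=> y //= -[Dky Diy].
    have ik : i = k by apply: tD => //; exists y.
    by move: Nk; rewrite -ik leqNgt iN.
  rewrite (bigD1_seq k) ?mem_index_iota ?iota_uniq//= big1_seq; last first.
    move=> i /andP[ik _].
    rewrite (pvmZ HE)// (pvmI HE)// (pvm_disj HE (A := D k)) ?(pvm0 HE) ?scaler0//.
    apply/seteqP; split=> y //= -[Dky Diy]; move/eqP : ik; apply.
    by apply: tD => //; exists y.
  rewrite addr0 (pvmZ HE)// (pvm_subl HE)//.
  rewrite -scalerBl hnormZ ler_wpM2r ?hnorm_ge0//.
  rewrite -(subrKA (f x)) (le_trans (cmodD _ _))// addrC lerD ?fB//.
  by rewrite cmodC Dq.
have apx_dist (r s : R) v v' : 0 < r -> 0 < s -> apx r v -> apx s v' ->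
    hnorm (v - v') <= (r + s) * hnorm u.
  move=> r0 s0 av av'; have rs0 : 0 <= r + s by rewrite addr_ge0// ltW.
  suff : hnorm (E setT (v - v')) <= (r + s) * hnorm (E setT u) by rewrite !(pvmT HE).
  apply: (cells_principle Hip HE (u := u) (u' := 0) (M := 2) mf mf) => //.
  move=> d D c _ d0 _ mD _ _ fD _; rewrite (pvm0 HE)// hnorm0 addr0.
  have := av D c d mD (ltW d0) fD; have := av' D c d mD (ltW d0) fD.
  have -> : v - v' = (v - c *: u) - (v' - c *: u) by rewrite opprB addrA subrK.
  rewrite [in X in _ -> _ -> X](pvmB HE)// => h1 h2.
  by rewrite (le_trans (ler_hnormB _ _))//; move: h1 h2; lra.
have r0 n : 0 < (2^-1 ^+ n : R) by rewrite exprn_gt0// invr_gt0.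
have /choice[vs vsP] n := apxP _ (r0 n).
have rcvg : (fun n => 2^-1 ^+ n : R) @ \oo --> 0.
  by apply: cvg_expr; rewrite ger0_norm ?invr_ge0// invf_lt1// ltr1n.
have [|v vsv] := @hnorm_cauchy _ _ vs.
  move=> e e0; have u0 := hnorm_ge0 u; have u1 : 0 < 2 * (hnorm u + 1) by lra.
  have [N NP] := (cvgnP _ _).1 rcvg _ (divr_gt0 e0 u1); exists N => n m Nn Nm.
  have := NP n Nn; have := NP m Nm; rewrite !subr0.
  rewrite (ger0_norm (ltW (r0 n))) (ger0_norm (ltW (r0 m))) !ltr_pdivlMr// => h1 h2.
  apply: le_lt_trans (apx_dist _ _ _ _ (r0 n) (r0 m) (vsP n) (vsP m)) _.
  have := r0 n; have := r0 m; move: (2^-1 ^+ n) (2^-1 ^+ m) h1 h2 => x y.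
  nra.
exists v; apply: (locP HE) => B c e mB e0 fB.
apply/ler_addgt0Pl => /= s s0.
have u0 := hnorm_ge0 u; have K0 : 0 < hnorm u + 1 by lra.
have [N NP] := (cvgnP _ _).1 rcvg _ (divr_gt0 (divr_gt0 s0 (ltr0n _ 2)) K0).
have [N' NP'] := (hnorm_cvgP _ _).1 vsv _ (divr_gt0 s0 (ltr0n _ 2)).
set n := maxn N N'; have := NP n (leq_maxl _ _); have := NP' n (leq_maxr _ _).
rewrite subr0 (ger0_norm (ltW (r0 n))) => h1; rewrite ltr_pdivlMr// => h2.
have h3 := vsP n B c e mB e0 fB.
have -> : v - c *: u = (vs n - c *: u) - (vs n - v).
  by apply: (ip_ext Hip) => z; rewrite !(ipDl, ipNl, ipZl); ring.
rewrite (pvmB HE)// (le_trans (ler_hnormB _ _))//.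
have h4 := pvm_contract Hip HE (vs n - v) mB.
have h5 := pvm_contract Hip HE u mB.
have h6 := ler_wpM2l (ltW (r0 n)) h5.
have h7 := r0 n.
by move: h1 h2 h3 h4 h6 h7; move: (2^-1 ^+ n) => x; nra.
Qed.

(** On each cell both inner products are close to q_k times that of the pieces of [u] and [w], with
    an error at most d (|E(D_k) u|^2 + |E(D_k) w|^2); these errors are summable by Bessel's
    inequality, and d is arbitrary. *)
Lemma loc_adj f u v w w' : cmeasurable f ->
  loc f u v -> loc (fun x => conjc (f x)) w w' -> ip v w = ip u w'.
Proof.
move=> mf fv fw; apply/eqP; rewrite -subr_eq0; apply/eqP/cmod_eq0.
apply: le_anti; rewrite cmod_ge0 andbT; apply/ler_addgt0Pl => /= e e0.
rewrite addr0.
set K := hnorm u ^+ 2 + hnorm w ^+ 2; have K0 : 0 <= K by rewrite addr_ge0// sqr_ge0.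
have d0 : 0 < e / 2 / (K + 1) by rewrite !divr_gt0// ltr_wpDl.
set d := _ / _ in d0.
have dE : d * (K + 1) = e / 2 by rewrite divfK// gt_eqF// ltr_wpDl.
have [D [q [mD tD DT Dq _]]] := cmeasurable_cells mf d0.
have part n : cmod (ip (\sum_(0 <= k < n) E (D k) v) w -
    ip (\sum_(0 <= k < n) E (D k) u) w') <= d * K.
  rewrite !ip_suml -sumrB.
  apply: (le_trans (cmod_ler_sum _ _)).
  apply: (@le_trans _ _ (\sum_(0 <= k < n) d *
    (hnorm (E (D k) u) ^+ 2 + hnorm (E (D k) w) ^+ 2))).
    apply: ler_sum => k _.
    have h1 := loc_on HE fv (mD k) (Dq k).
    have h2 : hnorm (E (D k) w' - conjc (q k) *: E (D k) w) <= d * hnorm (E (D k) w).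
      apply: (loc_on HE fw (mD k)) => x Dx; rewrite -rmorphB /=.
      by rewrite -lecR -!cmodE normcJ cmodE lecR Dq.
    have pe x y : ip (E (D k) x) y = ip (E (D k) x) (E (D k) y).
      by rewrite -[RHS](pvm_adj HE)// (pvm_id HE).
    rewrite (pe v w) (pe u w').
    move: (E (D k) u) (E (D k) v) (E (D k) w) (E (D k) w') h1 h2 => x y z t h1 h2.
    have -> : ip y z - ip x t = ip (y - q k *: x) z - ip x (t - conjc (q k) *: z).
      by rewrite !(ipDl, ipDr, ipNl, ipNr, ipZl, ipZr) conjcK; ring.
    rewrite (le_trans (cmodB _ _))//.
    have h3 := cauchy_schwarz Hip (y - q k *: x) z.
    have h4 := cauchy_schwarz Hip x (t - conjc (q k) *: z).
    have h5 := ler_wpM2r (hnorm_ge0 z) h1; have h6 := ler_wpM2l (hnorm_ge0 x) h2.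
    have := mulr_ge0 (ltW d0) (sqr_ge0 (hnorm x - hnorm z)).
    by rewrite !expr2; move: h3 h4 h5 h6; lra.
  rewrite -mulr_sumr ler_wpM2l ?(ltW d0)// big_split/= lerD//.
    by have := pvm_bessel Hip HE u n mD tD; rewrite DT (pvmT HE).
  by have := pvm_bessel Hip HE w n mD tD; rewrite DT (pvmT HE).
have e40 : 0 < e / 4 by rewrite divr_gt0.
have cu := @pvm_sigma _ _ _ _ HE D u mD tD; rewrite DT (pvmT HE) in cu.
have cv := @pvm_sigma _ _ _ _ HE D v mD tD; rewrite DT (pvmT HE) in cv.
have [N NP] := ip_cvg Hip w' cu e40; have [M MP] := ip_cvg Hip w cv e40.
set n := maxn N M; have := NP n (leq_maxl _ _); have := MP n (leq_maxr _ _).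
have := part n; move: (ip (\sum_(_ <= _ < _) _) w) (ip (\sum_(_ <= _ < _) _) w').
move=> p r h1 h2 h3.
have -> : ip v w - ip u w' = (p - r) - (p - ip v w) + (r - ip u w') by ring.
rewrite (le_trans (cmodD _ _))// (le_trans (lerD (cmodB _ _) (lexx _)))//.
by move: h1 h2 h3 dE d0; lra.
Qed.

End LocalCalculusLaws.

(** * Agreement of the local description with the L^2 definition *)

Section SimpleIntegral.
Context {R : realType}.
Variable mu : {measure set (measurableTypeR R) -> \bar R}.
Hypothesis mufin : (mu setT < +oo)%E.

Lemma finite_measure_fin (A : set (measurableTypeR R)) :
  measurable A -> mu A \is a fin_num.
Proof.
move=> mA; rewrite ge0_fin_numE//; apply: le_lt_trans mufin.
by apply: le_measure; rewrite ?inE.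
Qed.

Lemma integrable_indic_fin (A : set (measurableTypeR R)) : measurable A ->
  mu.-integrable setT (fun x => (\1_A x : R)%:E).
Proof.
move=> mA; apply/integrableP; split; first by apply/measurable_EFinP.
rewrite (eq_integral (fun x => (\1_A x)%:E)); last first.
  by move=> t _; rewrite gee0_abs// lee_fin.
by rewrite integral_indic// setIT -ge0_fin_numE// finite_measure_fin.
Qed.

Lemma integral_simple (s : seq (R * set R)) :
  (forall p, p \in s -> measurable p.2) ->
  mu.-integrable setT (fun x => (\sum_(p <- s) p.1 * \1_(p.2) x)%:E) /\
  (\int[mu]_x (\sum_(p <- s) p.1 * \1_(p.2) x)%:E =
    (\sum_(p <- s) p.1 * fine (mu p.2))%:E)%E.
Proof.
elim: s => [|p s IHs] ms.
  split; first by under eq_fun do rewrite big_nil; exact: integrable0.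
  by under eq_integral do rewrite big_nil; rewrite integral0 big_nil.
have mp : measurable p.2 by apply: ms; rewrite mem_head.
have [i1 e1] := IHs (fun q qs => ms q (mem_behead (s := p :: s) qs)).
have i2 : mu.-integrable setT (fun x => (p.1)%:E * (\1_(p.2) x : R)%:E)%E.
  by apply: integrableZl => //; exact: integrable_indic_fin.
have eqf : (fun x => (\sum_(q <- p :: s) q.1 * \1_(q.2) x)%:E) =
    ((fun x => (p.1)%:E * (\1_(p.2) x : R)%:E) \+
     (fun x => (\sum_(q <- s) q.1 * \1_(q.2) x)%:E))%E.
  by apply/funext => x /=; rewrite big_cons EFinD EFinM.
rewrite eqf; split; first exact: integrableD.
rewrite integralD// integralZl//; last exact: integrable_indic_fin.
by rewrite integral_indic// setIT e1 big_cons EFinD EFinM fineK// finite_measure_fin.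
Qed.

End SimpleIntegral.

Section SpectralIntegral.
Context {R : realType} {H : completeNormedModType R[i]}.
Local Notation C := R[i].
Variable ip : {dot H for (@Num.conj R[i])}.
Hypothesis Hip : hilbert ip.
Variable E : set R -> H -> H.
Hypothesis HE : projection_valued_measure ip E.
Implicit Types (A B D : set R) (u v w a : H) (c : C) (f g h : R -> C).

Lemma sqmodE c : sqmod c = cmod c ^+ 2.
Proof. by rewrite cmod_sqr. Qed.

Lemma sqmod_ge0 c : 0 <= sqmod c.
Proof. by rewrite sqmodE sqr_ge0. Qed.

Lemma Re_mul_conjc (a b : C) (x y : R) :
  complex.Re ((a * x%:C) * conjc (b * y%:C)) =
  complex.Re (a * conjc b) * (x * y).
Proof. by case: a b => [? ?] [? ?] /=; ring. Qed.

Section Measure.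
Variables (u : H) (mu : {measure set (measurableTypeR R) -> \bar R}).
Hypothesis muE : forall A, measurable A ->
  mu A = (complex.Re (ip (E A u) u))%:E.

Lemma spectral_mu_fin : (mu setT < +oo)%E.
Proof. by rewrite muE// ltry. Qed.

Lemma spectral_muE A : measurable A -> mu A = (hnorm (E A u) ^+ 2)%:E.
Proof. by move=> mA; rewrite muE// (pvm_sqr Hip HE). Qed.

(** The isometry on simple functions, whose sets may overlap: both sides expand into double sums,
    matched by <E(A) u, E(B) u> = |E(A and B) u|^2. *)
Lemma integral_simple_hnorm (t : seq (C * set R)) :
  {in t, forall p, measurable p.2} ->
  (\int[mu]_x (sqmod (\sum_(p <- t) p.1 * (\1_(p.2) x)%:C))%:E =
   (hnorm (\sum_(p <- t) p.1 *: E p.2 u) ^+ 2)%:E)%E.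
Proof.
move=> mt.
pose s := [seq (complex.Re (p.1 * conjc q.1), p.2 `&` q.2) | p <- t, q <- t].
have ms p : p \in s -> measurable p.2.
  move=> /allpairsP[[a b] /= [ta tb ->]] /=.
  by apply: measurableI; exact: mt.
have [_] := integral_simple spectral_mu_fin ms.
under eq_integral => x _.
  have -> : \sum_(p <- s) p.1 * \1_(p.2) x =
      sqmod (\sum_(p <- t) p.1 * (\1_(p.2) x)%:C).
    set z := \sum_(p <- t) _; have -> : sqmod z = complex.Re (z * conjc z).
      by case: (z) => a b; rewrite /sqmod /=; ring.
    rewrite /z rmorph_sum/= mulr_suml raddf_sum/= big_allpairs_dep/=.
    apply: eq_bigr => p _; rewrite mulr_sumr raddf_sum/=.
    apply: eq_bigr => q _; by rewrite indicI/= Re_mul_conjc.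
  over.
move=> ->; congr EFin.
rewrite (hnorm_sqr Hip) ip_suml raddf_sum/= big_allpairs_dep/= big_seq [RHS]big_seq.
apply: eq_bigr => p pt; rewrite ip_sumr raddf_sum/= big_seq [RHS]big_seq.
apply: eq_bigr => q qt.
have mp := mt _ pt; have mq := mt _ qt.
have mpq : measurable (p.2 `&` q.2) by exact: measurableI.
have -> : ip (p.1 *: E p.2 u) (q.1 *: E q.2 u) =
    p.1 * conjc q.1 * (hnorm (E (p.2 `&` q.2) u) ^+ 2)%:C.
  rewrite ipZl ipZr mulrA -(ip_hnorm Hip) (pvmI HE)//; congr (_ * _).
  rewrite -[in LHS](pvm_id HE u mq) -(pvm_adj HE)// (pvm_comm HE)//.
  by rewrite -[in LHS](pvm_id HE _ mp) (pvm_adj HE).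
rewrite spectral_muE//=.
by case: (p.1 * _) => a b /=; rewrite mulr0 subr0.
Qed.

(** The approximants g_n are cut down to B and compared with c there. Young's inequality bounds |g_n
    - c|^2 by (1 + 1/r) |f - g_n|^2 + (1 + r) e^2 on B; integrate, let n grow, then let r tend to
    0. *)
Lemma spectral_integral_loc f v (s : nat -> seq (C * set R)) : cmeasurable f ->
  (forall n, {in s n, forall p, measurable p.2}) ->
  ((\int[mu]_x (sqmod (f x -
     \sum_(p <- s n) p.1 * (\1_(p.2) x)%:C)%R)%:E)%E @[n --> \oo]
    --> (0 : \bar R)) ->
  (\sum_(p <- s n) p.1 *: E p.2 u) @[n --> \oo] --> v ->
  loc E f u v.
Proof.
move=> mf ms sf sv; apply: (locP HE) => B c e mB e0 fB.
pose g n x := \sum_(p <- s n) p.1 * (\1_(p.2) x)%:C.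
have mg n : cmeasurable (g n) by exact: cmeasurable_simple.
pose K n := (\int[mu]_x (sqmod (f x - g n x))%:E)%E.
have mK n : measurable_fun setT (fun x : measurableTypeR R => (sqmod (f x - g n x))%:E).
  by apply: measurable_sqmod; apply: cmeasurableD => //; exact: cmeasurableN.
pose S n := \sum_(p <- s n) p.1 *: E p.2 u.
pose X := hnorm (E B (v - c *: u)); pose Y := hnorm (E B u); rewrite -/X -/Y.
have bound (r : R) n : 0 < r -> ((hnorm (E B (S n - c *: u)) ^+ 2)%:E <=
    (1 + r^-1)%:E * K n + ((1 + r) * e ^+ 2 * Y ^+ 2)%:E)%E.
  move=> r0; pose t := [seq (p.1, p.2 `&` B) | p <- s n] ++ [:: (- c, B)].
  have mt : {in t, forall p, measurable p.2}.
    move=> p; rewrite mem_cat => /orP[/mapP[q qs ->]|] /=.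
      by apply: measurableI => //; exact: ms qs.
    by rewrite inE => /eqP ->.
  have -> : E B (S n - c *: u) = \sum_(p <- t) p.1 *: E p.2 u.
    rewrite big_cat big_seq1 big_map/= scaleNr (pvmB HE)// (pvmZ HE)//; congr (_ - _).
    rewrite (pvm_sum HE)// big_seq [RHS]big_seq; apply: eq_bigr => p ps.
    by have mp := ms _ _ ps; rewrite (pvmZ HE)// setIC (pvmI HE).
  rewrite -integral_simple_hnorm//.
  have tE x : \sum_(p <- t) p.1 * (\1_(p.2) x)%:C = (g n x - c) * (\1_B x)%:C.
    rewrite big_cat big_seq1 big_map/= mulrBl mulNr; congr (_ - _).
    rewrite /g mulr_suml; apply: eq_bigr => p _.
    by rewrite indicI/= rmorphM mulrA.
  have -> : ((1 + r) * e ^+ 2 * Y ^+ 2)%:E =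
      (\int[mu]_x (((1 + r) * e ^+ 2)%:E * (\1_B x : R)%:E))%E.
    have k0 : 0 <= (1 + r) * e ^+ 2 by rewrite mulr_ge0 ?sqr_ge0// addr_ge0// ltW.
    have mB1 : measurable_fun setT (fun x : measurableTypeR R => (\1_B x : R)%:E).
      by apply/measurable_EFinP; exact: measurable_indic.
    rewrite (ge0_integralZl_EFin _ measurableT _ mB1 k0); last by move=> x _; rewrite lee_fin.
    by rewrite integral_indic// setIT spectral_muE// EFinM.
  have r10 : 0 <= 1 + r^-1 by rewrite addr_ge0// invr_ge0 ltW.
  rewrite -ge0_integralZl_EFin//; last by move=> x _; rewrite lee_fin sqmod_ge0.
  rewrite -ge0_integralD//; last 4 first.
  - by move=> x _; rewrite -EFinM lee_fin mulr_ge0 ?sqmod_ge0.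
  - exact: measurable_funeM.
  - by move=> x _; rewrite -EFinM lee_fin !mulr_ge0 ?sqr_ge0// addr_ge0// ltW.
  - by apply: measurable_funeM; apply/measurable_EFinP; exact: measurable_indic.
  apply: ge0_le_integral => //.
  - by move=> x _; rewrite lee_fin sqmod_ge0.
  - by apply: measurable_sqmod; exact: cmeasurable_simple.
  - apply: emeasurable_funD; first exact: measurable_funeM.
    by apply: measurable_funeM; apply/measurable_EFinP; exact: measurable_indic.
  move=> x _; rewrite tE -!EFinM -EFinD lee_fin !sqmodE cmodM exprMn cmod_real.
  rewrite indicE; case: (boolP (x \in B)) => [|_]; last first.
    rewrite normr0 expr0n !mulr0 addr0.
    by rewrite mulr_ge0 ?sqr_ge0.
  rewrite inE => Bx; rewrite normr1 expr1n !mulr1.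
  have h1 : cmod (g n x - c) <= cmod (f x - g n x) + e.
    have -> : g n x - c = - (f x - g n x) + (f x - c) by ring.
    by rewrite (le_trans (cmodD _ _))// cmodN lerD2l fB.
  have : cmod (g n x - c) ^+ 2 <= (cmod (f x - g n x) + e) ^+ 2.
    by rewrite lerXn2r ?nnegrE ?cmod_ge0// addr_ge0 ?cmod_ge0.
  move=> /le_trans; apply.
  have : 0 <= r^-1 * (cmod (f x - g n x) - r * e) ^+ 2.
    by rewrite mulr_ge0 ?sqr_ge0// invr_ge0 ltW.
  move: (cmod _) => z.
  have -> : r^-1 * (z - r * e) ^+ 2 = r^-1 * z ^+ 2 - 2 * z * e + r * e ^+ 2.
    by field; rewrite gt_eqF.
  by rewrite !expr2; lra.
(* [r ^+ 2 + r] is (1 + 1/r) r^2: n is taken so large that the L^2 error is below r^2. *)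
have XY (r : R) : 0 < r -> X ^+ 2 <= r ^+ 2 + r + (1 + r) * e ^+ 2 * Y ^+ 2.
  move=> r0; have XX : (fun n => hnorm (E B (S n - c *: u)) ^+ 2) @ \oo --> X ^+ 2.
    have : (fun n => E B (S n - c *: u)) @ \oo --> E B (v - c *: u).
      apply/hnorm_cvgP => d d0; have [N NP] := (hnorm_cvgP _ _).1 sv _ d0.
      exists N => n /NP; apply: le_lt_trans.
      rewrite -(pvmB HE)// opprB addrA subrK.
      exact: (pvm_contract Hip HE).
    by move/hnorm_cvg => h; exact: (cvgM h h).
  rewrite -(cvg_lim (@Rhausdorff R) XX); apply: limr_le.
    by apply/cvg_ex; eexists; exact: XX.
  have [Kfin /cvgnP/(_ (r ^+ 2))] := (fine_cvgP _ _).1 sf.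
  have r20 : 0 < r ^+ 2 by rewrite exprn_gt0.
  move=> /(_ r20)[N NP]; near=> n.
  have Kn : K n \is a fin_num by near: n.
  have {NP}Kr : `|fine (K n) - 0| < r ^+ 2 by apply: NP; near: n; exists N.
  have := bound r n r0; rewrite -(fineK Kn) -EFinM -EFinD lee_fin => /le_trans; apply.
  rewrite lerD2r.
  have {}Kr : fine (K n) <= r ^+ 2.
    by rewrite ltW// (le_lt_trans _ Kr)// subr0 ler_norm.
  have r10 : 0 <= 1 + r^-1 by rewrite addr_ge0// invr_ge0 ltW.
  apply: (le_trans (ler_wpM2l r10 Kr)).
  by rewrite le_eqVlt; apply/orP; left; apply/eqP; field; rewrite gt_eqF.
rewrite -(ler_pXn2r (_ : 0 < 2)%N) ?nnegrE ?mulr_ge0 ?hnorm_ge0// exprMn.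
apply/ler_addgt0Pl => /= d d0.
pose M := 2 + e ^+ 2 * Y ^+ 2.
have M0 : 0 < M by rewrite ltr_pwDl// mulr_ge0// sqr_ge0.
pose r := Num.min 1 (d / M).
have r0 : 0 < r by rewrite lt_min ltr01 divr_gt0.
have r1 : r <= 1 by rewrite ge_min lexx.
have rM : r * M <= d by rewrite -ler_pdivlMr// ge_min lexx orbT.
rewrite (le_trans (XY r r0))//.
have : r * r <= r by rewrite -[leRHS]mulr1 ler_pM2l.
by move: rM; rewrite /M expr2; lra.
Unshelve. all: by end_near.
Qed.

End Measure.
End SpectralIntegral.

Section SpectralMeasureOf.
Context {R : realType} {H : completeNormedModType R[i]}.
Local Notation C := R[i].
Variable ip : {dot H for (@Num.conj R[i])}.
Hypothesis Hip : hilbert ip.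
Variable E : set R -> H -> H.
Hypothesis HE : projection_valued_measure ip E.
Variable u : H.

(** The two hypotheses are arguments because the measure structure attached to this function is
    proved from them. *)
Definition spectral_mu & hilbert ip & projection_valued_measure ip E :
  set (measurableTypeR R) -> \bar R := fun A => (hnorm (E A u) ^+ 2)%:E.

Let mu0 : spectral_mu Hip HE set0 = 0%E.
Proof. by rewrite /spectral_mu (pvm_set0 HE) hnorm0 expr0n. Qed.

Let mu_ge0 A : (0 <= spectral_mu Hip HE A)%E.
Proof. by rewrite lee_fin sqr_ge0. Qed.

Let mu_sigma : semi_sigma_additive (spectral_mu Hip HE).
Proof.
move=> F mF tF _; rewrite /spectral_mu.
under eq_fun do rewrite sumEFin.
apply: cvg_EFin; first by near=> n.
exact: (pvm_bigcup_norm Hip HE mF tF).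
Unshelve. all: by end_near. Qed.

HB.instance Definition _ := isMeasure.Build _ _ _ (spectral_mu Hip HE)
  mu0 mu_ge0 mu_sigma.

Lemma spectral_mu_ip (A : set R) : measurable A ->
  spectral_mu Hip HE A = (complex.Re (ip (E A u) u))%:E.
Proof. by move=> mA; rewrite /spectral_mu (pvm_sqr Hip HE). Qed.

Lemma integral_cells_le (g : R -> R) (D : nat -> set R) (a : nat -> R) (b : R) :
  measurable_fun setT g -> (forall x, 0 <= g x) ->
  (forall k, measurable (D k)) -> trivIset setT D -> \bigcup_k D k = setT ->
  (forall k x, D k x -> g x <= a k) -> (forall k, 0 <= a k) ->
  (forall n, \sum_(0 <= k < n) a k * hnorm (E (D k) u) ^+ 2 <= b) ->
  (\int[spectral_mu Hip HE]_x (g x)%:E <= b%:E)%E.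
Proof.
move=> mg g0 mD tD DT ga a0 ab.
have meg : measurable_fun setT (fun x : measurableTypeR R => (g x)%:E).
  exact/measurable_EFinP.
have := @ge0_integral_bigcup _ (measurableTypeR R) R (spectral_mu Hip HE) D
  (fun x => (g x)%:E) mD.
rewrite DT => -> //; last by move=> x _; rewrite lee_fin.
have le1 k : (\int[spectral_mu Hip HE]_(x in D k) (g x)%:E <=
    (a k * hnorm (E (D k) u) ^+ 2)%:E)%E.
  apply: (@le_trans _ _ (\int[spectral_mu Hip HE]_(x in D k) (a k)%:E)%E).
    apply: ge0_le_integral => //.
    - exact: mD.
    - by move=> x _; rewrite lee_fin.
    - by apply: measurable_funTS.
    - by move=> x Dx; rewrite lee_fin ga.
  by rewrite integral_cst ?EFinM//=; exact: mD.
apply: lime_le.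
  by apply: is_cvg_nneseries => n _ _; apply: integral_ge0 => x _; rewrite lee_fin.
near=> n; apply: (@le_trans _ _ (\sum_(0 <= k < n) (a k * hnorm (E (D k) u) ^+ 2)%:E)%E).
  by apply: lee_sum => k _; exact: le1.
by rewrite sumEFin lee_fin.
Unshelve. all: by end_near. Qed.

End SpectralMeasureOf.

Section SpectralIntegralE.
Context {R : realType} {H : completeNormedModType R[i]}.
Local Notation C := R[i].
Variable ip : {dot H for (@Num.conj R[i])}.
Hypothesis Hip : hilbert ip.
Variable E : set R -> H -> H.
Hypothesis HE : projection_valued_measure ip E.

(** The approximants take the values c_k on finitely many cells of size d. On these cells the error
    is at most d; on the remaining ones |c_k| |E(D_k) u| is controlled by the pieces of [v] and [u],
    so the discarded mass is bounded by the tails of |v|^2 and |u|^2. *)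
Lemma loc_spectral_integral (f : R -> C) (u v : H) : cmeasurable f ->
  loc E f u v -> spectral_integral ip E f (u, v).
Proof.
move=> mf fuv; exists (spectral_mu u Hip HE); split=> /= [A mA|].
  exact: spectral_mu_ip.
(* The kept cells cost at most [d * (hnorm u + 1) ^+ 2]; the tails, each at most [d], cost 2 for [v]
   and 16 for [u]. *)
pose K := 2 * (hnorm u + 1) ^+ 2 + 18.
have K0 : 0 <= K by rewrite addr_ge0// mulr_ge0// sqr_ge0.
have step (d : R) : 0 < d -> d <= 1 -> exists s : seq (C * set R),
    [/\ {in s, forall p, measurable p.2},
      (\int[spectral_mu u Hip HE]_x
        (sqmod (f x - \sum_(p <- s) p.1 * (\1_(p.2) x)%:C))%:E <= (K * d)%:E)%E
    & hnorm (\sum_(p <- s) p.1 *: E p.2 u - v) <= (hnorm u + 1) * d].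
  move=> d0 d1; have [D [c [mD tD DT Dc _]]] := cmeasurable_cells mf d0.
  have cu := pvm_bigcup_norm Hip HE (u := u) mD tD; rewrite DT (pvmT HE) in cu.
  have cv := pvm_bigcup_norm Hip HE (u := v) mD tD; rewrite DT (pvmT HE) in cv.
  have cw := pvm_sigma HE (u := v) mD tD; rewrite DT (pvmT HE) in cw.
  have [N1 N1P] := (cvgnP _ _).1 cu _ d0; have [N2 N2P] := (cvgnP _ _).1 cv _ d0.
  have [N3 N3P] := (hnorm_cvgP _ _).1 cw _ d0.
  pose N := maxn N1 (maxn N2 N3).
  have {N1P} Nu : hnorm u ^+ 2 - \sum_(0 <= k < N) hnorm (E (D k) u) ^+ 2 <= d.
    have := N1P N (leq_maxl _ _); rewrite distrC => h.
    by rewrite (le_trans (ler_norm _))// ltW.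
  have {N2P} Nv : hnorm v ^+ 2 - \sum_(0 <= k < N) hnorm (E (D k) v) ^+ 2 <= d.
    have := N2P N (leq_trans (leq_maxl _ _) (leq_maxr _ _)); rewrite distrC => h.
    by rewrite (le_trans (ler_norm _))// ltW.
  have {N3P} Nw : hnorm (\sum_(0 <= k < N) E (D k) v - v) <= d.
    by rewrite ltW// N3P// (leq_trans (leq_maxr N2 N3)) ?leq_maxr.
  have cell k : hnorm (E (D k) v - c k *: E (D k) u) <= d * hnorm (E (D k) u).
    exact: (loc_on HE fuv (mD k) (Dc k)).
  have bessel w n : \sum_(0 <= k < n) hnorm (E (D k) w) ^+ 2 <= hnorm w ^+ 2.
    by have := pvm_bessel Hip HE w n mD tD; rewrite DT (pvmT HE).
  pose s := [seq (c k, D k) | k <- index_iota 0 N]; exists s; split.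
  - by move=> p /mapP[k _ ->]; exact: mD.
  - have sE x k : D k x -> \sum_(p <- s) p.1 * (\1_(p.2) x)%:C =
        if (k < N)%N then c k else 0.
      move=> Dx; rewrite big_map/=.
      have D0 i : i != k -> c i * (\1_(D i) x)%:C = 0.
        move=> ik; rewrite indicE memNset ?mulr0// => Di.
        by move/eqP : ik; apply; apply: tD => //; exists x.
      case: ltnP => kN.
        rewrite (bigD1_seq k) ?mem_index_iota ?iota_uniq//= big1 ?addr0.
          by rewrite indicE mem_set// mulr1.
        by move=> i ik; exact: D0.
      rewrite big1_seq// => i /=; rewrite mem_index_iota/= => iN; apply: D0.
      by apply/eqP => ik; move: iN; rewrite ik ltnNge kN.
    pose a k : R := if (k < N)%N then d ^+ 2 else (cmod (c k) + d) ^+ 2.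
    have ms : {in s, forall p, measurable p.2} by move=> p /mapP[k _ ->]; exact: mD.
    apply: (@integral_cells_le _ _ _ Hip _ HE _ _ D a) => //.
    + apply/measurable_EFinP; apply: measurable_sqmod; apply: cmeasurableD => //.
      by apply: cmeasurableN; exact: cmeasurable_simple.
    + by move=> x; exact: sqmod_ge0.
    + move=> k x Dx; rewrite (sE x k Dx) sqmodE /a; case: ltnP => _.
        by rewrite lerXn2r ?nnegrE ?cmod_ge0 ?(ltW d0)// Dc.
      rewrite lerXn2r ?nnegrE ?cmod_ge0 ?addr_ge0 ?cmod_ge0 ?(ltW d0)// subr0.
      by rewrite -(subrKC (c k) (f x)) (le_trans (cmodD _ _))// lerD2l Dc.
    + by move=> k; rewrite /a; case: ifP => _; exact: sqr_ge0.
    have ak k : a k * hnorm (E (D k) u) ^+ 2 <= d ^+ 2 * hnorm (E (D k) u) ^+ 2 +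
        if (k < N)%N then 0 else 2 * hnorm (E (D k) v) ^+ 2 + 16 * hnorm (E (D k) u) ^+ 2.
      rewrite /a; case: ltnP => _; first by rewrite addr0.
      rewrite -exprMn.
      (* Here [f] may be unbounded; existence of the value [v] is what bounds the contribution of
         the large c_k. *)
      have h : (cmod (c k) + d) * hnorm (E (D k) u) <=
          hnorm (E (D k) v) + 2 * d * hnorm (E (D k) u).
        have : cmod (c k) * hnorm (E (D k) u) <= hnorm (E (D k) v) + d * hnorm (E (D k) u).
          rewrite -hnormZ -{1}(subrK (E (D k) v) (c k *: E (D k) u)) addrC.
          by rewrite (le_trans (ler_hnormD _ _))// lerD2l hnormB.
        by lra.
      apply: (@le_trans _ _ ((hnorm (E (D k) v) + 2 * d * hnorm (E (D k) u)) ^+ 2)).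
        have n0 := hnorm_ge0 (E (D k) u); have n1 := hnorm_ge0 (E (D k) v).
        have c0 := cmod_ge0 (c k); have d0' := ltW d0.
        by rewrite lerXn2r ?nnegrE ?mulr_ge0 ?addr_ge0 ?mulr_ge0.
      have := sqr_ge0 (hnorm (E (D k) v) - 2 * d * hnorm (E (D k) u)).
      have : d ^+ 2 * hnorm (E (D k) u) ^+ 2 <= hnorm (E (D k) u) ^+ 2.
        by rewrite ler_piMl ?sqr_ge0// expr_le1// ltW.
      have := sqr_ge0 (d * hnorm (E (D k) u)).
      by move: (hnorm _) (hnorm _) => x y; rewrite exprMn !expr2; lra.
    move=> n; apply: (le_trans (ler_sum _ (fun k _ => ak k))).
    rewrite big_split/= -mulr_sumr.
    have h1 : d ^+ 2 * \sum_(0 <= k < n) hnorm (E (D k) u) ^+ 2 <=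
        d * (hnorm u + 1) ^+ 2.
      rewrite ler_pM ?sqr_ge0//; first by apply: sumr_ge0 => k _; exact: sqr_ge0.
        by rewrite expr2 ler_piMl// ltW.
      rewrite (le_trans (bessel _ _))// lerXn2r ?nnegrE ?addr_ge0 ?hnorm_ge0//.
      by rewrite lerDl.
    have tail (w : H) : hnorm w ^+ 2 - \sum_(0 <= k < N) hnorm (E (D k) w) ^+ 2 <= d ->
        \sum_(0 <= k < n) (if (k < N)%N then 0 else hnorm (E (D k) w) ^+ 2) <= d.
      move=> wd; apply: le_trans wd; have := bessel w (maxn n N).
      have nN : (n <= maxn n N)%N by exact: leq_maxl.
      have Nn : (N <= maxn n N)%N by exact: leq_maxr.
      rewrite (big_cat_nat _ Nn)//= -lerBrDl => h.
      apply: le_trans h.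
      pose F k := if (k < N)%N then 0 else hnorm (E (D k) w) ^+ 2.
      have F0 k : 0 <= F k by rewrite /F; case: ifP => // _; exact: sqr_ge0.
      apply: (@le_trans _ _ (\sum_(0 <= k < maxn n N) F k)).
        by rewrite [leRHS](big_cat_nat _ nN)//= lerDl sumr_ge0.
      rewrite (big_cat_nat _ Nn)//= big1_seq ?add0r => [|k]; last first.
        by rewrite mem_index_iota /F /= => ->.
      rewrite big_seq [leRHS]big_seq; apply: ler_sum => k.
      by rewrite mem_index_iota /F => /andP[Nk _]; rewrite ltnNge Nk.
    have h2 : \sum_(0 <= k < n) (if (k < N)%N then 0 else
        2 * hnorm (E (D k) v) ^+ 2 + 16 * hnorm (E (D k) u) ^+ 2) <= 18 * d.
      apply: (@le_trans _ _ (2 * \sum_(0 <= k < n)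
        (if (k < N)%N then 0 else hnorm (E (D k) v) ^+ 2) + 16 * \sum_(0 <= k < n)
        (if (k < N)%N then 0 else hnorm (E (D k) u) ^+ 2))).
        rewrite !mulr_sumr -big_split/=; apply: ler_sum => k _.
        by case: ifP => // _; rewrite !mulr0 addr0.
      by have := tail _ Nu; have := tail _ Nv; lra.
    have := mulr_ge0 (ltW d0) (sqr_ge0 (hnorm u + 1)).
    by move: h1 h2; rewrite /K; lra.
  - rewrite big_map/= -(subrKA (\sum_(0 <= k < N) E (D k) v)).
    rewrite (le_trans (ler_hnormD _ _))// mulrDl mul1r lerD// -sumrB.
    rewrite -(ler_pXn2r (_ : 0 < 2)%N) ?nnegrE ?mulr_ge0 ?hnorm_ge0 ?(ltW d0)//.
    rewrite (pythagoras_sum Hip); last first.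
      move=> i j ij; have Dij : D i `&` D j = set0.
        by move/trivIsetP : tD => /(_ i j I I); apply; apply/eqP.
      rewrite -!(pvmZ HE)// -!(pvmB HE)//; exact: (pvm_orth HE).
    apply: (@le_trans _ _ (\sum_(0 <= k < N) d ^+ 2 * hnorm (E (D k) u) ^+ 2)).
      apply: ler_sum => k _; rewrite hnormB -exprMn lerXn2r ?nnegrE ?hnorm_ge0//.
      by rewrite mulr_ge0 ?hnorm_ge0// ltW.
    by rewrite -mulr_sumr exprMn mulrC ler_wpM2r ?sqr_ge0.
have d0 n : 0 < n.+1%:R^-1 :> R by rewrite invr_gt0.
have d1 n : n.+1%:R^-1 <= 1 :> R by rewrite invf_le1// ler1n.
have /choice[s sP] n := step _ (d0 n) (d1 n).
exists s; split.
- by move=> n; case: (sP n).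
- apply: (@squeeze_cvge _ _ _ _ (cst 0%E) _ (fun n => (K * n.+1%:R^-1)%:E)).
  + near=> n; case: (sP n) => _ -> _; rewrite andbT.
    by apply: integral_ge0 => x _; rewrite lee_fin sqmod_ge0.
  + exact: cvg_cst.
  + apply: cvg_EFin; first by near=> n.
    rewrite -[X in _ --> X](mulr0 K); apply: cvgMr; exact: cvg_harmonic.
- apply: (@hcvg_squeeze _ _ _ _ (fun n => (hnorm u + 1) * n.+1%:R^-1)).
    by move=> n; case: (sP n).
  rewrite -[X in _ --> X](mulr0 (hnorm u + 1)); apply: cvgMr; exact: cvg_harmonic.
Unshelve. all: by end_near.
Qed.

Lemma spectral_integralE (f : R -> C) (u v : H) : cmeasurable f ->
  spectral_integral ip E f (u, v) <-> loc E f u v.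
Proof.
move=> mf; split; last exact: loc_spectral_integral.
by case=> mu /= [muE [s [ms sf sv]]]; exact: (spectral_integral_loc Hip HE muE mf ms sf sv).
Qed.

End SpectralIntegralE.

(** * Powers of the modular operator *)

Section ComplexExponential.
Context {R : realType}.
Local Notation C := R[i].
Implicit Types (z w : C) (t x : R).

Definition cexp z : C :=
  (expR (complex.Re z))%:C * (cos (complex.Im z) +i* sin (complex.Im z)).

Lemma cexpD z w : cexp (z + w) = cexp z * cexp w.
Proof.
rewrite /cexp !raddfD/= expRD cosD sinD rmorphM/= mulrACA; congr (_ * _).
by apply/eqP; rewrite eq_complex/= [sin _ * cos _ + _]addrC !eqxx.
Qed.

Lemma cexp_real t : cexp t%:C = (expR t)%:C.
Proof. by rewrite /cexp/= cos0 sin0 mulr1. Qed.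

Lemma cexp0 : cexp 0 = 1.
Proof. by rewrite -[0]/((0 : R)%:C) cexp_real expR0. Qed.

Lemma cmod_cexp z : cmod (cexp z) = expR (complex.Re z).
Proof.
rewrite cmodM cmod_real ger0_norm ?expR_ge0// /cmod /= cos2Dsin2 sqrtr1 mulr1.
by [].
Qed.

Lemma cexp_conjc z : cexp (conjc z) = conjc (cexp z).
Proof.
case: z => a b; rewrite /cexp /= cosN sinN.
by apply/eqP; rewrite eq_complex/=; apply/andP; split; apply/eqP; ring.
Qed.

Lemma is_derive_epsilon (f : R -> R) x (d e : R) : is_derive x 1 f d -> 0 < e ->
  exists2 r : R, 0 < r & forall h, `|h| < r -> `|f (x + h) - f x - d * h| <= e * `|h|.
Proof.
move=> [fx <-] e0; move: fx => /cvg_ex[l fl]; rewrite /derive (cvg_lim _ fl)//.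
have /nbhs_ballP[r /= r0 rP] : nbhs (0 : R) (fun h => h != 0 ->
    `|l - h^-1 *: (f (h *: (1 : R) + x) - f x)| <= e).
  by have /cvgrPdist_le/(_ e e0) := fl.
exists r => // h hr.
have [->|h0] := eqVneq h 0; first by rewrite addr0 subrr mulr0 subrr normr0 mulr0.
have := rP h; rewrite /ball/= sub0r normrN => /(_ hr h0).
rewrite /GRing.scale/= mulr1 (addrC h) distrC => le.
have -> : f (x + h) - f x - l * h = (h^-1 * (f (x + h) - f x) - l) * h.
  by field.
by rewrite normrM ler_wpM2r.
Qed.

Lemma cexp_derive0 (e : R) : 0 < e -> exists2 r : R, 0 < r & forall w,
  cmod w < r -> cmod (cexp w - 1 - w) <= e * cmod w.
Proof.
(* The four error terms collected at the end amount to at most 9 d |w|. *)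
move=> e0; have [d [d0 d1 d8]] : exists d : R, [/\ 0 < d, d <= 1 & d * 16 <= e].
  exists (Num.min 1 (e / 16)); split; first by rewrite lt_min ltr01 divr_gt0.
    by rewrite ge_min lexx.
  by rewrite -ler_pdivlMr// ge_min lexx orbT.
have [r1 r10 h1] := is_derive_epsilon (is_derive_expR 0) d0.
have [r2 r20 h2] := is_derive_epsilon (is_derive_cos 0) d0.
have [r3 r30 h3] := is_derive_epsilon (is_derive_sin 0) d0.
exists (Num.min d (Num.min r1 (Num.min r2 r3))) => [|w]; first by rewrite !lt_min d0 r10 r20.
rewrite !lt_min => /and4P[wd w1 w2 w3].
have wa := ler_Re_cmod w; have wb := ler_Im_cmod w.
have := h1 _ (le_lt_trans wa w1); have := h2 _ (le_lt_trans wb w2).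
have := h3 _ (le_lt_trans wb w3).
rewrite !add0r expR0 cos0 sin0 oppr0 !mul0r !mul1r !subr0 !addr0.
rewrite /cexp; case: w wa wb wd {w1 w2 w3} => a b /= wa wb wd s c ex.
set m := cmod _ in wa wb wd *.
have m0 : 0 <= m := cmod_ge0 _.
rewrite (le_trans (cmod_ler_ReIm _))//=.
rewrite [X in `|X| + _](_ : _ = (expR a - 1 - a) + expR a * (cos b - 1)); last by ring.
rewrite [X in _ + `|X|](_ : _ = (expR a - 1) * sin b + (sin b - b)); last by ring.
have e1 : `|expR a - 1| <= (1 + d) * m.
  have -> : expR a - 1 = (expR a - 1 - a) + a by ring.
  rewrite (le_trans (ler_normD _ _))// mulrDl mul1r addrC lerD//.
  by rewrite (le_trans ex)// ler_wpM2l// ltW.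
have ea : `|expR a| <= 3.
  have -> : expR a = (expR a - 1) + 1 by ring.
  rewrite (le_trans (ler_normD _ _))// normr1.
  by have : (1 + d) * m <= 2 * 1; [rewrite ler_pM//; lra|lra].
have sb : `|sin b| <= (1 + d) * m.
  have -> : sin b = (sin b - b) + b by ring.
  rewrite (le_trans (ler_normD _ _))// mulrDl mul1r addrC lerD//.
  by rewrite (le_trans s)// ler_wpM2l// ltW.
have c' : `|expR a * (cos b - 1)| <= 3 * (d * m).
  by rewrite normrM ler_pM// (le_trans c)// ler_wpM2l// ltW.
have s' : `|(expR a - 1) * sin b| <= (1 + d) * m * ((1 + d) * m) by rewrite normrM ler_pM.
have ss : `|sin b - b| <= d * m by rewrite (le_trans s)// ler_wpM2l// ltW.
have ee : `|expR a - 1 - a| <= d * m by rewrite (le_trans ex)// ler_wpM2l// ltW.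
have mm : (1 + d) * m * ((1 + d) * m) <= 4 * (d * m).
  rewrite mulrACA -[_ * _ * _]/((1 + d) * (1 + d) * (m * m)) ler_pM ?mulr_ge0 ?addr_ge0 ?(ltW d0)//.
    by nra.
  by rewrite ler_wpM2r// ltW.
apply: (le_trans (lerD (ler_normD _ _) (ler_normD _ _))).
apply: (le_trans (lerD (lerD ee c') (lerD (le_trans s' mm) ss))).
have : d * 16 * m <= e * m by rewrite ler_wpM2r.
by have := mulr_ge0 (ltW d0) m0; lra.
Qed.

(** The function whose integral against the spectral measure of log T is T^z. *)
Definition ex z x : C := cexp (z * x%:C).

Lemma cmeasurable_ex z : cmeasurable (ex z).
Proof.
have Re_ex x : complex.Re (z * x%:C) = complex.Re z * x.
  by case: z => a b /=; rewrite mulr0 subr0.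
have Im_ex x : complex.Im (z * x%:C) = complex.Im z * x.
  by case: (z) => a b /=; rewrite mulr0 add0r.
have mM (a : R) : measurable_fun setT (fun x : R => a * x).
  by apply: measurable_funM; [exact: measurable_cst|exact: measurable_id].
apply: cmeasurableM.
  apply: cmeasurable_real; apply: measurableT_comp; first exact: measurable_expR.
  by under eq_fun do rewrite Re_ex; exact: mM.
split => /=; under eq_fun do rewrite Im_ex.
- apply: continuous_measurable_fun => x.
  by apply: (@continuous_comp _ _ _ _ cos); [exact: mulrl_continuous|exact: continuous_cos].
- apply: continuous_measurable_fun => x.
  by apply: (@continuous_comp _ _ _ _ sin); [exact: mulrl_continuous|exact: continuous_sin].
Qed.

Lemma exD z w x : ex (z + w) x = ex z x * ex w x.
Proof. by rewrite /ex mulrDl cexpD. Qed.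

Lemma ex0 x : ex 0 x = 1.
Proof. by rewrite /ex mul0r cexp0. Qed.

Lemma cmod_ex z x : cmod (ex z x) = expR (complex.Re z * x).
Proof. by rewrite cmod_cexp; case: z => a b /=; rewrite mulr0 subr0. Qed.

Lemma ex_conjc z x : ex (conjc z) x = conjc (ex z x).
Proof.
rewrite /ex -cexp_conjc; congr cexp; case: z => a b.
by apply/eqP; rewrite eq_complex/=; apply/andP; split; apply/eqP; ring.
Qed.

End ComplexExponential.

Section LogMeasure.
Context {R : realType} {H : completeNormedModType R[i]}.
Local Notation C := R[i].
Variable ip : {dot H for (@Num.conj R[i])}.
Hypothesis Hip : hilbert ip.
Variable E : set R -> H -> H.
Hypothesis HE : projection_valued_measure ip E.
Implicit Types (u v : H) (z : C).

(* The spectral measure of log T when E is that of a positive injective T *)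
Definition log_pvm (A : set R) : H -> H := E (@ln R @^-1` A).

Lemma measurable_preimage_ln (A : set R) : measurable A ->
  measurable (@ln R @^-1` A).
Proof. by move=> mA; rewrite -[X in measurable X]setTI; exact: measurable_ln. Qed.

Lemma log_pvmP : projection_valued_measure ip log_pvm.
Proof.
case: (HE) => h1 h2 h3 h4; split.
- by move=> A /measurable_preimage_ln; exact: h1.
- by rewrite /log_pvm preimage_setT.
- move=> A B /measurable_preimage_ln mA /measurable_preimage_ln mB.
  by rewrite /log_pvm preimage_setI h3.
- move=> A mA tA u; rewrite /log_pvm preimage_bigcup; apply: h4 => [n|].
    exact: measurable_preimage_ln.
  move=> i j _ _ [x [Ai Aj]]; apply: tA => //; by exists (ln x).
Qed.

(** For negative [s] both sides contain the same default value of [ln]; the point 0 alone is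
    exceptional, since there a power is not an exponential. *)
Lemma cpow_ex z (s : R) : s != 0 -> cpow z s = ex z (ln s).
Proof.
move=> s0; rewrite /cpow /ex /cexp /powR (negbTE s0).
have -> : complex.Re (z * (ln s)%:C) = complex.Re z * ln s.
  by case: z => a b /=; rewrite mulr0 subr0.
by have -> : complex.Im (z * (ln s)%:C) = complex.Im z * ln s
  by case: z => a b /=; rewrite mulr0 add0r.
Qed.

Lemma cmeasurable_cpow z : cmeasurable (cpow z).
Proof.
have mM (a : R) : measurable_fun setT (fun s : R => a * ln s).
  by apply: measurable_funM; [exact: measurable_cst|exact: measurable_ln].
apply: cmeasurableM.
  by apply: cmeasurable_real; exact: measurable_powR.
split => /=.
- apply: measurableT_comp; last exact: mM.
  by apply: continuous_measurable_fun; exact: continuous_cos.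
- apply: measurableT_comp; last exact: mM.
  by apply: continuous_measurable_fun; exact: continuous_sin.
Qed.

(** Injectivity of the operator with spectral measure [E]. *)
Hypothesis E0 : forall u, E [set 0] u = 0.

Lemma pvm_setD0 (A : set R) u : measurable A -> E (A `\` [set 0]) u = E A u.
Proof.
move=> mA; have m0 : measurable [set (0 : R)] by exact: measurable_set1.
have mD : measurable (A `\` [set 0]) by exact: measurableD.
have mI : measurable (A `&` [set 0]) by exact: measurableI.
have dj : (A `&` [set 0]) `&` (A `\` [set 0]) = set0.
  by apply/seteqP; split=> x //= -[[_ x0] [_]].
have := pvmU HE u mI mD dj.
by rewrite setUIDK (pvmI HE)// E0 (pvm0 HE)// add0r.
Qed.

(** Substitution s = e^x. From left to right it suffices to test preimages under [ln], with the null
    point 0 removed. Conversely, a Borel set of s need not be such a preimage, so it is cut by the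
    preimages of cells of [ex z]: on a full preimage the value is known up to d, and projecting to
    the smaller set does not increase the error. *)
Lemma op_powerE z u v : op_power ip E z (u, v) <-> loc log_pvm (ex z) u v.
Proof.
have m0 : measurable [set (0 : R)] by exact: measurable_set1.
rewrite /op_power; split.
  move=> /(spectral_integralE Hip HE _ _ (cmeasurable_cpow z)) uv B c e mB fB.
  have mB' := measurable_preimage_ln mB.
  rewrite /log_pvm -!(pvm_setD0 _ mB'); apply: uv; first exact: measurableD.
  by move=> s [Bs /eqP s0]; rewrite cpow_ex// fB.
move=> uv; apply/(spectral_integralE Hip HE _ _ (cmeasurable_cpow z)).
apply: (locP HE) => B c e mB e0 fB.
apply: (local_principle Hip HE) => //; exists (4 * hnorm u ^+ 2) => d d0 d1.
have [D [q [mD tD DT Dq _]]] := cmeasurable_cells (cmeasurable_ex z) d0.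
pose D' k := @ln R @^-1` D k.
have mD' k : measurable (D' k) by exact: measurable_preimage_ln.
have tD' : trivIset setT D'.
  by move=> i j _ _ [x [Ai Aj]]; apply: tD => //; exists (ln x).
have DT' : \bigcup_k D' k = setT by rewrite -preimage_bigcup DT preimage_setT.
exists D', (fun k => 2 * hnorm (E (D' k) u)); split=> // [k|N]; last first.
  under eq_bigr do rewrite exprMn; rewrite -mulr_sumr (_ : 2 ^+ 2 = 4); last by ring.
  by rewrite ler_wpM2l//; have := pvm_bessel Hip HE u N mD' tD'; rewrite DT' (pvmT HE).
have mBD : measurable (B `&` D' k) by exact: measurableI.
have uvk := loc_on log_pvmP uv (mD k) (Dq k).
rewrite /log_pvm -/(D' k) in uvk.
have [BD0|/set0P[s [[Bs Ds] /eqP s0]]] := eqVneq ((B `&` D' k) `\` [set 0]) set0.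
  rewrite -!(pvm_setD0 _ mBD) BD0 !(pvm_set0 HE) hnorm0 mulr0 add0r.
  by rewrite !mulr_ge0 ?hnorm_ge0// ltW.
have qc : cmod (q k - c) <= d + e.
  rewrite -(subrKA (ex z (ln s))) (le_trans (cmodD _ _))// lerD//.
    by rewrite cmodC Dq.
  by rewrite -cpow_ex// fB.
have le2 : hnorm (E (B `&` D' k) u) <= hnorm (E (D' k) u).
  by apply: (pvm_le Hip HE) => // x [].
have -> : v - c *: u = (v - q k *: u) + (q k - c) *: u.
  by rewrite scalerBl addrA subrK.
rewrite (pvmD HE)// (pvmZ HE)// (le_trans (ler_hnormD _ _))// hnormZ.
have h1 : hnorm (E (B `&` D' k) (v - q k *: u)) <= d * hnorm (E (D' k) u).
  apply: le_trans uvk; rewrite -(pvmZ HE)// -(pvmB HE)//.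
  by apply: (pvm_le Hip HE) => // x [].
have h2 := ler_wpM2r (hnorm_ge0 (E (B `&` D' k) u)) qc.
have h3 := ler_wpM2l (ltW d0) le2.
by move: h1 h2 h3; lra.
Qed.

End LogMeasure.

(** * Analytic continuation of orbits of vectors *)

Section VectorEntire.
Context {R : realType} {H : completeNormedModType R[i]}.
Local Notation C := R[i].
Variable ip : {dot H for (@Num.conj R[i])}.
Hypothesis Hip : hilbert ip.
Variable Q : set R -> H -> H.
Hypothesis HQ : projection_valued_measure ip Q.

Lemma itv_measurable (a b : R) : measurable [set x : R | a <= x <= b].
Proof.
have -> : [set x : R | a <= x <= b] = `[a, b]%classic.
  by apply/seteqP; split=> x /=; rewrite in_itv.
exact: measurable_itv.
Qed.

(* If the orbit of a vector under the imaginary powers exp(it log T) extends to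
   an entire function, its values on the imaginary axis are the images of the
   vector under the real powers of T. *)
Lemma vector_entire (f : C -> H) : (forall h, cderivable (fun z => ip (f z) h)) ->
  (forall t : R, loc Q (ex ('i * t%:C)) (f 0) (f t%:C)) ->
  forall a : R, loc Q (ex a%:C) (f 0) (f ('i * (- a)%:C)).
Proof.
(* On the windows [S m] all exponentials are bounded, so every complex power T^(iz) is defined on
   vectors supported there; the statement is then recovered by closedness as m grows. *)
move=> fd ft a; pose S (m : nat) := [set x : R | - m%:R <= x <= m%:R].
have mS m : measurable (S m) by exact: itv_measurable.
have SU : \bigcup_m S m = setT.
  apply/seteqP; split=> // x _; exists (Num.bound `|x|) => //.
  by have := archi_boundP (normr_ge0 x) => /ltW; rewrite ler_norml.
have Sle : {homo S : n m / (n <= m)%N >-> n `<=` m}.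
  move=> n m nm x /= /andP[x1 x2]; have : n%:R <= m%:R :> R by rewrite ler_nat.
  by move=> nmR; apply/andP; split; lra.
have limS w : (fun m => Q (S m) w) @ \oo --> w.
  by have := pvm_nondecreasing_cvg HQ (u := w) mS Sle; rewrite SU (pvmT HQ).
suff tr m : loc Q (ex a%:C) (Q (S m) (f 0)) (Q (S m) (f ('i * (- a)%:C))).
  by apply: (loc_closed Hip HQ tr); exact: limS.
set w := Q (S m) (f 0).
have i1 : cmod ('i : C) = 1 by rewrite /cmod /= expr0n/= expr1n add0r sqrtr1.
have exb z x : S m x -> cmod (ex z x) <= expR (cmod z * m%:R).
  move=> /andP[x1 x2]; rewrite cmod_ex ler_expR.
  rewrite (le_trans (ler_norm _))// normrM ler_pM ?ler_Re_cmod// ler_norml x2 andbT//.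
have /choice[T TP] z : exists v, loc Q (ex ('i * z)) w v.
  exact: (loc_exists Hip HQ (f 0) (cmeasurable_ex _) (mS m) (exb _)).
(* The derivative of T^(iz) w is the integral of i x e^(izx). The remainder is again a spectral
   integral, of a function that is o(|k|) uniformly on the window, hence small by [loc_bound]. *)
have Td h : cderivable (fun z => ip (T z) h).
  move=> z; pose g x := ex ('i * z) x * ('i * x%:C).
  have mg : cmeasurable g.
    apply: cmeasurableM; first exact: cmeasurable_ex.
    apply: cmeasurableM; first exact: cmeasurable_cst.
    by apply: cmeasurable_real; exact: measurable_id.
  have gb x : S m x -> cmod (g x) <= expR (cmod ('i * z) * m%:R) * m%:R.
    move=> Sx; rewrite cmodM ler_pM ?cmod_ge0 ?exb//.
    by rewrite cmodM i1 mul1r cmod_real ler_norml.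
  have [D DP] := loc_exists Hip HQ (f 0) mg (mS m) gb.
  exists (ip D h) => e e0.
  set X := expR _ in gb; have X0 : 0 < X by exact: expR_gt0.
  have w0 := hnorm_ge0 w; have h0 := hnorm_ge0 h; have m0 : 0 <= m%:R :> R by [].
  pose K := X * (m%:R + 1) * (hnorm w + 1) * (hnorm h + 1).
  have K0 : 0 < K by rewrite !mulr_gt0// ltr_wpDl.
  have eK0 : 0 < e / K by rewrite divr_gt0.
  have [r r0 rP] := cexp_derive0 eK0.
  have m1 : 0 < m%:R + 1 :> R by rewrite ltr_wpDl.
  exists (r / (m%:R + 1)) => [|k]; first by rewrite divr_gt0.
  rewrite ltr_pdivlMr// => kr; have k0 := cmod_ge0 k.
  have mfg : cmeasurable (fun x => -1 * ex ('i * z) x + ex ('i * (z + k)) x).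
    apply: cmeasurableD; last exact: cmeasurable_ex.
    by apply: cmeasurableM; [exact: cmeasurable_cst|exact: cmeasurable_ex].
  have l1 := loc_symlin Hip HQ (c := -1) (cmeasurable_ex _) (cmeasurable_ex _) (TP z) (TP (z + k)).
  have l2 := loc_symlin Hip HQ (c := - k) mg mfg DP l1.
  have ml2 : cmeasurable (fun x => - k * g x + (-1 * ex ('i * z) x + ex ('i * (z + k)) x)).
    by apply: cmeasurableD => //; apply: cmeasurableM => //; exact: cmeasurable_cst.
  have bl2 x : S m x ->
      cmod (- k * g x + (-1 * ex ('i * z) x + ex ('i * (z + k)) x)) <=
      X * (e / K * (cmod k * m%:R)).
    move=> Sx; rewrite /g mulrDr exD.
    have -> : - k * (ex ('i * z) x * ('i * x%:C)) +
        (-1 * ex ('i * z) x + ex ('i * z) x * ex ('i * k) x) =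
        ex ('i * z) x * (cexp ('i * k * x%:C) - 1 - 'i * k * x%:C) by rewrite /ex; ring.
    have kx : cmod ('i * k * x%:C) <= cmod k * m%:R.
      by rewrite !cmodM i1 mul1r cmod_real ler_wpM2l// ler_norml.
    rewrite cmodM ler_pM ?cmod_ge0 ?exb// (le_trans (rP _ _))//.
      by rewrite (le_lt_trans kx)// (le_lt_trans _ kr)// ler_wpM2l// lerDl.
    by rewrite ler_wpM2l// ltW.
  have := loc_bound Hip HQ ml2 (mS m) bl2 l2.
  rewrite -/w => h1.
  have -> : ip (T (z + k)) h - ip (T z) h - ip D h * k =
      ip (- k *: D + (-1 *: T z + T (z + k))) h.
    by rewrite !(ipDl, ipNl, ipZl); ring.
  rewrite (le_trans (cauchy_schwarz Hip _ _))// (le_trans (ler_wpM2r h0 h1))//.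
  have KE : e / K * K = e by rewrite divfK// gt_eqF.
  rewrite -[in leRHS]KE.
  have -> : X * (e / K * (cmod k * m%:R)) * hnorm w * hnorm h =
    (e / K * cmod k) * (X * (m%:R * (hnorm w * hnorm h))) by ring.
  have -> : e / K * K * cmod k = (e / K * cmod k) * K by ring.
  rewrite ler_wpM2l//; first by rewrite mulr_ge0// ltW.
  rewrite /K -!mulrA ler_wpM2l ?(ltW X0)// ler_pM ?mulr_ge0// ?lerDl//.
  by rewrite ler_pM// lerDl.
(* On the real line both terms are the truncated orbit of [f 0], by uniqueness of values; hence they
   agree on the imaginary axis too, and at -ia the exponent i(-ia) is a. *)
pose psi h z := ip (f z) (Q (S m) h) - ip (T z) h.
have psid h : cderivable (psi h).
  have e : psi h = fun z => ip (f z) (Q (S m) h) + -1 * ip (T z) h.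
    by apply/funext => z; rewrite mulN1r.
  rewrite e; apply: cderivableD => //; apply: cderivableM => //; exact: cderivable_cst.
have psi0 h (t : R) : psi h t%:C = 0.
  rewrite /psi -(pvm_adj HQ)//; apply/eqP; rewrite subr_eq0; apply/eqP; congr (ip _ h).
  apply: (loc_unique Hip HQ (cmeasurable_ex _) _ (TP _)).
  exact: (loc_restrict HQ (mS m) (ft t)).
have -> : Q (S m) (f ('i * (- a)%:C)) = T ('i * (- a)%:C).
  apply: (ip_ext Hip) => h; have := entire_eq0 (psid h) (psi0 h) (- a).
  by rewrite /psi -(pvm_adj HQ)// => /eqP; rewrite subr_eq0 => /eqP.
have := TP ('i * (- a)%:C); rewrite mulrA.
have -> // : 'i * 'i * (- a)%:C = a%:C :> C.
by rewrite -expr2 sqr_i rmorphN/= mulN1r opprK.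
Qed.

End VectorEntire.

(** * The modular conjugation *)

Section Conjugation.
Context {R : realType} {H : completeNormedModType R[i]}.
Local Notation C := R[i].
Variable ip : {dot H for (@Num.conj R[i])}.
Hypothesis Hip : hilbert ip.
Variable J : H -> H.
Hypothesis Jlin : forall (c : C) u v, J (c *: u + v) = Num.conj c *: J u + J v.
Hypothesis JK : forall u, J (J u) = u.
Hypothesis Jip : forall u v, ip (J u) (J v) = ip v u.
Implicit Types (u v w : H) (z : C).

Lemma J0 : J 0 = 0.
Proof.
have := Jlin 1 0 0; rewrite scale1r addr0 rmorph1 scale1r.
by move=> /eqP; rewrite -subr_eq0 opprD addrA subrr sub0r oppr_eq0 => /eqP.
Qed.

Lemma JZ z u : J (z *: u) = conjc z *: J u.
Proof. by have := Jlin z u 0; rewrite !addr0 J0 addr0. Qed.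

Lemma JD u v : J (u + v) = J u + J v.
Proof. by have := Jlin 1 u v; rewrite rmorph1 !scale1r. Qed.

Lemma JB u v : J (u - v) = J u - J v.
Proof.
rewrite JD -scaleN1r JZ; have -> : conjc (-1) = -1 :> C by rewrite rmorphN rmorph1.
by rewrite scaleN1r.
Qed.

Lemma hnormJ u : hnorm (J u) = hnorm u.
Proof.
apply/eqP; rewrite -(eqrXn2 (_ : 0 < 2)%N) ?hnorm_ge0//.
by rewrite !(hnorm_sqr Hip) Jip.
Qed.

Lemma J_cvg (s : nat -> H) (l : H) : s @ \oo --> l -> (fun n => J (s n)) @ \oo --> J l.
Proof.
move=> /hnorm_cvgP sl; apply/hnorm_cvgP => e /sl[N NP]; exists N => n /NP.
by rewrite -JB hnormJ.
Qed.

Section Gap.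
Variable Q : set R -> H -> H.
Hypothesis HQ : projection_valued_measure ip Q.
(** J T^(1/2) J = T^(-1/2), phrased without the inverse. *)
Hypothesis QJ : forall u v, loc Q (ex (2^-1 : R)%:C) u v ->
  loc Q (ex (2^-1 : R)%:C) (J v) (J u).

Lemma measurable_ler (a : R) : measurable [set x : R | x <= a].
Proof.
have -> : [set x : R | x <= a] = `]-oo, a]%classic.
  by apply/seteqP; split=> x /=; rewrite in_itv.
exact: measurable_itv.
Qed.

Lemma loc_ex_inv z u v : loc Q (ex z) u v -> loc Q (ex (- z)) v u.
Proof.
have e x : ex (- z) x * ex z x = 1 by rewrite -exD addNr ex0.
move=> uv; apply: (loc_div Hip HQ (cmeasurable_ex z) _ uv).
- by under eq_fun do rewrite e; exact: cmeasurable_cst.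
- under eq_fun do rewrite e.
  by have := loc_id HQ (c := 1) u; rewrite scale1r.
Qed.

(* With T = exp(log T) and J T^(1/2) = T^(-1/2) J, the vectors T^(n/2) u grow
   at most like e^(n a / 2), so that J u = T^(n/2) J T^(n/2) u is small on
   {x <= b}, by the factor e^(n (a + b) / 2). *)
Lemma gap_le (a b : R) u : a + b < 0 ->
  Q [set x | x <= b] (J (Q [set x | x <= a] u)) = 0.
Proof.
move=> ab; set w := Q _ u.
have ma := measurable_ler a; have mb := measurable_ler b.
have hE (n : nat) : (n%:R / 2 : R)%:C + (2^-1 : R)%:C = (n.+1%:R / 2 : R)%:C.
  by rewrite -rmorphD/= -[n.+1]addn1 natrD mulrDl mul1r.
have bnd n x : x <= a -> cmod (ex (n%:R / 2 : R)%:C x) <= expR (n%:R / 2 * a).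
  by move=> xa; rewrite cmod_ex ler_expR ler_wpM2l// divr_ge0.
have /choice[T TP] n : exists v, loc Q (ex (n%:R / 2 : R)%:C) w v.
  exact: (loc_exists Hip HQ u (cmeasurable_ex _) ma (bnd n)).
have T0 : T 0%N = w.
  apply: (loc_unique Hip HQ (cmeasurable_ex _) (TP 0%N)).
  have -> : ex (0%:R / 2 : R)%:C = fun=> 1.
    by apply/funext => x; rewrite mul0r; exact: ex0.
  by have := loc_id HQ (c := 1) w; rewrite scale1r.
have TS n : loc Q (ex (2^-1 : R)%:C) (T n) (T n.+1).
  have e : (fun x => ex (2^-1 : R)%:C x * ex (n%:R / 2 : R)%:C x) =
      ex (n.+1%:R / 2 : R)%:C.
    by apply/funext => x; rewrite -exD addrC hE.
  apply: (loc_div Hip HQ (cmeasurable_ex _) _ (TP n)); rewrite e.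
  - exact: cmeasurable_ex.
  - exact: TP.
pose X n := hnorm (Q [set x | x <= b] (J (T n))).
have XS n : X n <= expR (b / 2) * X n.+1.
  have := QJ (TS n) (c := 0) (e := expR (b / 2)) mb.
  rewrite scale0r subr0; apply=> x xb.
  by rewrite subr0 cmod_ex ler_expR mulrC ler_pM2r// invr_gt0.
have Xn n : X 0%N <= expR (b / 2) ^+ n * X n.
  elim: n => [|n IHn]; first by rewrite expr0 mul1r.
  rewrite (le_trans IHn)// exprSr -mulrA ler_wpM2l// exprn_ge0// expR_ge0//.
have XT n : X n <= expR (n%:R / 2 * a) * hnorm w.
  rewrite (le_trans (pvm_contract Hip HQ _ mb))// hnormJ.
  exact: (loc_bound Hip HQ (cmeasurable_ex _) ma (bnd n) (TP n)).
apply: hnorm_le0; rewrite -T0 -/(X 0%N) leNgt; apply/negP => X0.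
have s0 : 0 <= expR ((a + b) / 2) by exact: expR_ge0.
have s1 : expR ((a + b) / 2) < 1.
  by rewrite -[ltRHS]expR0 ltr_expR; move: ab; lra.
have [n] := geometric_gap (hnorm w) X0 s0 s1.
rewrite expr1n mulr1 ltNge => /negP; apply.
apply: (le_trans (Xn n)).
apply: (le_trans (ler_wpM2l (exprn_ge0 n (expR_ge0 (b / 2))) (XT n))).
rewrite le_eqVlt; apply/orP; left; apply/eqP.
rewrite mulrA mulrC -!expRM_natr -expRD; congr (_ * expR _).
by field.
Qed.

End Gap.

(** The spectral measure of -log T, that is, of the logarithm of the inverse of T. *)
Definition reflect_pvm (Q : set R -> H -> H) (B : set R) := Q (-%R @^-1` B).

Section Reflect.
Variable Q : set R -> H -> H.
Hypothesis HQ : projection_valued_measure ip Q.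

Lemma measurable_preimage_opp (B : set R) : measurable B -> measurable (-%R @^-1` B).
Proof.
move=> mB; rewrite -[X in measurable X]setTI.
by apply: (@measurable_funN _ _ R setT id) => //; exact: measurable_id.
Qed.

Lemma preimage_oppK (B : set R) : -%R @^-1` (-%R @^-1` B) = B.
Proof. by apply/seteqP; split=> x /=; rewrite opprK. Qed.

Lemma reflect_pvmP : projection_valued_measure ip (reflect_pvm Q).
Proof.
case: (HQ) => h1 h2 h3 h4; split.
- by move=> A /measurable_preimage_opp; exact: h1.
- by rewrite /reflect_pvm preimage_setT.
- move=> A B /measurable_preimage_opp mA /measurable_preimage_opp mB.
  by rewrite /reflect_pvm preimage_setI h3.
- move=> A mA tA u; rewrite /reflect_pvm preimage_bigcup; apply: h4 => [n|].
    exact: measurable_preimage_opp.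
  by move=> i j _ _ [x [Ai Aj]]; apply: tA => //; exists (- x).
Qed.

Lemma loc_reflect (g : R -> C) u v :
  loc Q (fun x => g (- x)) u v <-> loc (reflect_pvm Q) g u v.
Proof.
split=> uv B c e mB gB.
  apply: uv; first exact: measurable_preimage_opp.
  by move=> x Bx; exact: gB.
have := uv (-%R @^-1` B) c e (measurable_preimage_opp mB).
by rewrite /reflect_pvm preimage_oppK; apply => x Bx; rewrite -[x]opprK; exact: gB.
Qed.

End Reflect.

Variable Q : set R -> H -> H.
Hypothesis HQ : projection_valued_measure ip Q.
Hypothesis QJ : forall u v, loc Q (ex (2^-1 : R)%:C) u v ->
  loc Q (ex (2^-1 : R)%:C) (J v) (J u).

Lemma exNx z x : ex z (- x) = ex (- z) x.
Proof. by rewrite /ex rmorphN/= mulrN mulNr. Qed.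

(** The relation between J and T^(1/2) is invariant under replacing T by its inverse, so this is
    [gap_le] for the reflected measure. *)
Lemma gap_ge (a b : R) u : 0 < a + b ->
  Q [set x | b <= x] (J (Q [set x | a <= x] u)) = 0.
Proof.
move=> ab.
have QJ' v w : loc (reflect_pvm Q) (ex (2^-1 : R)%:C) v w ->
    loc (reflect_pvm Q) (ex (2^-1 : R)%:C) (J w) (J v).
  have e : (fun x => ex (2^-1 : R)%:C (- x)) = ex (- (2^-1 : R)%:C).
    by apply/funext => x; rewrite exNx.
  move=> /(proj2 (loc_reflect Q _ _ _)); rewrite e.
  move=> /(loc_ex_inv HQ); rewrite opprK => /QJ /(loc_ex_inv HQ) h.
  by apply/(proj1 (loc_reflect Q _ _ _)); rewrite e.
have := @gap_le _ (reflect_pvmP HQ) QJ' (- a) (- b) u.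
rewrite /reflect_pvm.
have -> : -%R @^-1` [set x : R | x <= - b] = [set x | b <= x].
  by apply/seteqP; split=> x /=; rewrite lerN2.
have -> : -%R @^-1` [set x : R | x <= - a] = [set x | a <= x].
  by apply/seteqP; split=> x /=; rewrite lerN2.
by apply; move: ab; lra.
Qed.

(** The Borel sets on which J reflects [Q] form a sigma-algebra, by continuity of [Q] along
    increasing unions and of J. It contains the open rays ]-oo, t[ by the two gap lemmas, and these
    generate. *)
Lemma pvm_J (B : set R) u : measurable B -> Q B (J u) = J (Q (-%R @^-1` B) u).
Proof.
pose G : set (set R) := [set B | measurable B /\ forall u,
  Q B (J u) = J (Q (-%R @^-1` B) u)].
suff mG : measurable `<=` G by move=> /mG[_].
have Gset0 : G set0.
  split; first exact: measurable0.
  by move=> v; rewrite preimage_set0 !(pvm_set0 HQ) J0.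
have GC A : G A -> G (~` A).
  move=> [mA GA]; split; first exact: measurableC.
  move=> v; have mA' := measurable_preimage_opp mA.
  by rewrite preimage_setC !(pvmC HQ)// GA JB.
have GI A A' : G A -> G A' -> G (A `&` A').
  move=> [mA GA] [mA' GA']; split; first exact: measurableI.
  move=> v; have mB := measurable_preimage_opp mA; have mB' := measurable_preimage_opp mA'.
  by rewrite preimage_setI !(pvmI HQ)// GA' GA.
have GU A A' : G A -> G A' -> G (A `|` A').
  by move=> /GC GA /GC GA'; rewrite -[_ `|` _]setCK setCU; apply: GC; exact: GI.
have Glim (A : nat -> set R) : (forall n, G (A n)) ->
    {homo A : n m / (n <= m)%N >-> n `<=` m} -> G (\bigcup_n A n).
  move=> GA hA; have mA n : measurable (A n) by case: (GA n).
  split; first exact: bigcup_measurable.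
  move=> v; have c1 := pvm_nondecreasing_cvg HQ (u := J v) mA hA.
  have mA' n := measurable_preimage_opp (mA n).
  have hA' : {homo (fun n => -%R @^-1` A n) : n m / (n <= m)%N >-> n `<=` m}.
    by move=> n m nm x /=; exact: hA.
  have c2 := J_cvg (pvm_nondecreasing_cvg HQ (u := v) mA' hA').
  rewrite preimage_bigcup; apply: hcvg_unique c1 _.
  by rewrite (_ : (fun n => Q (A n) (J v)) = (fun n => J (Q (-%R @^-1` A n) v)))//;
    apply/funext => n; case: (GA n).
have Gray t : G [set x | x < t].
  have mlt (a : R) : measurable [set x : R | x < a].
    have -> : [set x : R | x < a] = `]-oo, a[%classic.
      by apply/seteqP; split=> x /=; rewrite in_itv.
    exact: measurable_itv.
  have mgt (a : R) : measurable [set x : R | a < x].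
    have -> : [set x : R | a < x] = `]a, +oo[%classic.
      by apply/seteqP; split=> x /=; rewrite in_itv/= andbT.
    exact: measurable_itv.
  have mge (a : R) : measurable [set x : R | a <= x].
    have -> : [set x : R | a <= x] = `[a, +oo[%classic.
      by apply/seteqP; split=> x /=; rewrite in_itv/= andbT.
    exact: measurable_itv.
  have mle := measurable_ler.
  split=> // v.
  have -> : -%R @^-1` [set x : R | x < t] = [set x | - t < x].
    by apply/seteqP; split=> x /=; rewrite ltrNl.
  pose A := [set x : R | - t < x]; rewrite -/A.
  have AC : ~` A = [set x : R | x <= - t].
    by apply/seteqP; split=> x /=; rewrite /A /= leNgt => /negP.
  have BC : ~` [set x : R | x < t] = [set x | t <= x].
    by apply/seteqP; split=> x /=; rewrite leNgt => /negP.
  have r0 n : 0 < n.+1%:R^-1 :> R by rewrite invr_gt0.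
  have rle n m : (n <= m)%N -> m.+1%:R^-1 <= n.+1%:R^-1 :> R.
    by move=> nm; rewrite lef_pV2 ?posrE// ler_nat ltnS.
  have rlt (s : R) : 0 < s -> exists n : nat, n.+1%:R^-1 < s.
    move=> s0; have [n _ /(_ n (leqnn n))] := near_infty_natSinv_lt (PosNum s0).
    by exists n.
  (* The gap lemmas need a strict inequality between the thresholds; the open ray is exhausted by
     closed ones at distance 1/(n+1). The same is done for [z2]. *)
  have z1 : Q [set x | x < t] (J (Q (~` A) v)) = 0.
    have c1 := pvm_nondecreasing_cvg HQ (D := fun n => [set x : R | x <= t - n.+1%:R^-1])
      (u := J (Q (~` A) v)).
    have e : \bigcup_n [set x : R | x <= t - n.+1%:R^-1] = [set x : R | x < t].
      apply/seteqP; split=> x /=.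
        by move=> [n _ /=]; have := r0 n; move: (n.+1%:R^-1) => r; lra.
      move=> xt; have [|n nx] := rlt (t - x); first by rewrite subr_gt0.
      by exists n => //; rewrite /= lerBrDl -lerBrDr ltW.
    rewrite e in c1; have {}c1 := c1 (fun n => mle _).
    have {}c1 := c1 (fun n m nm x (xn : x <= t - n.+1%:R^-1) =>
      le_trans xn (lerB (lexx t) (rle n m nm))).
    apply: hcvg_unique c1 _.
    rewrite (_ : (fun n => _) = cst 0); first exact: cvg_cst.
    apply/funext => n; rewrite AC (gap_le HQ QJ)//.
    by have := r0 n; move: (n.+1%:R^-1) => r; lra.
  have z2 : Q [set x | t <= x] (J (Q A v)) = 0.
    have c1 := pvm_nondecreasing_cvg HQ (D := fun n => [set x : R | - t + n.+1%:R^-1 <= x])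
      (u := v).
    have e : \bigcup_n [set x : R | - t + n.+1%:R^-1 <= x] = A.
      apply/seteqP; split=> x /=.
        by move=> [n _ /=]; have := r0 n; rewrite /A /=; move: (n.+1%:R^-1) => r; lra.
      rewrite /A /= => xt; have [|n nx] := rlt (x + t); first by rewrite -ltrBlDr sub0r.
      by exists n => //; rewrite /= addrC lerBlDr ltW.
    rewrite e in c1; have {}c1 := c1 (fun n => mge _).
    have {}c1 := c1 (fun n m nm x (xn : - t + n.+1%:R^-1 <= x) =>
      le_trans (lerD (lexx (- t)) (rle n m nm)) xn).
    have c2 := J_cvg c1.
    have c3 : (fun n => Q [set x | t <= x] (J (Q [set x | - t + n.+1%:R^-1 <= x] v)))
        @ \oo --> Q [set x | t <= x] (J (Q A v)).
      apply/hnorm_cvgP => d d0; have [N NP] := (hnorm_cvgP _ _).1 c2 _ d0.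
      exists N => n /NP; apply: le_lt_trans.
      by rewrite -(pvmB HQ)//; exact: (pvm_contract Hip HQ).
    apply: hcvg_unique c3 _.
    rewrite (_ : (fun n => _) = cst 0); first exact: cvg_cst.
    apply/funext => n; rewrite gap_ge//.
    by have := r0 n; move: (n.+1%:R^-1) => r; lra.
  have mA : measurable A by exact: mgt.
  (* Splitting [v] along [A]: by [z1] the part off [A] contributes nothing below [t], and by [z2]
     the image under J of the part in [A] lies entirely below [t]. *)
  rewrite -{1}[v](subrKC (Q A v)) -(pvmC HQ)// JD (pvmD HQ)// z1 addr0.
  move: z2; rewrite -BC (pvmC HQ)// => /eqP; rewrite subr_eq0 => /eqP <-.
  by [].
have sG : sigma_algebra setT G.
  split=> // [A|A GA].
    by rewrite setTD; exact: GC.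
  rewrite -bigcup_bigsetU_bigcup; apply: Glim.
    by move=> n; elim/big_ind: _ => // *; exact: GA.
  by move=> n m nm; exact: subset_bigsetU.
have -> : @measurable _ R = (@RGenInftyO.G R).-sigma.-measurable.
  exact: RGenInftyO.measurableE.
apply: smallest_sub => // A [x ->].
have -> : `]-oo, x[%classic = [set y : R | y < x].
  by apply/seteqP; split=> y /=; rewrite in_itv.
exact: Gray.
Qed.

(** Antilinearity of J conjugates the constant [c], and [pvm_J] replaces [B] by its reflection. *)
Lemma loc_J (g : R -> C) u v : loc Q g u v ->
  loc Q (fun x => conjc (g (- x))) (J u) (J v).
Proof.
move=> uv B c e mB gB.
have -> : J v - c *: J u = J (v - conjc c *: u) by rewrite JB JZ conjcK.
rewrite !pvm_J// !hnormJ; apply: uv; first exact: measurable_preimage_opp.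
move=> x Bx; have := gB _ Bx; rewrite opprK.
by have -> : g x - conjc c = conjc (conjc (g x) - c);
  [rewrite rmorphB/= conjcK|rewrite cmod_conjc].
Qed.

Lemma loc_ex_J (a : R) u v : loc Q (ex a%:C) u v -> loc Q (ex (- a)%:C) (J u) (J v).
Proof.
move=> /loc_J; under eq_fun do rewrite -ex_conjc exNx conjc_real.
by rewrite rmorphN.
Qed.

End Conjugation.

(** * Analytic elements *)

Section AnalyticOrbits.
Context {R : realType} {H : completeNormedModType R[i]}.
Local Notation C := R[i].
Variable ip : {dot H for (@Num.conj R[i])}.
Hypothesis Hip : hilbert ip.
Variable Q : set R -> H -> H.
Hypothesis HQ : projection_valued_measure ip Q.
Implicit Types (u v w : H) (z c : C).

Lemma cderivable_cexp c : cderivable (fun z => cexp (c * z)).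
Proof.
suff h : cderivable (@cexp R) by exact: (@cderivable_scale _ cexp c h).
move=> z; exists (cexp z) => e e0; set X := cmod (cexp z).
have X0 : 0 <= X by exact: cmod_ge0.
have X1 : 0 < X + 1 by rewrite ltr_wpDl.
have [r r0 rP] := cexp_derive0 (divr_gt0 e0 X1); exists r => // h /rP hr.
have -> : cexp (z + h) - cexp z - cexp z * h = cexp z * (cexp h - 1 - h).
  by rewrite cexpD; ring.
have h0 := cmod_ge0 h.
rewrite cmodM (le_trans (ler_wpM2l X0 hr))// mulrA ler_wpM2r// mulrCA ler_piMr ?(ltW e0)//.
by rewrite ler_pdivrMr// mul1r lerDl.
Qed.

Lemma cderivable_conjc (f : C -> C) : cderivable f ->
  cderivable (fun z => conjc (f (conjc z))).
Proof.
move=> fd z; have [d dP] := fd (conjc z); exists (conjc d) => e /dP[r r0 rP].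
exists r => // h hr; have := rP (conjc h); rewrite cmod_conjc => /(_ hr).
rewrite -[X in X <= _ -> _]cmod_conjc !rmorphB rmorphM/= conjcK.
by rewrite rmorphD.
Qed.

Lemma entire_cderivable (F : C -> H -> H) u h : entire F ->
  cderivable (fun z => ip (F z u) h).
Proof.
move=> Fe z; have [D _ DP] := Fe z; exists (ip (D u) h) => e e0.
have u0 := hnorm_ge0 u; have h0 := hnorm_ge0 h.
have K0 : 0 < hnorm u * hnorm h + 1 by rewrite ltr_wpDl// mulr_ge0.
have eK0 : 0 < e / (hnorm u * hnorm h + 1) by rewrite divr_gt0.
have eK0c : (0 : C) < (e / (hnorm u * hnorm h + 1))%:C by rewrite ltcR.
have [d d0 dP] := DP _ eK0c.
have d0' : 0 < complex.Re d by move: d0; rewrite ltcE => /andP[].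
have dE : d = (complex.Re d)%:C.
  by move: d0; rewrite ltcE => /andP[/eqP]; case: (d) => a b /= -> _.
exists (complex.Re d) => // k kd; have k0 := cmod_ge0 k.
have [->|kn0] := eqVneq k 0.
  by rewrite addr0 subrr sub0r mulr0 oppr0 cmod0 mulr0.
have := dP k u kn0; rewrite dE cmodE ltcR => /(_ kd).
rewrite !hnormE -rmorphM/= lecR => le.
have -> : ip (F (z + k) u) h - ip (F z u) h - ip (D u) h * k =
    k * ip (k^-1 *: (F (z + k) u - F z u) - D u) h.
  by rewrite !(ipDl, ipNl, ipZl); field.
rewrite cmodM mulrC ler_wpM2r//.
rewrite (le_trans (cauchy_schwarz Hip _ _))// (le_trans (ler_wpM2r h0 le))//.
rewrite -mulrA mulrAC ler_pdivrMr// ler_wpM2l ?(ltW e0)// lerDl.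
by [].
Qed.

(** An eigenvector of log T for [theta], expressed through all complex powers of T, imaginary ones
    included, since these are what gets applied to it. *)
Definition log_eigenvector (theta : R) v :=
  forall z, loc Q (ex z) v (cexp (z * theta%:C) *: v).

Lemma pvm_limit0 (D : nat -> set R) v : (forall n, measurable (D n)) ->
  {homo D : n m / (n <= m)%N >-> n `<=` m} -> (forall n, Q (D n) v = 0) ->
  Q (\bigcup_n D n) v = 0.
Proof.
move=> mD hD D0; have c1 := pvm_nondecreasing_cvg HQ (u := v) mD hD.
apply: hcvg_unique c1 _; rewrite (_ : (fun n => _) = cst 0); first exact: cvg_cst.
exact/funext.
Qed.

(** The vector is carried by the single point theta. On {x <= b} with b < theta, T^(1/2) has norm at
    most e^(b/2) but multiplies [v] by the larger e^(theta/2), so the piece of [v] is zero; above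
    theta the same argument applies to T^(-1/2). *)
Lemma half_eigenvector (theta : R) v :
  loc Q (ex (2^-1 : R)%:C) v ((expR (theta / 2))%:C *: v) ->
  log_eigenvector theta v.
Proof.
move=> hv; have hv' := loc_ex_inv Hip HQ hv.
have r0 n : 0 < n.+1%:R^-1 :> R by rewrite invr_gt0.
have rle n m : (n <= m)%N -> m.+1%:R^-1 <= n.+1%:R^-1 :> R.
  by move=> nm; rewrite lef_pV2 ?posrE// ler_nat ltnS.
have rlt (s : R) : 0 < s -> exists n : nat, n.+1%:R^-1 < s.
  move=> s0; have [n _ /(_ n (leqnn n))] := near_infty_natSinv_lt (PosNum s0).
  by exists n.
have mge (a : R) : measurable [set x : R | a <= x].
  have -> : [set x : R | a <= x] = `[a, +oo[%classic.
    by apply/seteqP; split=> x /=; rewrite in_itv/= andbT.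
  exact: measurable_itv.
have zero (X Y Z : R) : 0 <= X -> Y < Z -> Z * X <= Y * X -> X <= 0.
  by move=> X0 YZ ZY; rewrite leNgt; apply/negP => X1; move: ZY; rewrite ler_pM2r// leNgt YZ.
have e0 t : 0 <= expR t :> R by exact: expR_ge0.
have low (b : R) : b < theta -> Q [set x | x <= b] v = 0.
  move=> bt; have mb := measurable_ler b; apply: hnorm_le0.
  have := hv _ 0 (expR (b / 2)) mb; rewrite scale0r subr0 (pvmZ HQ)// hnormZ.
  rewrite cmod_real ger0_norm// => h; apply: (zero _ _ _ (hnorm_ge0 _) _ (h _)).
    by rewrite ltr_expR ltr_pM2r ?invr_gt0.
  by move=> x xb; rewrite subr0 cmod_ex ler_expR mulrC ler_pM2r ?invr_gt0.
have high (b : R) : theta < b -> Q [set x | b <= x] v = 0.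
  move=> bt; have mb := mge b; apply: hnorm_le0.
  have := hv' _ 0 (expR (- (b / 2))) mb; rewrite scale0r subr0 (pvmZ HQ)// hnormZ.
  rewrite cmod_real ger0_norm// mulrA -expRD => h.
  have h1 : 1 * hnorm (Q [set x | b <= x] v) <=
      expR (- (b / 2) + theta / 2) * hnorm (Q [set x | b <= x] v).
    rewrite mul1r; apply: h => x xb; rewrite subr0 cmod_ex/= ler_expR.
    by rewrite mulNr lerN2 mulrC ler_pM2l ?invr_gt0.
  apply: (zero _ _ _ (hnorm_ge0 _) _ h1).
  by rewrite -[ltRHS]expR0 ltr_expR; move: bt; lra.
pose A : set R := [set theta].
have mA : measurable A by exact: measurable_set1.
pose D n := [set x : R | x <= theta - n.+1%:R^-1] `|` [set x : R | theta + n.+1%:R^-1 <= x].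
have mD n : measurable (D n) by apply: measurableU; [exact: measurable_ler|exact: mge].
have DA : \bigcup_n D n = ~` A.
  apply/seteqP; split=> x.
    move=> [n _ Dx] /= e; move: Dx; rewrite e /D /=; have := r0 n.
    by move: (n.+1%:R^-1) => r r1 []; lra.
  move=> /= /eqP; rewrite neq_lt => /orP[] xt.
    have [|n nx] := rlt (theta - x); first by rewrite subr_gt0.
    by exists n => //; left; rewrite /= lerBrDl -lerBrDr ltW.
  have [|n nx] := rlt (x - theta); first by rewrite subr_gt0.
  by exists n => //; right; rewrite /= -lerBrDl ltW.
have A0 : Q (~` A) v = 0.
  rewrite -DA; apply: pvm_limit0 => // [n m nm x|n].
    have := rle n m nm; rewrite /D /=; move: (m.+1%:R^-1) (n.+1%:R^-1) => r s rs.
    by move=> [] h; [left|right]; lra.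
  rewrite (pvmU HQ); [|exact: measurable_ler|exact: mge|].
    rewrite low ?high ?addr0//; have := r0 n; move: (n.+1%:R^-1) => r; lra.
  apply/seteqP; split=> x //= -[]; have := r0 n; move: (n.+1%:R^-1) => r; lra.
have Av : Q A v = v by move: A0; rewrite (pvmC HQ)// => /eqP; rewrite subr_eq0 => /eqP.
move=> z B c e mB zB; have [Bt|Bt] := pselect (B theta).
  rewrite -scalerBl (pvmZ HQ)// hnormZ ler_wpM2r ?hnorm_ge0//.
  exact: zB.
have B0 : Q B v = 0.
  by rewrite -Av (pvm_disj HQ)//; apply/seteqP; split=> x //= -[Bx xt]; apply: Bt; rewrite -xt.
by rewrite (pvmB HQ)// !(pvmZ HQ)// B0 !scaler0 subrr hnorm0 mulr0.
Qed.

Variables (y : H -> H) (F : C -> H -> H).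
Hypothesis ylin : linear y.
Hypothesis Fentire : entire F.
(** F(t) u = T^(it) y T^(-it) u, with [a] the intermediate vector T^(-it) u. *)
Hypothesis FP : forall (t : R) u, exists2 a,
  loc Q (ex (- ('i * t%:C))) u a & loc Q (ex ('i * t%:C)) (y a) (F t%:C u).

Lemma flow0 u : F 0 u = y u.
Proof.
have [a ua ya] := FP 0 u.
have ex1 (z : C) : z = 0 -> ex z = fun=> 1 :> C.
  by move=> ->; apply/funext => x; exact: ex0.
have z1 : - ('i * (0 : R)%:C) = 0 :> C by rewrite mulr0 oppr0.
have z2 : 'i * (0 : R)%:C = 0 :> C by rewrite mulr0.
rewrite (ex1 _ z1) in ua; rewrite (ex1 _ z2) in ya.
have l1 w : loc Q (fun=> 1) w w by have := loc_id HQ (c := 1) w; rewrite scale1r.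
have au : a = u by exact: (loc_unique Hip HQ (cmeasurable_cst _) ua (l1 _)).
have := loc_unique Hip HQ (cmeasurable_cst _) ya (l1 _).
by rewrite au.
Qed.

Lemma cexp_ii (theta a : R) : cexp ('i * theta%:C * ('i * (- a)%:C)) = (expR (a * theta))%:C.
Proof.
rewrite -cexp_real; congr cexp.
by apply/eqP; rewrite eq_complex/=; apply/andP; split; apply/eqP; ring.
Qed.

(** On an eigenvector the inner factor T^(-it) is a scalar, so T^(it) y v = e^(i t theta) F(t) v.
    The right-hand side extends to an entire function, evaluated at -ia. *)
Lemma orbit_power (theta : R) v : log_eigenvector theta v ->
  forall a : R, loc Q (ex a%:C) (y v) ((expR (a * theta))%:C *: F ('i * (- a)%:C) v).
Proof.
move=> hv a; pose f z := cexp ('i * theta%:C * z) *: F z v.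
have fd h : cderivable (fun z => ip (f z) h).
  have -> : (fun z => ip (f z) h) = fun z => cexp ('i * theta%:C * z) * ip (F z v) h.
    by apply/funext => z; rewrite ipZl.
  by apply: cderivableM; [exact: cderivable_cexp|exact: entire_cderivable].
have f0 : f 0 = y v by rewrite /f mulr0 cexp0 scale1r flow0.
have ft (t : R) : loc Q (ex ('i * t%:C)) (f 0) (f t%:C).
  have [b vb yb] := FP t v.
  have be := loc_unique Hip HQ (cmeasurable_ex _) vb (hv _).
  have yZ c u : y (c *: u) = c *: y u.
    have y0 : y 0 = 0.
      by have := ylin (-1) 0 0; rewrite scaler0 addr0 scaleN1r addNr.
    by have := ylin c u 0; rewrite !addr0 y0 addr0.
  have := loc_scale HQ (cexp ('i * theta%:C * t%:C)) yb.
  rewrite be yZ scalerA -cexpD f0.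
  have -> : 'i * theta%:C * t%:C + - ('i * t%:C) * theta%:C = 0 :> C by ring.
  by rewrite cexp0 scale1r.
by have := vector_entire Hip HQ fd ft (a := a); rewrite f0 /f cexp_ii.
Qed.

Variable G : C -> H -> H.
Hypothesis FG : forall z, adjoint_of ip (F z) (G z).

(** The adjoint [G z] depends antiholomorphically on z, so the entire continuation is z |-> G(conj
    z); the value at -ia is therefore G(ia), with the sign opposite to that in [orbit_power]. *)
Lemma adjoint_orbit_power (theta : R) v : log_eigenvector theta v ->
  forall a : R, loc Q (ex a%:C) (G 0 v) ((expR (a * theta))%:C *: G ('i * a%:C) v).
Proof.
move=> hv a; pose f z := cexp ('i * theta%:C * z) *: G (conjc z) v.
have fd h : cderivable (fun z => ip (f z) h).
  have -> : (fun z => ip (f z) h) = fun z => cexp ('i * theta%:C * z) *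
      conjc (ip (F (conjc z) h) v).
    by apply/funext => z; rewrite ipZl (ipC _ (G _ v)) -FG.
  apply: cderivableM; first exact: cderivable_cexp.
  by apply: cderivable_conjc (fun z => ip (F z h) v) _; exact: entire_cderivable.
have f0 : f 0 = G 0 v by rewrite /f mulr0 cexp0 scale1r conjc0.
have conj_it (t : R) : conjc ('i * t%:C) = - ('i * t%:C) :> C.
  by apply/eqP; rewrite eq_complex/=; apply/andP; split; apply/eqP; ring.
have conj_nit (t : R) : conjc (- ('i * t%:C)) = 'i * t%:C :> C.
  by rewrite -conj_it conjcK.
have exc z : (fun x => conjc (ex z x)) = ex (conjc z).
  by apply/funext => x; rewrite ex_conjc.
have ft (t : R) : loc Q (ex ('i * t%:C)) (f 0) (f t%:C).
  (* Taken at -t, the relation provides w = T^(it) G(0) v. That w equals e^(i t theta) G(t) v is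
     checked weakly, by moving the imaginary powers across the inner product. *)
  have [w vw _] := FP (- t) (G 0 v).
  have tt : - ('i * (- t)%:C) = 'i * t%:C :> C by rewrite rmorphN mulrN opprK.
  rewrite tt in vw; rewrite f0.
  suff -> : f t%:C = w by [].
  rewrite /f conjc_real; apply: (ip_ext Hip) => u.
  have [b ub yb] := FP t u.
  have e1 : ip b (G 0 v) = ip u w.
    apply: (loc_adj Hip HQ (cmeasurable_ex _) ub).
    by rewrite exc conj_nit.
  have e2 : ip (F t%:C u) v = ip (y b) (cexp (- ('i * t%:C) * theta%:C) *: v).
    apply: (loc_adj Hip HQ (cmeasurable_ex _) yb).
    by rewrite exc conj_it; exact: hv.
  rewrite ipZl (ipC _ (G _ v)) -FG e2 -flow0 ipZr FG e1.
  have cc (z1 z2 : C) : conjc (conjc z1 * z2) = z1 * conjc z2 by rewrite rmorphM/= conjcK.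
  rewrite cc mulrA -cexpD -(ipC ip w).
  have -> : 'i * theta%:C * t%:C + - ('i * t%:C) * theta%:C = 0 :> C by ring.
  by rewrite cexp0 mul1r.
have := vector_entire Hip HQ fd ft (a := a); rewrite f0 /f cexp_ii.
have -> // : conjc ('i * (- a)%:C) = 'i * a%:C :> C.
by apply/eqP; rewrite eq_complex/=; apply/andP; split; apply/eqP; ring.
Qed.

End AnalyticOrbits.

(** * Derivations *)

Section ModularOperator.
Context {R : realType} {H : completeNormedModType R[i]}.
Local Notation C := R[i].
Variable ip : {dot H for (@Num.conj R[i])}.
Hypothesis Hip : hilbert ip.
Variable M : set (H -> H).
Implicit Types (u v w : H) (z c : C) (a b x : H -> H).

Lemma adjoint_of_sym a b : adjoint_of ip a b -> adjoint_of ip b a.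
Proof. by move=> ab u v; rewrite (ipC _ (b u)) -ab -(ipC ip). Qed.

Lemma adjoint_of_unique a b b' : adjoint_of ip a b -> adjoint_of ip a b' ->
  forall u, b u = b' u.
Proof.
move=> ab ab' u; apply: (ip_ext Hip) => w.
by rewrite (ipC _ (b u)) (ipC _ (b' u)) -ab -ab'.
Qed.

Lemma closure_swap (A : set (H * H)) u v :
  (forall p, A p -> A (p.2, p.1)) -> closure A (u, v) -> closure A (v, u).
Proof.
move=> Asym Auv B Bvu.
have cs : {for (u, v), continuous (fun p : H * H => (p.2, p.1))}.
  by apply: cvg_pair; [exact: cvg_snd|exact: cvg_fst].
have /Auv[p [Ap Bp]] := cs B Bvu.
by exists (p.2, p.1); split => //; exact: Asym.
Qed.

Lemma app_eq (T : set (H * H)) u v :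
  (forall v', T (u, v') -> v' = v) -> T (u, v) -> app T u = v.
Proof. by move=> Tu Tv; apply: xget_subset1 => // v' v'' /Tu -> /Tu ->. Qed.

Hypothesis Mvn : von_neumann_algebra ip M.

Lemma vna_bounded a : M a -> bounded_op a.
Proof. by case: Mvn => _ <- []. Qed.

Lemma vna_id : M id.
Proof.
case: Mvn => _ <-; split=> [|b _]; last by apply/funext.
by split=> [c u v //|u]; exact: cvg_id.
Qed.

Lemma vna_adjoint a : M a -> exists2 b, M b & adjoint_of ip a b.
Proof. by case: Mvn => + _; apply. Qed.

Variable xi0 : H.

Lemma modular_S_graph x y : M x -> adjoint_of ip x y ->
  modular_S ip M xi0 (x xi0, y xi0).
Proof. by move=> Mx xy; apply: subset_closure; exists x, y. Qed.

(** The adjoint is an involution on M, so exchanging coordinates preserves the graph of x xi0 |->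
    x^* xi0, and with it the closure. *)
Lemma modular_S_sym u v : modular_S ip M xi0 (u, v) -> modular_S ip M xi0 (v, u).
Proof.
apply: closure_swap => -[_ _] /= [x [y [Mx xy /= -> ->]]].
exists y, x; split=> //; last exact: adjoint_of_sym.
have [b Mb xb] := vna_adjoint Mx.
by have -> : y = b by apply/funext; exact: (adjoint_of_unique xy xb).
Qed.

Variable J : H -> H.
Hypothesis Jlin : forall (c : C) u v, J (c *: u + v) = Num.conj c *: J u + J v.
Hypothesis JK : forall u, J (J u) = u.
Hypothesis Jip : forall u v, ip (J u) (J v) = ip v u.
Hypothesis JM : [set J \o a \o J | a in M] = commutant M.
Hypothesis Jxi0 : J xi0 = xi0.
Variable E : set R -> H -> H.
Variable Q : set R -> H -> H.
Hypothesis HQ : projection_valued_measure ip Q.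
Hypothesis opQ : forall z u v, op_power ip E z (u, v) <-> loc Q (ex z) u v.
(** S = J T^(1/2), with J moved to the side of the value. *)
Hypothesis SQ : forall u v,
  modular_S ip M xi0 (u, v) <-> loc Q (ex (2^-1 : R)%:C) u (J v).

Lemma modular_S_unique u v v' : modular_S ip M xi0 (u, v) ->
  modular_S ip M xi0 (u, v') -> v = v'.
Proof.
move=> /SQ uv /SQ uv'; rewrite -(JK v) -(JK v').
by congr J; exact: (loc_unique Hip HQ (cmeasurable_ex _) uv uv').
Qed.

Lemma half_power_J u v : loc Q (ex (2^-1 : R)%:C) u v ->
  loc Q (ex (2^-1 : R)%:C) (J v) (J u).
Proof.
move=> uv; apply/SQ; apply: modular_S_sym; apply/SQ.
by rewrite JK.
Qed.

Lemma J_commutant a : M a -> commutant M (fun u => J (a (J u))).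
Proof. by move=> Ma; rewrite -JM; exists a. Qed.

Lemma op_power_app z u v : loc Q (ex z) u v -> app (op_power ip E z) u = v.
Proof.
move=> uv; apply: app_eq; last exact/opQ.
by move=> v' /opQ uv'; exact: (loc_unique Hip HQ (cmeasurable_ex _) uv' uv).
Qed.

(** Both S and J fix [xi0], hence so does T^(1/2). *)
Lemma log_eigenvector_xi0 : log_eigenvector Q 0 xi0.
Proof.
apply: (half_eigenvector Hip HQ); rewrite mul0r expR0 scale1r -[X in loc _ _ _ X]Jxi0.
by apply/SQ; apply: (modular_S_graph vna_id).
Qed.

Variables (y : H -> H) (F : C -> H -> H).
Hypothesis My : M y.
Hypothesis MF : forall z, M (F z).
Hypothesis Fentire : entire F.
Hypothesis FP : forall (t : R) u, exists2 a,
  loc Q (ex (- ('i * t%:C))) u a & loc Q (ex ('i * t%:C)) (y a) (F t%:C u).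

Lemma loc_ex_div (s t : R) u v w : loc Q (ex s%:C) u v ->
  loc Q (ex t%:C) u w -> loc Q (ex (t - s)%:C) v w.
Proof.
move=> uv uw; have e : (fun r => ex (t - s)%:C r * ex s%:C r) = ex t%:C.
  by apply/funext => r; rewrite -exD -rmorphD/= subrK.
apply: (loc_div Hip HQ (cmeasurable_ex _) _ uv); rewrite e //.
exact: cmeasurable_ex.
Qed.

Lemma linearZ_fun a c u : M a -> a (c *: u) = c *: a u.
Proof.
move=> /vna_bounded[alin _].
have a0 : a 0 = 0 by have := alin (-1) 0 0; rewrite scaler0 addr0 scaleN1r addNr.
by have := alin c u 0; rewrite !addr0 a0 addr0.
Qed.

(** [X] and [X'] are linked only by xi' = lam^2 J xi, so that exchanging them and inverting [lam]
    gives the second identity. Both sides turn out to be i times lam J F(i/4)^* J xi - lam F(-i/4)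
    xi. *)
Lemma derivation_intertwines (X X' : set (H * H)) (lam : R) (xi xi' : H) :
  (forall u v v', X (u, v) -> X (u, v') -> v = v') ->
  (forall u v v', X' (u, v) -> X' (u, v') -> v = v') ->
  affiliated M X -> affiliated M X' ->
  X (xi0, xi) -> X' (xi0, xi') -> 0 < lam ->
  loc Q (ex (2^-1 : R)%:C) xi ((lam ^+ 2)%:C *: xi) ->
  xi' = (lam ^+ 2)%:C *: J xi ->
  let i0 := symmetric_embedding ip E xi0 in
  let dX := dop J lam X X' in
  [/\ embeddable ip E xi0 (graph y),
      embeddable ip E xi0 (commutator X y),
      dom dX (i0 (graph y))
    & app dX (i0 (graph y)) = 'i *: i0 (commutator X y)].
Proof.
move=> X1 X1' XM XM' Xxi Xxi' lam0 xiE xi'E i0 dX.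
have ylin : linear y by have [] := vna_bounded My.
(* The eigenvalue lam^2 of Delta^(1/2) is e^(th/2), and that of Delta^(1/4) is e^(th/4) = lam. *)
pose th := 4 * ln lam.
have e2 : expR (th / 2) = lam ^+ 2.
  by rewrite (_ : th / 2 = 2%:R * ln lam) ?expRM_natl ?lnK// /th; field.
have e4 : expR (th / 4) = lam.
  by rewrite (_ : th / 4 = ln lam) ?lnK// /th; field.
have xiL : log_eigenvector Q th xi by apply: (half_eigenvector Hip HQ); rewrite e2.
pose eta := J xi.
have etaL : log_eigenvector Q (- th) eta.
  apply: (half_eigenvector Hip HQ).
  have := half_power_J xiE; rewrite (JZ Jlin) conjc_real -/eta => h.
  have := loc_scale HQ ((expR (- th / 2))%:C) h.
  by rewrite scalerA -rmorphM/= -e2 -expRD mulNr addNr expR0 scale1r.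
have /choice[G GP] z : exists b, M b /\ adjoint_of ip (F z) b.
  by have [b Mb Fb] := vna_adjoint (MF z); exists b.
have FG z : adjoint_of ip (F z) (G z) by case: (GP z).
have MG z : M (G z) by case: (GP z).
(* On eigenvectors F(-ia) acts as Delta^a y Delta^(-a): [y1], [y2], [y3] stand for a = 1/4, -1/4,
   -1/2, while [b2] and [b3] are the adjoints of [y2] and [y3]. *)
pose y1 := F ('i * (- 4^-1 : R)%:C).
pose y2 := F ('i * (4^-1 : R)%:C); pose b2 := G ('i * (4^-1 : R)%:C).
pose y3 := F ('i * (2^-1 : R)%:C); pose b3 := G ('i * (2^-1 : R)%:C).
have orb := orbit_power Hip HQ ylin Fentire FP.
have aorb := adjoint_orbit_power Hip HQ Fentire FP FG.
have xi0q : loc Q (ex (4^-1 : R)%:C) (y xi0) (y1 xi0).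
  by have := orb _ _ log_eigenvector_xi0 4^-1; rewrite mulr0 expR0 scale1r.
have xi0mq : loc Q (ex (- 4^-1 : R)%:C) (y xi0) (y2 xi0).
  by have := orb _ _ log_eigenvector_xi0 (- 4^-1); rewrite mulr0 expR0 scale1r opprK.
have xi0mh : loc Q (ex (- 2^-1 : R)%:C) (y xi0) (y3 xi0).
  by have := orb _ _ log_eigenvector_xi0 (- 2^-1); rewrite mulr0 expR0 scale1r opprK.
(* S(y2 xi0) is computed twice: as J Delta^(1/2) y2 xi0 = J y1 xi0, and as b2 xi0. Hence y1 xi0 = J
   b2 J xi0 with J b2 J in the commutant, where affiliation applies. *)
have Jy1 : J (y1 xi0) = b2 xi0.
  apply: modular_S_unique (_ : modular_S ip M xi0 (y2 xi0, _)) _.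
    apply/SQ; rewrite JK; have := loc_ex_div xi0mq xi0q.
    by rewrite (_ : 4^-1 - - 4^-1 = 2^-1)//; field.
  exact: modular_S_graph (MF _) (FG _).
have Jy : J (y xi0) = b3 xi0.
  apply: modular_S_unique (_ : modular_S ip M xi0 (y3 xi0, _)) _.
    apply/SQ; rewrite JK; have := loc_ex_inv Hip HQ xi0mh.
    by rewrite rmorphN opprK.
  exact: modular_S_graph (MF _) (FG _).
have appy : app (graph y) xi0 = y xi0 by apply: app_eq.
have i0y : i0 (graph y) = y1 xi0.
  by rewrite /i0 /symmetric_embedding appy; exact: op_power_app.
have Xu : X (y1 xi0, J (b2 eta)).
  have := XM _ _ (J_commutant (MG ('i * (4^-1 : R)%:C))) Xxi; rewrite /= Jxi0 -/b2.
  by rewrite -Jy1 JK.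
have X'u : X' (J (y1 xi0), J (y1 ((lam ^+ 2)%:C *: xi))).
  have := XM' _ _ (J_commutant (MF ('i * (- 4^-1 : R)%:C))) Xxi'; rewrite /= Jxi0.
  by rewrite xi'E (JZ Jlin) conjc_real JK.
have Xy : X (y xi0, J (b3 eta)).
  have := XM _ _ (J_commutant (MG ('i * (2^-1 : R)%:C))) Xxi; rewrite /= Jxi0 -/b3.
  by rewrite -Jy JK.
pose q := lam%:C *: J (b2 eta) - lam%:C *: y1 xi.
have dXu : dX (y1 xi0, 'i *: q).
  exists (J (b2 eta)), (y1 ((lam ^+ 2)%:C *: xi)); split=> //=.
  rewrite (linearZ_fun (a := y1) _ _ (MF _)).
  (* The weight 1/lam meets the factor lam^2 of [xi'], so both terms of the derivation carry the
     same factor [lam]. *)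
  rewrite scalerA -rmorphM/= (_ : lam^-1 * lam ^+ 2 = lam)//.
  by rewrite expr2 mulKf// gt_eqF.
have dX1 v : dX (y1 xi0, v) -> v = 'i *: q.
  move=> [v1 [w1 [/= Xv1 Xw1 ->]]]; case: dXu => v2 [w2 [/= Xv2 Xw2 ->]].
  rewrite (X1 _ _ _ Xv1 Xv2) -(JK w1) -(JK w2).
  by rewrite (X1' _ _ _ Xw1 Xw2).
have Cy : commutator X y (xi0, J (b3 eta) - y xi).
  by exists (J (b3 eta)), xi.
have Cy1 : app (commutator X y) xi0 = J (b3 eta) - y xi.
  apply: app_eq Cy => v [v1 [w1 [/= Xv1 Xw1 ->]]].
  by rewrite (X1 _ _ _ Xv1 Xy) (X1 _ _ _ Xw1 Xxi).
(* [b3 eta] and [b2 eta] are, up to scalars, the images of [G 0 eta] under Delta^(1/2) and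
   Delta^(1/4). Dividing gives Delta^(-1/4) b3 eta = lam b2 eta, and J turns Delta^(-1/4) into
   Delta^(1/4). *)
have q1 : loc Q (ex (4^-1 : R)%:C) (J (b3 eta)) (lam%:C *: J (b2 eta)).
  have h3 := aorb _ _ etaL 2^-1; have h2 := aorb _ _ etaL 4^-1.
  have := loc_scale HQ ((expR (th / 2))%:C) (loc_ex_div h3 h2).
  rewrite !scalerA -!rmorphM/= -!expRD.
  rewrite (_ : th / 2 + 2^-1 * - th = 0); last by field.
  rewrite (_ : th / 2 + 4^-1 * - th = th / 4); last by field.
  rewrite e4 expR0 scale1r => h.
  have := loc_ex_J Hip Jlin Jip HQ half_power_J h.
  by rewrite (JZ Jlin) conjc_real (_ : - (4^-1 - 2^-1) = 4^-1)//; field.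
have q2 : loc Q (ex (4^-1 : R)%:C) (y xi) (lam%:C *: y1 xi).
  by have := orb _ _ xiL 4^-1; rewrite mulrC e4.
have qq : loc Q (ex (4^-1 : R)%:C) (J (b3 eta) - y xi) q.
  have -> : J (b3 eta) - y xi = -1 *: y xi + J (b3 eta) by rewrite scaleN1r addrC.
  have -> : q = -1 *: (lam%:C *: y1 xi) + lam%:C *: J (b2 eta) by rewrite scaleN1r addrC.
  exact: (@loc_lin _ _ _ Hip _ HQ (ex (4^-1 : R)%:C) (-1) _ _ _ _ (cmeasurable_ex _) q2 q1).
split.
- by split; [exists (y xi0)|rewrite appy; exists (y1 xi0); apply/opQ].
- by split; [exists (J (b3 eta) - y xi)|rewrite Cy1; exists q; apply/opQ].
- by rewrite i0y; exists ('i *: q).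
rewrite i0y (app_eq dX1 dXu); congr (_ *: _).
by rewrite /i0 /symmetric_embedding Cy1; apply/esym/op_power_app.
Qed.

End ModularOperator.

(** * Adjoints of densely defined operators *)

Section DenselyDefined.
Context {R : realType} {H : completeNormedModType R[i]}.
Local Notation C := R[i].
Variable ip : {dot H for (@Num.conj R[i])}.
Hypothesis Hip : hilbert ip.
Implicit Types (u v w : H) (M : set (H -> H)) (X : set (H * H)).

Lemma dense_orthogonal (D : set H) w :
  dense D -> (forall u, D u -> ip u w = 0) -> w = 0.
Proof.
move=> Dd Dw; apply: (hnorm_eq0 (u := w)); apply/eqP/negPn/negP => w0.
have wp : 0 < hnorm w by rewrite lt_neqAle eq_sym w0 hnorm_ge0.
have e0 : 0 < (hnorm w)%:C :> C by rewrite ltcR.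
have [u [wu Du]] : ball w (hnorm w)%:C `&` D !=set0.
  by apply: Dd; [exists w; exact: ballxx|exact: ball_open].
move: wu; rewrite -ball_normE /= hnormE ltcR => wu.
have : hnorm (u - w) ^+ 2 = hnorm u ^+ 2 + hnorm (- w) ^+ 2.
  by apply: (pythagoras Hip); rewrite ipNr Dw// oppr0.
rewrite hnormN hnormB => h.
have : hnorm w ^+ 2 <= hnorm (w - u) ^+ 2 by rewrite h lerDr sqr_ge0.
by rewrite ler_pXn2r ?nnegrE ?hnorm_ge0// leNgt wu.
Qed.

Lemma adj_unique X u v v' : dense (dom X) -> adj ip X (u, v) -> adj ip X (u, v') -> v = v'.
Proof.
move=> dX uv uv'; apply/eqP; rewrite -subr_eq0; apply/eqP.
apply: (dense_orthogonal dX) => a [b ab].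
by rewrite ipBr -(uv _ ab) -(uv' _ ab) subrr.
Qed.

Lemma app_mem X u : dom X u -> X (u, app X u).
Proof. by move=> [v Xv]; exact: (@xgetPex _ 0 [set v | X (u, v)] (ex_intro _ v Xv)). Qed.

End DenselyDefined.

Theorem proposition2p11
  (R : realType) (H : completeNormedModType R[i])
  (ip : {dot H for (@Num.conj R[i])}) (Hip : hilbert ip)
  (M : set (H -> H)) (P : set H) (J : H -> H)
  (HM : standard_form ip M P J) (Hsf : sigma_finite_algebra ip M)
  (w0 : (H -> H) -> R[i])
  (Hw0 : [/\ state ip M w0, faithful ip M w0 & normal ip M w0])
  (xi0 : H) (Hxi0 : P xi0) (Hcyc : cyclic M xi0)
  (Hrep : forall x, M x -> w0 x = ip (x xi0) xi0)
  (Delta : set (H * H)) (HDelta : positive_selfadjoint ip Delta)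
  (E : set R -> H -> H) (HE : spectral_measure ip E Delta)
  (Hpolar : modular_S ip M xi0 = comp_op (graph J) (op_power ip E (2^-1)%:C))
  (lambda : R) (Hlambda : 0 < lambda)
  (xi : H) (Hxi : dom (modular_S ip M xi0) xi)
  (Heig : eigenvector (op_power ip E (2^-1)%:C) (lambda ^+ 2)%:C xi)
  (X : set (H * H)) (HX : densely_defined X) (HXc : closed X)
  (HXM : affiliated M X)
  (HD : dom X xi0 /\ dom (adj ip X) xi0)
  (HXxi : xi = app X xi0)
  (HS : app (modular_S ip M xi0) (app X xi0) = app (adj ip X) xi0)
  (y : H -> H) (Hy : analytic_elements ip M E y) :
  let i0 := symmetric_embedding ip E xi0 in
  let X' := adj ip X in
  let dX := dop J lambda X X' in
  let dX' := dop J lambda^-1 X' X in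
  [/\ embeddable ip E xi0 (graph y),
      [/\ embeddable ip E xi0 (commutator X y),
          dom dX (i0 (graph y))
        & app dX (i0 (graph y)) = 'i *: i0 (commutator X y)]
    & [/\ embeddable ip E xi0 (commutator X' y),
          dom dX' (i0 (graph y))
        & app dX' (i0 (graph y)) = 'i *: i0 (commutator X' y)]].
Proof.
move=> i0 X' dX dX'.
have [Mvn _ [Jlin JK Jip] JM [_ JP _]] := HM.
have [HPVM _] := HE.
have SE u v : modular_S ip M xi0 (u, v) <-> op_power ip E (2^-1)%:C (u, J v).
  rewrite Hpolar; split=> [[a [ua]]|ua]; first by rewrite /graph/= => ->; rewrite JK.
  by exists (J v); split=> //; rewrite /graph/= JK.
have specE z u v : op_power ip E z (u, v) <-> loc E (cpow z) u v.
  by apply: (spectral_integralE Hip HPVM); exact: cmeasurable_cpow.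
(* Delta^(1/2) kills the range of E({0}), so S sends E({0}) u to 0; by symmetry of the graph S sends
   0 to E({0}) u, which must then vanish. *)
have E0 u : E [set 0] u = 0.
  have m0 : measurable [set (0 : R)] by exact: measurable_set1.
  have u0 : op_power ip E (2^-1)%:C (E [set 0] u, 0).
    apply/specE => B c e mB fB; rewrite sub0r.
    have [B0|B0] := pselect (B 0).
      have := fB _ B0; rewrite /cpow /= powR0 ?invr_neq0// mul0r sub0r => ce.
      rewrite -scaleNr (pvmZ HPVM)// hnormZ ler_wpM2r// hnorm_ge0//.
    rewrite -scaleNr (pvmZ HPVM)// (pvm_disj HPVM)// ?scaler0 ?hnorm0 ?mulr0//.
    by apply/seteqP; split=> // x [Bx /= x0]; rewrite x0 in Bx.
  have /SE : modular_S ip M xi0 (0, E [set 0] u).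
    by apply: (modular_S_sym Hip Mvn); apply/SE; rewrite (J0 Jlin).
  move=> /specE h; have h0 : loc E (cpow (2^-1)%:C) 0 0.
    move=> B c e mB fB; rewrite scaler0 subr0 (pvm0 HPVM)// hnorm0 mulr0//.
  rewrite -[LHS]JK (loc_unique Hip HPVM (cmeasurable_cpow _) h h0) (J0 Jlin)//.
have HQ := log_pvmP HPVM.
pose Q := log_pvm E; rewrite -/Q in HQ.
have opQ z u v : op_power ip E z (u, v) <-> loc Q (ex z) u v.
  exact: (op_powerE Hip HPVM E0).
have SQ u v : modular_S ip M xi0 (u, v) <-> loc Q (ex (2^-1 : R)%:C) u (J v).
  by split=> [/SE/opQ|/opQ/SE].
have [My [F [MF Fentire Fmod]]] := Hy.
have FP (t : R) u : exists2 a, loc Q (ex (- ('i * t%:C))) u a &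
    loc Q (ex ('i * t%:C)) (y a) (F t%:C u).
  have : graph (F t%:C) (u, F t%:C u) by [].
  rewrite Fmod => -[b [[a [/opQ ua]]]]; rewrite /graph/= => -> /opQ h.
  by exists a.
have Jxi0 : J xi0 = xi0 by exact: JP.
have Xxi : X (xi0, xi) by rewrite HXxi; exact: app_mem HD.1.
pose xi' := app X' xi0.
have X'xi' : X' (xi0, xi') by exact: app_mem HD.2.
have Sxi : modular_S ip M xi0 (xi, xi').
  by rewrite /xi' -HS -HXxi; exact: app_mem.
have xiE : loc Q (ex (2^-1 : R)%:C) xi ((lambda ^+ 2)%:C *: xi) by apply/opQ; case: Heig.
(* S xi is X^* xi0 by hypothesis, and J Delta^(1/2) xi = lambda^2 J xi by the eigenvalue
   equation. *)
have xi'E : xi' = (lambda ^+ 2)%:C *: J xi.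
  apply: (modular_S_unique Hip JK HQ SQ Sxi); apply/SQ.
  by rewrite (JZ Jlin) conjc_real JK.
have [[_ _ X1] Xd] := HX.
have X1' u v v' : X' (u, v) -> X' (u, v') -> v = v' by exact: (adj_unique Hip).
(* The commutant is J M J, hence closed under adjoints; commutation of X with the adjoint of z
   passes to commutation of the adjoint of X with z. *)
have XM' : affiliated M X'.
  move=> z [u v] /= Mz uv [a b] /= Xab.
  have [z0 Mz0 z0E] : [set J \o a \o J | a in M] z by rewrite JM.
  have [c Mc z0c] := vna_adjoint Mvn Mz0.
  have zc : adjoint_of ip z (fun u => J (c (J u))).
    move=> p q; rewrite -z0E /= -{1}(JK q) -{2}(JK p) !Jip.
    by rewrite (adjoint_of_sym z0c).
  have cM : commutant M (fun u => J (c (J u))) by exact: (J_commutant JM).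
  have cz := adjoint_of_sym zc.
  rewrite -!cz; exact: (uv _ (HXM _ _ cM Xab)).
have lam0 : lambda != 0 by rewrite gt_eqF.
(* J inverts the eigenvalue, so [xi'] satisfies for 1/lambda what [xi] satisfies for lambda, and the
   pair may be exchanged. *)
have xi'Q : loc Q (ex (2^-1 : R)%:C) xi' ((lambda^-1 ^+ 2)%:C *: xi').
  have h := half_power_J Hip Mvn JK SQ xiE.
  rewrite (JZ Jlin) conjc_real -xi'E in h.
  by rewrite xi'E scalerA -rmorphM/= -exprMn mulVf// expr1n scale1r -xi'E.
have xiE' : xi = (lambda^-1 ^+ 2)%:C *: J xi'.
  rewrite xi'E (JZ Jlin) conjc_real JK scalerA -rmorphM/= -exprMn mulVf//.
  by rewrite expr1n scale1r.
have [e1 e2 e3 e4] := derivation_intertwines Hip Mvn Jlin JK Jip JM Jxi0 HQ opQ SQ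
  My MF Fentire FP X1 X1' HXM XM' Xxi X'xi' Hlambda xiE xi'E.
have linv : 0 < lambda^-1 by rewrite invr_gt0.
have [f1 f2 f3 f4] := derivation_intertwines Hip Mvn Jlin JK Jip JM Jxi0 HQ opQ SQ
  My MF Fentire FP X1' X1 XM' HXM X'xi' Xxi linv xi'Q xiE'.
by [].
Qed.
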